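(* Let $\mathrm{ACF}_0$ be the usual first-order axioms for algebraically closed fields of characteristic $0$. For each axiom $\varphi$ of $\mathrm{ACF}_0$, let $\varphi^{*}$ be the first-order sentence in the language of planes asserting that the coordinatizing field of the plane satisfies $\varphi$. (i) Let $T_{\parallel}$ be the first-order theory of Pappian parallelity planes, in the two-sorted vocabulary of points and lines with incidence $I$ and parallelism $\parallel$. Then $T_{\parallel}\cup\{\varphi^{*}:\varphi\in \mathrm{ACF}_0\}$ axiomatizes the complete first-order theory of the complex affine plane $(\text{points},\text{lines}; I,\parallel)$ over $\mathbb{C}$. (ii) Let $T_{\perp}$ be the first-order theory of Wu-orthogonal planes, in the two-sorted vocabulary of points and lines with incidence $I$ and orthogonality $\perp$. Then $T_{\perp}\cup\{\varphi^{*}:\varphi\in \mathrm{ACF}_0\}$ axiomatizes the complete first-order theory of the complex affine plane $(\text{points},\text{lines}; I,\perp)$ over $\mathbb{C}$ equipped with its orthogonality relation. Here ''a set $S$ of sentences axiomatizes the complete theory of a structure $M$'' means that $M\models S$ and every sentence true in $M$ is a logical consequence of $S$.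
   Context: **Incidence plane.** A two-sorted structure of points and lines with an incidence relation $I(P,\ell)$ such that any two distinct points $A,B$ lie on exactly one line (denoted $AB$), every line contains at least two points, and there are three non-collinear points. Two lines are parallel, $\ell_1\parallel\ell_2$, if they are equal or have no common point. **Parallelity (affine) plane.** An incidence plane, with the relation $\parallel$ on lines ($\ell_1\parallel\ell_2$ iff $\ell_1$ and $\ell_2$ are equal or have no common point) in the vocabulary, such that for every line $\ell$ and point $A$ there is exactly one line through $A$ parallel to $\ell$. **Pappian.** A parallelity plane is Pappian if, for distinct points $A_1,A_2,A_3$ on a line $\ell_1$ and distinct points $B_1,B_2,B_3$ on a line $\ell_2\neq \ell_1$ (all six points distinct), $$(A_1B_2\parallel A_2B_1\ \wedge\ A_2B_3\parallel A_3B_2)\rightarrow A_1B_3\parallel A_3B_1 .$$ **Wu-orthogonal plane.** An incidence plane with a binary relation $\perp$ on lines, in which every line is infinite, through every point there is exactly one parallel to each line (where $\ell_1\parallel\ell_2$ is the defined relation that $\ell_1$ and $\ell_2$ are equal or have no common point), and the following hold. - (O-1) $\ell_1\perp\ell_2\leftrightarrow\ell_2\perp\ell_1$. - (O-2) For every point $O$ and line $\ell_1$ there is exactly one line $\ell_2$ with $\ell_1\perp\ell_2$ and $I(O,\ell_2)$. - (O-3) $(\ell_1\perp\ell_2\wedge\ell_1\perp\ell_3)\rightarrow\ell_2\parallel\ell_3$. - (O-4) For every point $O$ there is a line $\ell$ with $I(O,\ell)$ and $\ell\not\perp\ell$. - (O-5) The three heights of a triangle (for each vertex, the line through that vertex orthogonal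 to the opposite side) meet in one point. - (Desargues, two forms) Let $ABC$ and $A'B'C'$ be triangles with $A\ne A'$, $B\neq B'$, $C\neq C'$ such that the lines $AA',BB',CC'$ are pairwise distinct and are either (first form) pairwise parallel or (second form) concurrent in a single point. If $AB\parallel A'B'$ and $AC\parallel A'C'$, then $BC\parallel B'C'$. It is known that Wu-orthogonal planes satisfy the Pappian condition. **Coordinatizing field.** Let $O,E,E'$ be non-collinear points of a Pappian parallelity plane or of a Wu-orthogonal plane, $\ell=OE$, $\ell'=OE'$. The underlying set is the set of points on $\ell$, with $0=O$ and $1=E$. For $A,B$ on $\ell$: - Sum: let $P$ be the intersection of the line through $A$ parallel to $\ell'$ with the line through $E'$ parallel to $\ell$; $A+B$ is the intersection with $\ell$ of the line through $P$ parallel to $E'B$. - Product: let $B'$ be the intersection with $\ell'$ of the line through $B$ parallel to $EE'$; $A\cdot B$ is the intersection with $\ell$ of the line through $B'$ parallel to $E'A$. It is known that in Pappian planes this is a commutative field whose isomorphism type does not depend on the choice of $O,E,E'$. The sentence $\varphi^*$ says: for all non-collinear $O,E,E'$, the field so defined satisfies $\varphi$. **Complex affine plane.** The points are the elements of $\mathbb{C}^2$; the lines are the solution sets of linear equations $\alpha x_1+\beta x_2+\gamma=0$ with $\alpha,\beta,\gamma\in\mathbb{C}$, $(\alpha,\beta)\ne(0,0)$; $I$ is membership, and $\ell_1\parallel\ell_2$ iff $\ell_1$ and $\ell_2$ are equal or have no common point. For (ii), lines with direction vectors $(u_1,u_2)$ and $(v_1,v_2)$ are orthogonal iff $u_1v_1+u_2v_2=0$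 (the symmetric bilinear form associated with $x_1^2+x_2^2$). *)

(* Defs.v *)
From mathcomp Require Import all_boot all_order all_algebra.
From mathcomp Require Import boolp classical_sets cardinality reals complex.
From Stdlib Require List.

Set Implicit Arguments.
Unset Strict Implicit.
Unset Printing Implicit Defensive.

Import GRing.Theory.
Local Open Scope ring_scope.
Local Open Scope classical_set_scope.
Local Open Scope complex_scope.

(* [pl_rel] interprets the binary relation symbol on lines: parallelism in one
   vocabulary, orthogonality in the other. *)
Record plane := Plane {
  pl_point : Type;
  pl_line : Type;
  pl_inc : pl_point -> pl_line -> Prop;
  pl_rel : pl_line -> pl_line -> Prop }.

Section Planes.
Variable M : plane.
Local Notation point := (pl_point M).
Local Notation line := (pl_line M).
Local Notation I := (@pl_inc M).
Local Notation rel := (@pl_rel M).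

Definition collinear (A B C : point) : Prop := exists l, [/\ I A l, I B l & I C l].

Definition parallel (l1 l2 : line) : Prop := l1 = l2 \/ ~ exists P, I P l1 /\ I P l2.

(* [joins A B l] means l = AB only for distinct A and B. *)
Definition joins (A B : point) (l : line) : Prop := I A l /\ I B l.

Record incidence_plane : Prop := {
  inc_join : forall A B, A <> B -> exists! l, joins A B l;
  inc_two : forall l, exists A B, [/\ A <> B, I A l & I B l];
  inc_three : exists A B C, ~ collinear A B C }.

Record parallelity_plane : Prop := {
  par_inc : incidence_plane;
  par_rel : forall l1 l2, rel l1 l2 <-> parallel l1 l2;
  par_unique : forall l A, exists! m, I A m /\ rel m l }.

Definition pappian : Prop :=
  forall (l1 l2 : line) (A1 A2 A3 B1 B2 B3 : point),
    l1 <> l2 -> List.NoDup [:: A1; A2; A3; B1; B2; B3] ->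
    [/\ I A1 l1, I A2 l1 & I A3 l1] -> [/\ I B1 l2, I B2 l2 & I B3 l2] ->
  forall m12 m21 m23 m32 m13 m31 : line,
    joins A1 B2 m12 -> joins A2 B1 m21 ->
    joins A2 B3 m23 -> joins A3 B2 m32 ->
    joins A1 B3 m13 -> joins A3 B1 m31 ->
  rel m12 m21 /\ rel m23 m32 -> rel m13 m31.

Definition pappian_parallelity_plane : Prop := parallelity_plane /\ pappian.

Definition heights_concur : Prop :=
  forall (A B C : point) (a b c ha hb hc : line),
    ~ collinear A B C -> joins B C a -> joins A C b -> joins A B c ->
    I A ha /\ rel ha a -> I B hb /\ rel hb b -> I C hc /\ rel hc c ->
  exists! H, [/\ I H ha, I H hb & I H hc].

Definition desargues : Prop :=
  forall (A B C A' B' C' : point) (a b c : line),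
    ~ collinear A B C -> ~ collinear A' B' C' ->
    [/\ A <> A', B <> B' & C <> C'] ->
    [/\ joins A A' a, joins B B' b & joins C C' c] ->
    [/\ a <> b, a <> c & b <> c] ->
    [/\ parallel a b, parallel a c & parallel b c]
      \/ (exists O, [/\ I O a, I O b & I O c]) ->
  forall ab ab' ac ac' bc bc' : line,
    joins A B ab -> joins A' B' ab' ->
    joins A C ac -> joins A' C' ac' ->
    joins B C bc -> joins B' C' bc' ->
  parallel ab ab' -> parallel ac ac' -> parallel bc bc'.

Record wu_orthogonal_plane : Prop := {
  wu_inc : incidence_plane;
  wu_infinite : forall l, infinite_set [set P | I P l];
  wu_parallel : forall l A, exists! m, I A m /\ parallel m l;
  wu_O1 : forall l1 l2, rel l1 l2 <-> rel l2 l1;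
  wu_O2 : forall O l1, exists! l2, rel l1 l2 /\ I O l2;
  wu_O3 : forall l1 l2 l3, rel l1 l2 /\ rel l1 l3 -> parallel l2 l3;
  wu_O4 : forall O, exists l, I O l /\ ~ rel l l;
  wu_O5 : heights_concur;
  wu_desargues : desargues }.

(* X lies on the line through Y that is parallel to the line AB (A <> B). *)
Definition on_parallel (X Y A B : point) : Prop :=
  exists m n, [/\ joins X Y m, joins A B n & parallel m n].

(* The graph A + B = C. *)
Definition coord_sum (O E E' A B C : point) : Prop :=
  exists P, [/\ on_parallel P A O E', on_parallel P E' O E,
                on_parallel C P E' B & collinear C O E].

(* The graph A . B = C. *)
Definition coord_prod (O E E' A B C : point) : Prop :=
  exists B', [/\ collinear B' O E', on_parallel B' B E E',
                 on_parallel C B' E' A & collinear C O E].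

(* f identifies K with the coordinatizing field of M relative to O, E, E'. *)
Record coordinatizes (O E E' : point) (K : nzRingType) (f : K -> point) : Prop := {
  coord_inj : injective f;
  coord_onto : forall P, collinear P O E <-> exists a, P = f a;
  coord_0 : f 0 = O;
  coord_1 : f 1 = E;
  coord_add : forall a b P, coord_sum O E E' (f a) (f b) P <-> P = f (a + b);
  coord_mul : forall a b P, coord_prod O E E' (f a) (f b) P <-> P = f (a * b) }.

End Planes.

(* [var n] has n elements, read as de Bruijn indices: [None] is the variable
   bound by the innermost quantifier and [Some] shifts past it. *)
Fixpoint var (n : nat) : Set := if n is n'.+1 then option (var n') else void.

Definition env0 {T : Type} : var 0 -> T := fun v => match v with end.

Definition ext {T : Type} {n : nat} (e : var n -> T) (a : T) : var n.+1 -> T :=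
  fun v => if v is Some v' then e v' else a.

Inductive rterm (n : nat) : Set :=
| RVar of var n
| RZero
| ROne
| RAdd of rterm n & rterm n
| RMul of rterm n & rterm n.

Inductive rform (n : nat) : Set :=
| RBot
| REq of rterm n & rterm n
| RAnd of rform n & rform n
| ROr of rform n & rform n
| RImp of rform n & rform n
| RAll of rform n.+1
| REx of rform n.+1.

Arguments RZero {n}.
Arguments ROne {n}.
Arguments RBot {n}.

Fixpoint reval (K : nzRingType) n (e : var n -> K) (t : rterm n) : K :=
  match t with
  | RVar v => e v
  | RZero => 0
  | ROne => 1
  | RAdd t u => reval e t + reval e u
  | RMul t u => reval e t * reval e u
  end.

Fixpoint rsat (K : nzRingType) n (e : var n -> K) (p : rform n) : Prop :=
  match p with
  | RBot => False
  | REq t u => reval e t = reval e u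
  | RAnd p q => rsat e p /\ rsat e q
  | ROr p q => rsat e p \/ rsat e q
  | RImp p q => rsat e p -> rsat e q
  | RAll p => forall a, rsat (ext e a) p
  | REx p => exists a, rsat (ext e a) p
  end.

Definition RNot n (p : rform n) : rform n := RImp p RBot.

Fixpoint rclose n : rform n -> rform 0 :=
  if n is n'.+1 then fun p => rclose (RAll p) else id.

Fixpoint rrename m n (f : var m -> var n) (t : rterm m) : rterm n :=
  match t with
  | RVar v => RVar (f v)
  | RZero => RZero
  | ROne => ROne
  | RAdd t u => RAdd (rrename f t) (rrename f u)
  | RMul t u => RMul (rrename f t) (rrename f u)
  end.

Fixpoint rnat n (k : nat) : rterm n :=
  if k is k'.+1 then RAdd (rnat n k') ROne else RZero.

(* The general monic polynomial of degree n in Horner form; index 0 is the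
   unknown, the indices 1, ..., n are the coefficients of degrees 0, ..., n-1. *)
Fixpoint rmonic (n : nat) : rterm n.+1 :=
  if n is n'.+1 then
    RAdd (RMul (rrename (omap Some : var n'.+1 -> var n'.+2) (rmonic n'))
               (RVar (None : var n'.+2)))
         (RVar (Some None : var n'.+2))
  else ROne.

Section ACF.
Local Notation x0 := (@RVar _.+1 None).
Local Notation x1 := (@RVar _.+2 (Some None)).
Local Notation x2 := (@RVar _.+3 (Some (Some None))).
Local Infix "+" := RAdd.
Local Infix "*" := RMul.
Local Infix "==" := REq.

Inductive ACF0 : rform 0 -> Prop :=
| acf_addA : ACF0 (rclose (n := 3) (x0 + (x1 + x2) == (x0 + x1) + x2))
| acf_addC : ACF0 (rclose (n := 2) (x0 + x1 == x1 + x0))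
| acf_add0 : ACF0 (rclose (n := 1) (x0 + RZero == x0))
| acf_addN : ACF0 (rclose (n := 1) (REx (x1 + x0 == RZero)))
| acf_mulA : ACF0 (rclose (n := 3) (x0 * (x1 * x2) == (x0 * x1) * x2))
| acf_mulC : ACF0 (rclose (n := 2) (x0 * x1 == x1 * x0))
| acf_mul1 : ACF0 (rclose (n := 1) (x0 * ROne == x0))
| acf_mulD : ACF0 (rclose (n := 3) (x0 * (x1 + x2) == x0 * x1 + x0 * x2))
| acf_neq01 : ACF0 (RNot (RZero == ROne))
| acf_mulV :
    ACF0 (rclose (n := 1) (RImp (RNot (x0 == RZero)) (REx (x1 * x0 == ROne))))
| acf_char p : prime p -> ACF0 (RNot (rnat 0 p == RZero))
| acf_root n : (0 < n)%N -> ACF0 (rclose (REx (rmonic n == RZero))).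

End ACF.

(* [pform m n]: formulas with m free point variables and n free line variables. *)
Inductive pform (m n : nat) : Set :=
| PBot
| PEqPoint of var m & var m
| PEqLine of var n & var n
| PInc of var m & var n
| PRel of var n & var n
| PAnd of pform m n & pform m n
| POr of pform m n & pform m n
| PImp of pform m n & pform m n
| PAllPoint of pform m.+1 n
| PExPoint of pform m.+1 n
| PAllLine of pform m n.+1
| PExLine of pform m n.+1.

Arguments PBot {m n}.
Arguments PEqPoint {m n}.
Arguments PEqLine {m n}.

Fixpoint psat (M : plane) m n (e : var m -> pl_point M) (d : var n -> pl_line M)
    (p : pform m n) : Prop :=
  match p with
  | PBot => False
  | PEqPoint x y => e x = e y
  | PEqLine k l => d k = d l
  | PInc x k => pl_inc (e x) (d k)
  | PRel k l => pl_rel (d k) (d l)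
  | PAnd p q => psat e d p /\ psat e d q
  | POr p q => psat e d p \/ psat e d q
  | PImp p q => psat e d p -> psat e d q
  | PAllPoint p => forall A, psat (ext e A) d p
  | PExPoint p => exists A, psat (ext e A) d p
  | PAllLine p => forall l, psat e (ext d l) p
  | PExLine p => exists l, psat e (ext d l) p
  end.

Definition psentence : Set := pform 0 0.

Definition models (M : plane) (s : psentence) : Prop := psat (M := M) env0 env0 s.

Definition theory_of (K : plane -> Prop) : set psentence :=
  [set s | forall M, K M -> models M s].

Definition axiomatizes (S : set psentence) (M : plane) : Prop :=
  (forall s, S s -> models M s) /\
  (forall s, models M s -> forall N, (forall t, S t -> models N t) -> models N s).

Section Translation.

Definition PNot m n (p : pform m n) : pform m n := PImp p PBot.

(* Parallelism is expressed by incidence, so that the same formulas serve in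
   both vocabularies. *)
Definition Pparallel m n (k l : var n) : pform m n :=
  POr (PEqLine k l)
      (PNot (PExPoint (PAnd (PInc (None : var m.+1) k) (PInc (None : var m.+1) l)))).

Definition Pcollinear m n (x y z : var m) : pform m n :=
  let l : var n.+1 := None in
  PExLine (PAnd (PInc x l) (PAnd (PInc y l) (PInc z l))).

Definition Pon_parallel m n (x y a b : var m) : pform m n :=
  let k : var n.+2 := Some None in let l : var n.+2 := None in
  PExLine (PExLine
    (PAnd (PAnd (PInc x k) (PInc y k))
    (PAnd (PAnd (PInc a l) (PInc b l)) (Pparallel m k l)))).

Definition Psum m n (o e e' a b c : var m) : pform m n :=
  let p : var m.+1 := None in
  let s : var m -> var m.+1 := Some in
  PExPoint
    (PAnd (Pon_parallel n p (s a) (s o) (s e'))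
    (PAnd (Pon_parallel n p (s e') (s o) (s e))
    (PAnd (Pon_parallel n (s c) p (s e') (s b))
          (Pcollinear n (s c) (s o) (s e))))).

Definition Pprod m n (o e e' a b c : var m) : pform m n :=
  let b' : var m.+1 := None in
  let s : var m -> var m.+1 := Some in
  PExPoint
    (PAnd (Pcollinear n b' (s o) (s e'))
    (PAnd (Pon_parallel n b' (s b) (s e) (s e'))
    (PAnd (Pon_parallel n (s c) b' (s e') (s a))
          (Pcollinear n (s c) (s o) (s e))))).

(* The formula "the value of t is the point c", the ring variable v being
   represented by the point variable f v. *)
Fixpoint Pterm k m (f : var k -> var m) (o e e' : var m) (t : rterm k) (c : var m) :
    pform m 0 :=
  let s : var m -> var m.+2 := fun x => Some (Some x) in
  let a : var m.+2 := Some None in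
  let b : var m.+2 := None in
  match t with
  | RVar v => PEqPoint c (f v)
  | RZero => PEqPoint c o
  | ROne => PEqPoint c e
  | RAdd t u => PExPoint (PExPoint
      (PAnd (Pterm (fun v => s (f v)) (s o) (s e) (s e') t a)
      (PAnd (Pterm (fun v => s (f v)) (s o) (s e) (s e') u b)
            (Psum 0 (s o) (s e) (s e') a b (s c)))))
  | RMul t u => PExPoint (PExPoint
      (PAnd (Pterm (fun v => s (f v)) (s o) (s e) (s e') t a)
      (PAnd (Pterm (fun v => s (f v)) (s o) (s e) (s e') u b)
            (Pprod 0 (s o) (s e) (s e') a b (s c)))))
  end.

(* The formula "the coordinatizing field relative to o, e, e' satisfies p". *)
Fixpoint Pfield k m (f : var k -> var m) (o e e' : var m) (p : rform k) : pform m 0 :=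
  let s : var m -> var m.+1 := Some in
  let c : var m.+1 := None in
  match p with
  | RBot => PBot
  | REq t u => PExPoint
      (PAnd (Pterm (fun v => s (f v)) (s o) (s e) (s e') t c)
            (Pterm (fun v => s (f v)) (s o) (s e) (s e') u c))
  | RAnd p q => PAnd (Pfield f o e e' p) (Pfield f o e e' q)
  | ROr p q => POr (Pfield f o e e' p) (Pfield f o e e' q)
  | RImp p q => PImp (Pfield f o e e' p) (Pfield f o e e' q)
  | RAll p => PAllPoint
      (PImp (Pcollinear 0 c (s o) (s e))
            (Pfield (ext (fun v => s (f v)) c) (s o) (s e) (s e') p))
  | REx p => PExPoint
      (PAnd (Pcollinear 0 c (s o) (s e))
            (Pfield (ext (fun v => s (f v)) c) (s o) (s e) (s e') p))
  end.

Definition star (p : rform 0) : psentence :=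
  let o : var 3 := Some (Some None) in
  let e : var 3 := Some None in
  let e' : var 3 := None in
  PAllPoint (PAllPoint (PAllPoint
    (PImp (PNot (Pcollinear 0 o e e')) (Pfield env0 o e e' p)))).

End Translation.

Section Correctness.
Variables (M : plane).

Lemma psat_collinear m n (e : var m -> pl_point M) (d : var n -> pl_line M) x y z :
  psat e d (Pcollinear n x y z) <-> collinear (e x) (e y) (e z).
Proof.
by split=> [[l [? [? ?]]]|[l [? ? ?]]]; exists l.
Qed.

Lemma psat_on_parallel m n (e : var m -> pl_point M) (d : var n -> pl_line M) x y a b :
  psat e d (Pon_parallel n x y a b) <-> on_parallel (e x) (e y) (e a) (e b).
Proof.
split=> [[k [l [? [? ?]]]]|[k [l [? ? ?]]]]; by exists k, l.
Qed.

Let psatD m n (e : var m -> pl_point M) (d : var n -> pl_line M) p q :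
  psat e d (PAnd p q) = (psat e d p /\ psat e d q).
Proof. by []. Qed.

Let psatX m n (e : var m -> pl_point M) (d : var n -> pl_line M) p :
  psat e d (PExPoint p) = (exists A, psat (ext e A) d p).
Proof. by []. Qed.

Let psatI m n (e : var m -> pl_point M) (d : var n -> pl_line M) p q :
  psat e d (PImp p q) = (psat e d p -> psat e d q).
Proof. by []. Qed.

Let psatA m n (e : var m -> pl_point M) (d : var n -> pl_line M) p :
  psat e d (PAllPoint p) = (forall A, psat (ext e A) d p).
Proof. by []. Qed.

Lemma psat_sum m n (e : var m -> pl_point M) (d : var n -> pl_line M) o u u' a b c :
  psat e d (Psum n o u u' a b c) <->
  coord_sum (e o) (e u) (e u') (e a) (e b) (e c).
Proof.
rewrite /Psum psatX; split=> -[P]; first rewrite !psatD.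
  by move=> [/psat_on_parallel ? [/psat_on_parallel ?
    [/psat_on_parallel ? /psat_collinear ?]]]; exists P.
move=> [? ? ? ?]; exists P; rewrite !psatD.
by split; [|split; [|split]]; try exact/psat_on_parallel; exact/psat_collinear.
Qed.

Lemma psat_prod m n (e : var m -> pl_point M) (d : var n -> pl_line M) o u u' a b c :
  psat e d (Pprod n o u u' a b c) <->
  coord_prod (e o) (e u) (e u') (e a) (e b) (e c).
Proof.
rewrite /Pprod psatX; split=> -[P]; first rewrite !psatD.
  by move=> [/psat_collinear ? [/psat_on_parallel ?
    [/psat_on_parallel ? /psat_collinear ?]]]; exists P.
move=> [? ? ? ?]; exists P; rewrite !psatD.
by split; [|split; [|split]]; try exact/psat_on_parallel; exact/psat_collinear.
Qed.

Variables (O E E' : pl_point M) (K : nzRingType) (g : K -> pl_point M).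
Hypothesis gP : coordinatizes O E E' g.

Lemma psat_term k (t : rterm k) m (f : var k -> var m) (o u u' c : var m)
    (e : var m -> pl_point M) (r : var k -> K) :
  e o = O -> e u = E -> e u' = E' -> (forall v, e (f v) = g (r v)) ->
  psat e env0 (Pterm f o u u' t c) <-> e c = g (reval r t).
Proof.
elim: t m f o u u' c e => [v|||t IHt w IHw|t IHt w IHw] m f o u u' c e eo eu eu' ef.
- by rewrite /= ef.
- by rewrite /= eo (coord_0 gP).
- by rewrite /= eu (coord_1 gP).
- rewrite [Pterm _ _ _ _ _ _]/= psatX; split=> [[A]|ec].
    rewrite psatX => -[B]; rewrite !psatD.
    move=> [/IHt At [/IHw Bw /psat_sum]].
    have {At}/= At := At eo eu eu' ef; have {Bw}/= Bw := Bw eo eu eu' ef.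
    by rewrite /= At Bw eo eu eu' => /(coord_add gP).
  exists (g (reval r t)); rewrite psatX; exists (g (reval r w)); rewrite !psatD.
  split; [exact/IHt|split; [exact/IHw|]].
  by apply/psat_sum; rewrite /= eo eu eu'; apply/(coord_add gP).
- rewrite [Pterm _ _ _ _ _ _]/= psatX; split=> [[A]|ec].
    rewrite psatX => -[B]; rewrite !psatD.
    move=> [/IHt At [/IHw Bw /psat_prod]].
    have {At}/= At := At eo eu eu' ef; have {Bw}/= Bw := Bw eo eu eu' ef.
    by rewrite /= At Bw eo eu eu' => /(coord_mul gP).
  exists (g (reval r t)); rewrite psatX; exists (g (reval r w)); rewrite !psatD.
  split; [exact/IHt|split; [exact/IHw|]].
  by apply/psat_prod; rewrite /= eo eu eu'; apply/(coord_mul gP).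
Qed.

Lemma psat_field k (p : rform k) m (f : var k -> var m) (o u u' : var m)
    (e : var m -> pl_point M) (r : var k -> K) :
  e o = O -> e u = E -> e u' = E' -> (forall v, e (f v) = g (r v)) ->
  psat e env0 (Pfield f o u u' p) <-> rsat r p.
Proof.
elim: p m f o u u' e r => {k} [k|k t w|k p IHp q IHq|k p IHp q IHq|k p IHp q IHq
  |k p IHp|k p IHp] m f o u u' e r eo eu eu' ef.
- by [].
- have tE t' A : psat (ext e A) env0
      (Pterm (m := m.+1) (fun v => Some (f v)) (Some o) (Some u) (Some u') t' None)
      <-> A = g (reval r t') by exact: psat_term.
  split=> [[A [/tE tA /tE wA]]|/= tw].
    by apply: (coord_inj gP); rewrite -tA.
  by exists (g (reval r t)); split; apply/tE; rewrite // tw.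
- have [p1 p2] := IHp m f o u u' e r eo eu eu' ef.
  have [q1 q2] := IHq m f o u u' e r eo eu eu' ef.
  by split=> -[? ?]; split; auto.
- have [p1 p2] := IHp m f o u u' e r eo eu eu' ef.
  have [q1 q2] := IHq m f o u u' e r eo eu eu' ef.
  by split=> -[?|?]; [left|right|left|right]; auto.
- have [p1 p2] := IHp m f o u u' e r eo eu eu' ef.
  have [q1 q2] := IHq m f o u u' e r eo eu eu' ef.
  by split=> /= H => [/p2/H/q1|/p1/H/q2].
- have IH a : psat (ext e (g a)) env0
      (Pfield (m := m.+1) (ext (fun v => Some (f v) : var m.+1) None)
        (Some o) (Some u) (Some u') p)
      <-> rsat (ext r a) p by apply: IHp => //; case.
  have cE A : psat (ext e A) env0 (Pcollinear 0 (None : var m.+1) (Some o) (Some u))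
      <-> exists a, A = g a by rewrite psat_collinear /= eo eu (coord_onto gP).
  rewrite [Pfield _ _ _ _ _]/= psatA; split=> H.
    by move=> a; apply/IH; move: (H (g a)); rewrite psatI; apply; apply/cE; exists a.
  by move=> A; rewrite psatI => /cE[a ->]; apply/IH/H.
- have IH a : psat (ext e (g a)) env0
      (Pfield (m := m.+1) (ext (fun v => Some (f v) : var m.+1) None)
        (Some o) (Some u) (Some u') p)
      <-> rsat (ext r a) p by apply: IHp => //; case.
  have cE A : psat (ext e A) env0 (Pcollinear 0 (None : var m.+1) (Some o) (Some u))
      <-> exists a, A = g a by rewrite psat_collinear /= eo eu (coord_onto gP).
  split=> [[A [/cE[a ->] /IH]]|[a /IH H]]; first by exists a.
  by exists (g a); split=> //; apply/cE; exists a.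
Qed.

End Correctness.

Theorem models_star (M : plane) (p : rform 0) :
  (forall O E E' : pl_point M, ~ collinear O E E' ->
     exists (K : nzRingType) (g : K -> pl_point M), coordinatizes O E E' g) ->
  models M (star p) <->
  (forall (O E E' : pl_point M) (K : nzRingType) (g : K -> pl_point M),
     ~ collinear O E E' -> coordinatizes O E E' g -> rsat (env0 : var 0 -> K) p).
Proof.
have starE : models M (star p) = forall O E E' : pl_point M,
    (psat (ext (ext (ext env0 O) E) E') env0
       (Pcollinear 0 (Some (Some None) : var 3) (Some None) None) -> False) ->
    psat (ext (ext (ext env0 O) E) E') env0
      (Pfield env0 (Some (Some None) : var 3) (Some None) None p) by [].
have fieldP O E E' K g : @coordinatizes M O E E' K g ->
    psat (ext (ext (ext env0 O) E) E') env0
      (Pfield env0 (Some (Some None) : var 3) (Some None) None p)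
    <-> rsat (env0 : var 0 -> K) p.
  by move=> gP; apply: (psat_field gP) => //; case.
rewrite starE => coordM; split=> [H O E E' K g OEE' gP|H O E E' nOEE'].
  by apply/(fieldP O E E' K g gP)/H => /psat_collinear.
have OEE' : ~ collinear O E E' by move=> OEE'; apply/nOEE'/psat_collinear.
have [K [g gP]] := coordM O E E' OEE'.
exact/(fieldP O E E' K g gP)/(H _ _ _ _ _ OEE' gP).
Qed.

Section ComplexPlane.
Variable R : realType.
Local Notation C := R[i].

Definition is_complex_line (L : set (C * C)) : Prop :=
  exists a b c : C, (a, b) <> (0, 0) /\
    L = [set x | a * x.1 + b * x.2 + c = 0].

Definition complex_line : Type := {L : set (C * C) | is_complex_line L}.

Definition complex_inc (P : C * C) (l : complex_line) : Prop := sval l P.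

Definition complex_parallel (l1 l2 : complex_line) : Prop :=
  l1 = l2 \/ ~ exists P, complex_inc P l1 /\ complex_inc P l2.

Definition direction (l : complex_line) (u : C * C) : Prop :=
  exists P Q, [/\ P <> Q, complex_inc P l, complex_inc Q l & u = Q - P].

Definition complex_orthogonal (l1 l2 : complex_line) : Prop :=
  exists u v, [/\ direction l1 u, direction l2 v & u.1 * v.1 + u.2 * v.2 = 0].

Definition complex_affine_plane : plane := Plane complex_inc complex_parallel.

Definition complex_orthogonal_plane : plane := Plane complex_inc complex_orthogonal.

End ComplexPlane.

(* Main.v *)
Require Import Defs.
From HB Require Import structures.
From mathcomp Require Import all_boot all_order all_algebra.
From mathcomp Require Import boolp classical_sets cardinality reals complex.
From mathcomp Require Import closed_field ring.
From Stdlib Require List.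

(** Fix a plane satisfying the sentences in question.  For every frame
    [O, E, E'] its starred axioms are the axioms of algebraically closed fields
    of characteristic 0 for the operations that the frame induces on the points
    of the line [OE]; these operations are total because two lines that are not
    parallel meet ([frame_arith_exists]), so the frame has a genuine closed
    field [K] ([closed_field_ACF0], [frame_field]).

    What remains is to see that lines become linear equations over [K].  The
    parallels to [EE'] identify the points of [OE'] with those of [OE], so that
    points get coordinates; the slope of a line is the point [a] of [OE] for
    which it is parallel to the line joining [E'] and [a].  By definition of the
    product, the line of slope [a] through the point [y] of [OE'] meets [OE] in
    [a * y]; by definition of the sum, the one through [(x, 1)] meets [OE] in
    [x + a].  The claim is that the one through [(x, y)] meets [OE] in
    [x + a * y].  Replacing [E'] by the point [y] of [OE'] gives a frame with
    the same product, whose sum of [x] and [a * y] is read off the line of slope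
    [a] through [(x, y)]; its distributive law therefore moves the claim from
    slope 1 to slope [a] ([slope_scaling]).  In the frame [O, E', E] the product
    is again the same, and the sum of [y] and [t] is read off the line of slope
    1 through [(t, y)]; its distributive law moves the claim for slope 1 from
    height 1, where it is the definition of the sum, to height [y]
    ([slope1_grid]).  Hence [slope_grid], and [plane_coordinates].

    In the orthogonal case the frame is chosen with orthogonal axes.  The
    heights of the triangle [(p, 0), (1, 0), (0, 1)] concur only if the product
    of the slopes of two orthogonal lines is a constant, so orthogonality is
    given by a diagonal quadratic form, and a square root in [K] turns this form
    into a sum of two squares ([orthogonal_coordinates]).

    So both the given plane and the complex one are coordinate planes over
    closed fields of characteristic 0 with the same equation for the relation.
    Eliminating quantifiers over points and lines turns a sentence, uniformly
    in the field, into a quantifier-free formula without variables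
    ([quantifier_elimination], [psat_defined]).  Its terms evaluate to integers,
    so its truth value is the same in all fields of characteristic 0
    ([coordinate_planes_equivalent]).

    Conversely the complex plane satisfies the axioms by computing with
    coordinates, and it satisfies the starred sentences because every frame is
    the standard frame of some coordinate system ([frame_coordinates],
    [standard_frame]). *)

Set Implicit Arguments.
Unset Strict Implicit.
Unset Printing Implicit Defensive.

Import GRing.Theory.
Local Open Scope ring_scope.

(** * Integer polynomials and quantifier-free formulas *)

(** Terms carry no coefficients from a field, so that one formula can be
    evaluated in all fields at once. *)
Inductive zterm (V : Type) : Type :=
| ZVar of V
| ZZero
| ZOne
| ZAdd of zterm V & zterm V
| ZOpp of zterm V
| ZMul of zterm V & zterm V.

Arguments ZZero {V}.
Arguments ZOne {V}.

Fixpoint zeval (V : Type) (K : pzRingType) (e : V -> K) (t : zterm V) : K :=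
  match t with
  | ZVar v => e v
  | ZZero => 0
  | ZOne => 1
  | ZAdd t u => zeval e t + zeval e u
  | ZOpp t => - zeval e t
  | ZMul t u => zeval e t * zeval e u
  end.

Inductive qform (V : Type) : Type :=
| QZero of zterm V
| QAnd of qform V & qform V
| QNot of qform V.

Fixpoint qsat (V : Type) (K : fieldType) (e : V -> K) (f : qform V) : bool :=
  match f with
  | QZero t => zeval e t == 0
  | QAnd f g => qsat e f && qsat e g
  | QNot f => ~~ qsat e f
  end.

Definition QOr V (f g : qform V) := QNot (QAnd (QNot f) (QNot g)).

Lemma qsat_or V (K : fieldType) (e : V -> K) f g :
  qsat e (QOr f g) = qsat e f || qsat e g.
Proof. by rewrite /= negb_and !negbK. Qed.

Definition oext (V T : Type) (e : V -> T) (x : T) : option V -> T :=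
  fun v => if v is Some v' then e v' else x.

Section CoefficientLists.
Variable V : Type.
Implicit Types (s r : seq (zterm V)) (a c : zterm V).

Definition zpoly (K : nzRingType) (e : V -> K) s : {poly K} :=
  Poly (map (zeval e) s).

Fixpoint zpoly_add s r :=
  match s, r with
  | [::], _ => r
  | _, [::] => s
  | a :: s', c :: r' => ZAdd a c :: zpoly_add s' r'
  end.

Definition zpoly_scale c s := map (ZMul c) s.

Fixpoint zpoly_mul s r :=
  if s is a :: s' then zpoly_add (zpoly_scale a r) (ZZero :: zpoly_mul s' r)
  else [::].

Fixpoint zpoly_of (t : zterm (option V)) : seq (zterm V) :=
  match t with
  | ZVar None => [:: ZZero; ZOne]
  | ZVar (Some v) => [:: ZVar v]
  | ZZero => [::]
  | ZOne => [:: ZOne]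
  | ZAdd t u => zpoly_add (zpoly_of t) (zpoly_of u)
  | ZOpp t => zpoly_scale (ZOpp ZOne) (zpoly_of t)
  | ZMul t u => zpoly_mul (zpoly_of t) (zpoly_of u)
  end.

(** One step of pseudo-division: [c] times the polynomial with lower
    coefficients [s] and leading coefficient [a], minus a multiple of the one
    with lower coefficients [r] and leading coefficient [c].  The leading terms
    cancel, so only the lower coefficients enter and the length drops by one. *)
Definition zpoly_reduce s a r c :=
  zpoly_add (zpoly_scale c s)
    (zpoly_scale (ZOpp a) (nseq (size s - size r) ZZero ++ r)).

Lemma size_zpoly_add s r : size (zpoly_add s r) = maxn (size s) (size r).
Proof.
elim: s r => [|a s IHs] [|c r]; rewrite ?max0n ?maxn0 //=.
by rewrite IHs maxnSS.
Qed.

Lemma size_zpoly_reduce s a r c :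
  (size r <= size s)%N -> size (zpoly_reduce s a r c) = size s.
Proof.
move=> le_rs; rewrite size_zpoly_add !size_map size_cat size_nseq subnK //.
exact: maxnn.
Qed.

Variables (K : closedFieldType) (e : V -> K).

Lemma zpoly_cons a s : zpoly e (a :: s) = zpoly e s * 'X + (zeval e a)%:P.
Proof. by rewrite /zpoly /= cons_poly_def. Qed.

Lemma zpoly_cat s r : zpoly e (s ++ r) = zpoly e s + zpoly e r * 'X^(size s).
Proof.
elim: s => [|a s IHs] /=; first by rewrite expr0 mulr1 /zpoly /= add0r.
by rewrite !zpoly_cons IHs exprSr mulrDl mulrA addrAC.
Qed.

Lemma zpoly_rcons s a :
  zpoly e (rcons s a) = zpoly e s + zeval e a *: 'X^(size s).
Proof.
by rewrite -cats1 zpoly_cat zpoly_cons /zpoly /= mul0r add0r mul_polyC.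
Qed.

Lemma zpoly_nseq0 n : zpoly e (nseq n ZZero) = 0.
Proof. by elim: n => //= n IHn; rewrite zpoly_cons IHn mul0r add0r. Qed.

Lemma zpoly_addE s r : zpoly e (zpoly_add s r) = zpoly e s + zpoly e r.
Proof.
elim: s r => [|a s IHs] [|c r] /=; rewrite ?add0r ?addr0 //.
by rewrite !zpoly_cons IHs /= polyCD mulrDl addrACA.
Qed.

Lemma zpoly_scaleE c s : zpoly e (zpoly_scale c s) = zeval e c *: zpoly e s.
Proof.
elim: s => [|a s IHs] /=; first by rewrite /zpoly /= scaler0.
by rewrite !zpoly_cons IHs /= polyCM -!mul_polyC mulrDr mulrA.
Qed.

Lemma zpoly_mulE s r : zpoly e (zpoly_mul s r) = zpoly e s * zpoly e r.
Proof.
elim: s => [|a s IHs] /=; first by rewrite mul0r.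
rewrite zpoly_addE zpoly_scaleE !zpoly_cons IHs /= addr0 mulrDl mul_polyC addrC.
by congr (_ + _); rewrite mulrAC.
Qed.

Lemma zpoly_ofE x t : (zpoly e (zpoly_of t)).[x] = zeval (oext e x) t.
Proof.
elim: t => [[v|]|||t IHt u IHu|t IHt|t IHt u IHu] /=.
- by rewrite zpoly_cons /zpoly /= mul0r add0r hornerC.
- by rewrite !zpoly_cons /zpoly /= mul0r add0r addr0 mul1r hornerX.
- by rewrite /zpoly horner0.
- by rewrite zpoly_cons /zpoly /= mul0r add0r hornerC.
- by rewrite zpoly_addE hornerD IHt IHu.
- by rewrite zpoly_scaleE hornerZ IHt /= mulN1r.
- by rewrite zpoly_mulE hornerM IHt IHu.
Qed.

Lemma zpoly_reduceE s a r c : (size r <= size s)%N ->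
  zeval e c *: zpoly e (rcons s a) =
  zpoly e (zpoly_reduce s a r c)
  + zeval e a *: 'X^(size s - size r) * zpoly e (rcons r c).
Proof.
move=> le_rs; rewrite zpoly_addE !zpoly_scaleE zpoly_cat zpoly_nseq0 add0r /=.
rewrite size_nseq !zpoly_rcons mulrDr -!mul_polyC polyCN.
rewrite -{1}(subnK le_rs) exprD.
set A := (zeval e a)%:P; set C := (zeval e c)%:P; set Xd := 'X^(_ - _).
set Xr := 'X^(size r); set S := zpoly e s; set R := zpoly e r.
rewrite mulrDr mulNr -[A * (R * Xd)]mulrCA [R * (_ * _)]mulrC addrA addrNK.
by congr (_ + _); rewrite !mulrA [C * A]mulrC -!mulrA [C * (Xd * _)]mulrCA.
Qed.

Lemma zpoly_eq0 s : (zpoly e s == 0) = all (fun a => zeval e a == 0) s.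
Proof.
elim: s => [|a s IHs]; first by rewrite /zpoly /= eqxx.
rewrite zpoly_cons /= -IHs; have [->|nz_s] := eqVneq (zpoly e s) 0.
  by rewrite mul0r add0r polyC_eq0 andbT.
rewrite andbF -size_poly_eq0 size_MXaddC (negPf nz_s) /=.
by [].
Qed.

End CoefficientLists.

(** Over a closed field [p] is a product of linear factors, at most [size p]
    of them.  If every root of [p] is a root of [q], each factor divides [q],
    hence [p] divides this power of [q].  Divisibility, unlike the existence of
    a root, can be tested on the coefficients. *)
Lemma root_nonroot_dvdp (K : closedFieldType) (p q : {poly K}) : p != 0 ->
  (exists x, p.[x] = 0 /\ q.[x] <> 0) <-> ~~ (p %| q ^+ (size p)).
Proof.
move=> nz_p; split=> [[x [px0 qx0]]|].
  apply/negP => /dvdpP[r /(congr1 (horner^~ x))].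
  rewrite hornerM px0 mulr0 horner_exp => /eqP; rewrite expf_eq0.
  by move=> /andP[_ /eqP].
have [rs Dp] := closed_field_poly_normal p => ndvd.
have nz_lc : lead_coef p != 0 by rewrite lead_coef_eq0.
have [/hasP[x rs_x qx0]|/hasPn q0] := boolP (has (fun x => q.[x] != 0) rs).
  exists x; split; last exact/eqP.
  apply/eqP; rewrite [p]Dp -rootE rootZ //.
  by rewrite root_prod_XsubC.
case/negP: ndvd; rewrite [X in X %| _]Dp dvdpZl //.
have le_rs : (size rs <= size p)%N.
  by rewrite [p]Dp size_scale // size_prod_XsubC.
apply: (@dvdp_trans _ (q ^+ size rs)); last by rewrite dvdp_exp2l.
elim: rs q0 {Dp le_rs} => [|x rs IHrs] q0; first by rewrite big_nil expr0 dvdpp.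
rewrite big_cons exprS dvdp_mul //.
  rewrite dvdp_XsubCl rootE; have := q0 x (mem_head _ _).
  by rewrite negbK.
by apply: IHrs => y rs_y; apply: q0; rewrite inE rs_y orbT.
Qed.

(** A root of [q - 1] is not a root of [q]; there is one unless [q] is
    constant. *)
Lemma nonroot_exists (K : closedFieldType) (q : {poly K}) :
  (exists x, q.[x] <> 0) <-> q != 0.
Proof.
split=> [[x qx0]|nz_q]; first by apply: contra_notN qx0 => /eqP->; rewrite horner0.
have [[x /rootP q1x0]|] := altP (closed_rootP (q - 1)).
  exists x; move/eqP: q1x0; rewrite hornerD hornerN hornerC subr_eq0 => /eqP->.
  exact/eqP/oner_neq0.
rewrite negbK => /size_poly1P[c _] Dq; exists 0 => q0.
have Eq : q = (c + 1)%:P by rewrite polyCD -Dq subrK.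
by case/negP: nz_q; move: q0; rewrite Eq hornerC => ->.
Qed.

(** * Quantifier elimination, uniformly in the field *)

Section Elimination.
Variable V : Type.
Implicit Types (s r : seq (zterm V)) (a c : zterm V).

(** The point of the definition is the order of the quantifiers: one formula
    serves all closed fields. *)
Definition eliminable (P : forall K : closedFieldType, (V -> K) -> Prop) :=
  exists f : qform V, forall K e, qsat e f <-> P K e.

Lemma eliminable_iff P Q : (forall K e, P K e <-> Q K e) ->
  eliminable P -> eliminable Q.
Proof. by move=> PQ [f fP]; exists f => K e; rewrite fP PQ. Qed.

Lemma eliminable_not P : eliminable P -> eliminable (fun K e => ~ P K e).
Proof.
by move=> [f fP]; exists (QNot f) => K e; rewrite -fP /=; split=> /negP.
Qed.

Lemma eliminable_or P Q : eliminable P -> eliminable Q ->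
  eliminable (fun K e => P K e \/ Q K e).
Proof.
move=> [f fP] [g gQ]; exists (QOr f g) => K e.
by rewrite qsat_or -fP -gQ; split=> /orP.
Qed.

Lemma eliminable_all0 s : eliminable (fun K e => all (fun a => zeval e a == 0) s).
Proof.
elim: s => [|a s [f fP]]; first by exists (QZero ZZero) => K e /=; rewrite eqxx.
by exists (QAnd (QZero a) f) => K e /=; split=> /andP[-> /fP].
Qed.

(** Deciding whether the leading coefficient [c] vanishes is a quantifier-free
    condition; if it does, the polynomial may be shortened. *)
Lemma eliminable_cases c (P R : forall K : closedFieldType, (V -> K) -> Prop) :
  (forall K e, zeval e c = 0 -> (R K e <-> P K e)) ->
  (exists f, forall K e, zeval e c <> 0 -> (R K e <-> @qsat V K e f)) ->
  eliminable P -> eliminable R.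
Proof.
move=> RP [g gR] [f fP].
exists (QOr (QAnd (QZero c) f) (QAnd (QNot (QZero c)) g)) => K e.
rewrite qsat_or /=; have [c0|nz_c] := eqVneq (zeval e c) 0.
  by rewrite orbF fP RP.
by rewrite gR //; exact/eqP.
Qed.

(** Pseudo-division by a polynomial with nonzero leading coefficient [c] does
    not change divisibility; at the end the remainder is shorter than the
    divisor, and divisibility means that its coefficients vanish. *)
Lemma dvdp_qform n r s c : (size r <= n)%N -> exists f : qform V,
  forall (K : closedFieldType) (e : V -> K), zeval e c <> 0 ->
    qsat e f <-> zpoly e (rcons s c) %| zpoly e r.
Proof.
elim: n r => [|n IHn] r le_r_n.
  by exists (QZero ZZero) => K e _ /=; case: r le_r_n; rewrite // eqxx dvdp0.
have [le_r_s|lt_s_r] := leqP (size r) (size s).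
  have [f fP] := eliminable_all0 r; exists f => K e nz_c.
  rewrite fP -zpoly_eq0; split=> [/eqP->|]; first exact: dvdp0.
  rewrite /zpoly; have Dp : Poly (map (zeval e) (rcons s c)) =
      map (zeval e) (rcons s c) :> seq K.
    by rewrite (@PolyK _ 0) // map_rcons last_rcons; exact/eqP.
  apply: contraTT => /dvdp_leq le; apply/negP => /le; rewrite Dp.
  rewrite size_map size_rcons; apply/negP; rewrite -ltnNge ltnS.
  by apply: leq_trans le_r_s; rewrite (leq_trans (size_Poly _)) ?size_map.
case/lastP: r => [|r a] // in le_r_n lt_s_r *.
rewrite size_rcons ltnS in le_r_n lt_s_r.
have [|f fP] := IHn (zpoly_reduce r a s c); first by rewrite size_zpoly_reduce.
exists f => K e nz_c; rewrite fP // -(dvdpZr _ (zpoly e (rcons r a)) (introN eqP nz_c)).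
by rewrite (zpoly_reduceE _ _ _ lt_s_r) dvdp_addl // dvdp_mull.
Qed.

Definition zsystem (ps : seq (seq (zterm V))) q (K : closedFieldType) (e : V -> K) :=
  exists x, (forall p, List.In p ps -> (zpoly e p).[x] = 0) /\ (zpoly e q).[x] <> 0.

Lemma zsystem_zero p ps q (K : closedFieldType) (e : V -> K) :
  zpoly e p = 0 -> zsystem (p :: ps) q e <-> zsystem ps q e.
Proof.
move=> p0; split=> -[x [ps0 qx0]]; exists x; split=> // r.
  by move=> ps_r; apply: ps0; right.
by move=> [<-|/ps0 //]; rewrite p0 horner0.
Qed.

Lemma zsystem_eq p p' ps q (K : closedFieldType) (e : V -> K) :
  zpoly e p = zpoly e p' -> zsystem (p :: ps) q e <-> zsystem (p' :: ps) q e.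
Proof.
move=> pp'; split=> -[x [ps0 qx0]]; exists x; split=> // r.
  by move=> [<-|ps_r]; [rewrite -pp'|]; apply: ps0; [left|right].
by move=> [<-|ps_r]; [rewrite pp'|]; apply: ps0; [left|right].
Qed.

Lemma zsystem_swap p p' ps q (K : closedFieldType) (e : V -> K) :
  zsystem (p :: p' :: ps) q e <-> zsystem (p' :: p :: ps) q e.
Proof.
by split=> -[x [ps0 qx0]]; exists x; split=> // r [<-|[<-|ps_r]];
   apply: ps0; [right; left|left|right; right
               |right; left|left|right; right].
Qed.

Lemma zpoly_rcons0 s c (K : closedFieldType) (e : V -> K) : zeval e c = 0 ->
  zpoly e (rcons s c) = zpoly e s.
Proof. by move=> c0; rewrite zpoly_rcons c0 scale0r addr0. Qed.

(** The Euclidean algorithm: the reduction differs from a nonzero multiple of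
    the longer polynomial by a multiple of the shorter one, so the common roots
    are the same. *)
Lemma zsystem_reduce s a r c ps q (K : closedFieldType) (e : V -> K) :
  (size r <= size s)%N -> zeval e c <> 0 ->
  zsystem (rcons s a :: rcons r c :: ps) q e <->
  zsystem (zpoly_reduce s a r c :: rcons r c :: ps) q e.
Proof.
move=> le_rs nz_c; have /= D := zpoly_reduceE e a c le_rs.
split=> -[x [ps0 qx0]]; exists x; split=> // p.
  have a0 := ps0 _ (or_introl erefl).
  have c0 := ps0 _ (or_intror (or_introl erefl)).
  move=> [<-|ps_p]; last by apply: ps0; right.
  move/(congr1 (horner^~ x)): D; rewrite !hornerE a0 c0 mulr0 mulr0 addr0.
  by move=> <-.
have a0 := ps0 _ (or_introl erefl).
have c0 := ps0 _ (or_intror (or_introl erefl)).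
move=> [<-|ps_p]; last by apply: ps0; right.
move/(congr1 (horner^~ x)): D; rewrite !hornerE a0 c0 mulr0 add0r.
by move=> /eqP; rewrite mulf_eq0 => /orP[/eqP|/eqP].
Qed.

(** Induction on the total length of the equations.  Two equations of positive
    length are reduced by pseudo-division, or shortened if the leading
    coefficient of the shorter one vanishes.  A single equation is settled by
    [root_nonroot_dvdp], and no equation by [nonroot_exists]. *)
Lemma eliminable_zsystem n ps q : (sumn (map (fun p => (size p).+1) ps) <= n)%N ->
  eliminable (zsystem ps q).
Proof.
elim: n ps => [|n IHn] [|p ps] //; last first.
- case/lastP: p => [|p a] le_n.
    have [] := IHn ps; first by rewrite -ltnS (leq_trans _ le_n) //= ltnS leq_addl.
    move=> f fP; exists f => K e; rewrite fP.
    by apply: iff_sym; apply: zsystem_zero.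
  have elim_p : eliminable (zsystem (p :: ps) q).
    apply: IHn; move: le_n; rewrite /= size_rcons.
    by rewrite addSn ltnS.
  case: ps le_n elim_p => [|r ps] le_n elim_p.
    apply: (@eliminable_cases a (zsystem [:: p] q)) => // [K e a0|].
      by apply: zsystem_eq; apply: zpoly_rcons0.
    (* [(size p).+1] is the size of the polynomial [rcons p a] when [a] is nonzero. *)
    pose qk := iter (size p).+1 (zpoly_mul q) [:: ZOne].
    have [f fP] := @dvdp_qform (size qk) qk p a (leqnn _).
    exists (QNot f) => K e nz_a.
    have Dp : polyseq (zpoly e (rcons p a)) = map (zeval e) (rcons p a).
      by rewrite /zpoly (@PolyK _ 0) // map_rcons last_rcons; exact/eqP.
    have Sp : size (zpoly e (rcons p a)) = (size p).+1.
      by rewrite Dp size_map size_rcons.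
    have nz_p : zpoly e (rcons p a) != 0 by rewrite -size_poly_eq0 Sp.
    have Dqk : zpoly e qk = zpoly e q ^+ (size p).+1.
      rewrite /qk; elim: (size p).+1 => [|k IHk] /=.
        by rewrite zpoly_cons /zpoly /= mul0r add0r.
      by rewrite zpoly_mulE IHk exprS.
    have := root_nonroot_dvdp (zpoly e q) nz_p; rewrite Sp -Dqk => RN.
    have fE := fP K e nz_a; split=> [[x [ps0 qx0]]|/negP nf].
      apply/negP => /fE; apply/negP; apply/RN.
      by exists x; split=> //; apply: ps0; left.
    have /RN[x [px0 qx0]] : ~~ (zpoly e (rcons p a) %| zpoly e qk).
      by apply/negP => /fE.
    by exists x; split=> // r [<-|[]].
  case/lastP: r => [|r c] in le_n elim_p *.
    have [] := IHn (rcons p a :: ps).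
      by rewrite -ltnS (leq_trans _ le_n) //= !addnS ltnS.
    move=> f fP; exists f => K e; rewrite fP.
    by apply: iff_sym; apply: iff_trans (zsystem_swap _ _ _ _ _) _; apply: zsystem_zero.
  wlog le_rp : p a r c le_n elim_p / (size r <= size p)%N.
    move=> W; have [/W|/ltnW le_pr] := leqP (size r) (size p); first exact.
    apply: (@eliminable_iff (zsystem [:: rcons r c, rcons p a & ps] q)).
      by move=> K e; exact: zsystem_swap.
    apply: W => //; first by move: le_n; rewrite /= addnCA.
    by apply: IHn; move: le_n; rewrite /= !size_rcons [in X in X -> _]addnCA addSn ltnS.
  apply: (@eliminable_cases c (zsystem [:: rcons p a, r & ps] q)).
  - move=> K e c0; rewrite zsystem_swap [X in _ <-> X]zsystem_swap.
    by apply: zsystem_eq; apply: zpoly_rcons0.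
  - have [|f fP] := IHn (zpoly_reduce p a r c :: rcons r c :: ps).
      by move: le_n; rewrite /= size_zpoly_reduce // !size_rcons addSn ltnS.
    by exists f => K e nz_c; rewrite fP zsystem_reduce.
  - by apply: IHn; move: le_n; rewrite /= !size_rcons addnCA addSn ltnS addnCA.
all: move=> _; have := eliminable_not (eliminable_all0 q).
all: apply: eliminable_iff => K e; rewrite -zpoly_eq0.
all: split=> [/negP/nonroot_exists[x qx0]|[x [_ qx0]]]; first by exists x.
all: by apply/negP/nonroot_exists; exists x.
Qed.

End Elimination.

Section QuantifierElimination.
Variable V : Type.

(** The terms required to vanish and the terms required not to. *)
Definition literals := (seq (zterm (option V)) * seq (zterm (option V)))%type.

Definition literals_sat (K : fieldType) (e : option V -> K) (l : literals) : bool :=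
  all (fun t => zeval e t == 0) l.1 && all (fun t => zeval e t != 0) l.2.

(** The disjunctive normal form of [f] if [b] holds, and of its negation
    otherwise; carrying the sign along pushes negations to the atoms. *)
Fixpoint dnf (b : bool) (f : qform (option V)) : seq literals :=
  match f with
  | QZero t => if b then [:: ([:: t], [::])] else [:: ([::], [:: t])]
  | QAnd f g =>
      if b then [seq (l.1 ++ k.1, l.2 ++ k.2) | l <- dnf true f, k <- dnf true g]
      else dnf false f ++ dnf false g
  | QNot f => dnf (~~ b) f
  end.

Lemma dnfP (K : fieldType) (e : option V -> K) b f :
  has (literals_sat e) (dnf b f) = (qsat e f == b).
Proof.
elim: f b => [t|f IHf g IHg|f IHf] b /=.
- by case: b; rewrite /literals_sat /= ?andbT !orbF ?eqb_id // eqbF_neg.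
- case: b; last by rewrite has_cat IHf IHg !eqbF_neg negb_and.
  rewrite eqb_id -[qsat e f]eqb_id -[qsat e g]eqb_id -IHf -IHg.
  elim: (dnf true f) => [|l ls IHls] //=; rewrite has_cat IHls andb_orl.
  congr (_ || _); elim: (dnf true g) => [|k ks IHks] /=; first by rewrite andbF.
  by rewrite IHks andb_orr /literals_sat /= !all_cat andbACA.
- by rewrite IHf; case: (qsat e f); case: b.
Qed.

Lemma eliminable_literals (l : literals) :
  eliminable (fun K (e : V -> K) => exists x, literals_sat (oext e x) l).
Proof.
case: l => ps qs; pose q := foldr (fun t => zpoly_mul (zpoly_of t)) [:: ZOne] qs.
apply: (eliminable_iff _ (@eliminable_zsystem V _ (map (@zpoly_of V) ps) q (leqnn _))).
move=> K e; have psP x : all (fun t => zeval (oext e x) t == 0) ps <->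
    forall p, List.In p (map (@zpoly_of V) ps) -> (zpoly e p).[x] = 0.
  elim: ps => [|t ps IHps] //=; split=> [/andP[/eqP t0 /IHps ps0] p [<-|/ps0 //]|ps0].
    by rewrite zpoly_ofE.
  rewrite -zpoly_ofE ps0 ?eqxx /=; last by left.
  by apply/IHps => p ps_p; apply: ps0; right.
have qsP x : all (fun t => zeval (oext e x) t != 0) qs = ((zpoly e q).[x] != 0).
  rewrite {}/q; elim: qs => [|t qs IHqs] /=.
    by rewrite zpoly_cons /zpoly /= mul0r add0r hornerC oner_eq0.
  by rewrite IHqs zpoly_mulE hornerM mulf_eq0 negb_or zpoly_ofE.
split=> -[x]; first by move=> [/psP ps0 /eqP qs0]; exists x; rewrite /literals_sat ps0 qsP.
by move=> /andP[/psP ps0]; rewrite qsP => /eqP qs0; exists x.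
Qed.

Theorem quantifier_elimination (f : qform (option V)) :
  eliminable (fun K (e : V -> K) => exists x, qsat (oext e x) f).
Proof.
suff: eliminable (fun K (e : V -> K) => exists x, has (literals_sat (oext e x)) (dnf true f)).
  by apply: eliminable_iff => K e; split=> -[x fx]; exists x; move: fx;
    rewrite dnfP eqb_id.
elim: (dnf true f) => [|l ls IHls].
  by exists (QNot (QZero ZZero)) => K e; rewrite /= eqxx; split=> // -[].
apply: eliminable_iff (eliminable_or (eliminable_literals l) IHls) => K e /=.
split=> [[[x lx]|[x lsx]]|[x /orP[lx|lsx]]]; try by [left; exists x|right; exists x].
  by exists x; rewrite lx.
by exists x; rewrite lsx orbT.
Qed.

End QuantifierElimination.

(** A term without variables is the image of one and the same integer in both
    fields. *)
Lemma qsat_closed (K L : fieldType) (f : qform void) (e : void -> K) (d : void -> L) :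
  [pchar K] =i pred0 -> [pchar L] =i pred0 -> qsat e f = qsat d f.
Proof.
move=> charK charL; elim: f => [t|f IHf g IHg|f IHf] /=; [|by rewrite IHf IHg|by rewrite IHf].
suff [m [-> ->]] : exists m : int, zeval e t = m%:~R /\ zeval d t = m%:~R.
  have z0 (F : fieldType) : [pchar F] =i pred0 -> (m%:~R == 0 :> F) = (m == 0).
    move/pcharf0P => charF; case: m => n; first exact: (charF n).
    by rewrite NegzE rmorphN !oppr_eq0; exact: (charF n.+1).
  by rewrite !z0.
elim: t => [[]|||t [m [Km Lm]] u [n [Kn Ln]]|t [m [Km Lm]]|t [m [Km Lm]] u [n [Kn Ln]]] /=.
- by exists 0.
- by exists 1.
- by exists (m + n); rewrite !rmorphD /= Km Lm Kn Ln.
- by exists (- m); rewrite !rmorphN /= Km Lm.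
- by exists (m * n); rewrite !rmorphM /= Km Lm Kn Ln.
Qed.

(** * Coordinate planes and their first-order theory *)

Section Coordinates.
Variables (M : plane) (K : fieldType) (pt : K -> K -> pl_point M).

Definition has_equation (l : pl_line M) (a b c : K) : Prop :=
  (a, b) <> (0, 0) /\ forall x y, pl_inc (pt x y) l <-> a * x + b * y + c = 0.

Record affine_coordinates : Prop := {
  pt_inj : forall x y x' y', pt x y = pt x' y' -> x = x' /\ y = y';
  pt_surj : forall P, exists x y, P = pt x y;
  line_equation : forall l, exists a b c, has_equation l a b c;
  equation_line : forall a b c : K, (a, b) <> (0, 0) -> exists l, has_equation l a b c;
  line_ext : forall l l' : pl_line M, (forall P, pl_inc P l <-> pl_inc P l') -> l = l' }.

(** The two relations have bilinear equations: parallel lines have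
    proportional coefficients, orthogonal ones have coefficients with vanishing
    scalar product. *)
Definition rel_form (R : pzRingType) (orth : bool) (a b a' b' : R) : R :=
  if orth then a * a' + b * b' else a * b' - b * a'.

Definition rel_equation (orth : bool) : Prop :=
  forall l l' a b c a' b' c', has_equation l a b c -> has_equation l' a' b' c' ->
  pl_rel l l' <-> rel_form orth a b a' b' = 0.

End Coordinates.

Section Uniformity.

Lemma quantifier_elimination2 V (f : qform (option (option V))) :
  eliminable (fun K (e : V -> K) => exists x y, qsat (oext (oext e x) y) f).
Proof.
have [g gP] := quantifier_elimination f; have [h hP] := quantifier_elimination g.
exists h => K e; rewrite hP.
by split=> -[x]; [move/gP=> [y ?]; exists x, y|move=> [y ?]; exists x; apply/gP; exists y].
Qed.

Lemma quantifier_elimination3 V (f : qform (option (option (option V)))) :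
  eliminable (fun K (e : V -> K) =>
    exists x y z, qsat (oext (oext (oext e x) y) z) f).
Proof.
have [g gP] := quantifier_elimination f; have [h hP] := quantifier_elimination2 g.
exists h => K e; rewrite hP.
by split=> -[x [y]]; [move/gP=> [z ?]; exists x, y, z|move=> [z ?]; exists x, y; apply/gP; exists z].
Qed.

Definition zequation V (a b c x y : V) : zterm V :=
  ZAdd (ZAdd (ZMul (ZVar a) (ZVar x)) (ZMul (ZVar b) (ZVar y))) (ZVar c).

Definition zrel V (orth : bool) (a b a' b' : V) : zterm V :=
  if orth then ZAdd (ZMul (ZVar a) (ZVar a')) (ZMul (ZVar b) (ZVar b'))
  else ZAdd (ZMul (ZVar a) (ZVar b')) (ZOpp (ZMul (ZVar b) (ZVar a'))).

(** Each point variable is represented by two field variables and each line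
    variable by the three coefficients of an equation; [f] expresses [p] in all
    coordinate planes over all closed fields at once. *)
Definition defines (orth : bool) m n (p : pform m n) V (x y : var m -> V)
    (a b c : var n -> V) (f : qform V) : Prop :=
  forall (K : closedFieldType) (e : V -> K) (M : plane) (pt : K -> K -> pl_point M)
    (A : var m -> pl_point M) (d : var n -> pl_line M),
  affine_coordinates pt -> rel_equation pt orth ->
  (forall i, A i = pt (e (x i)) (e (y i))) ->
  (forall j, has_equation pt (d j) (e (a j)) (e (b j)) (e (c j))) ->
  qsat e f <-> psat A d p.

Lemma defines_ex_point orth m n (p : pform m.+1 n) V (x y : var m -> V)
    (a b c : var n -> V) (f : qform (option (option V))) :
  let s : V -> option (option V) := Some \o Some in
  defines orth p (ext (n := m) (s \o x) (Some None)) (ext (n := m) (s \o y) None)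
    (s \o a) (s \o b) (s \o c) f ->
  exists g, defines orth (PExPoint p) x y a b c g.
Proof.
move=> s fP; have [g gP] := quantifier_elimination2 f.
exists g => K e M pt A d cM rM AE dE; rewrite gP.
have fE u v : qsat (oext (oext e u) v) f <-> psat (ext A (pt u v)) d p.
  by apply: (fP _ _ _ _ _ _ cM rM) => //; case=> //=.
split=> [[u [v /fE ?]]|[P]]; first by exists (pt u v).
by have [u [v ->]] := pt_surj cM P => /fE; exists u, v.
Qed.

Lemma defines_ex_line orth m n (p : pform m n.+1) V (x y : var m -> V)
    (a b c : var n -> V) (f : qform (option (option (option V)))) :
  let s : V -> option (option (option V)) := fun v => Some (Some (Some v)) in
  defines orth p (s \o x) (s \o y) (ext (n := n) (s \o a) (Some (Some None)))
    (ext (n := n) (s \o b) (Some None)) (ext (n := n) (s \o c) None) f ->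
  exists g, defines orth (PExLine p) x y a b c g.
Proof.
move=> s fP; pose nz := QNot (QAnd (QZero (ZVar (Some (Some None))))
  (QZero (ZVar (Some (None : option (option V)))))).
have [g gP] := quantifier_elimination3 (QAnd nz f).
exists g => K e M pt A d cM rM AE dE; rewrite gP.
have fE u v w l : has_equation pt l u v w ->
    qsat (oext (oext (oext e u) v) w) f <-> psat A (ext d l) p.
  by move=> lE; apply: (fP _ _ _ _ _ _ cM rM) => //; case=> //=.
have nzE u v w : (qsat (oext (oext (oext e u) v) w) nz : Prop) <-> (u, v) <> (0, 0).
  by rewrite /= -xpair_eqE; split=> /eqP.
split=> [[u [v [w /= /andP[/(nzE u v w) nz_uv fuvw]]]]|[l]].
  have [l lE] := equation_line cM w nz_uv; exists l.
  exact/(fE u v w).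
have [u [v [w lE]]] := line_equation cM l => /(fE _ _ _ _ lE) fuvw.
exists u, v, w; apply/andP; split=> //; apply/nzE; exact: (proj1 lE).
Qed.

Lemma defines_not orth m n (p : pform m n) V (x y : var m -> V) (a b c : var n -> V) f :
  defines orth p x y a b c f -> defines orth (PImp p PBot) x y a b c (QNot f).
Proof.
move=> fP K e M pt A d cM rM AE dE; have fE := fP K e M pt A d cM rM AE dE.
by rewrite /=; split=> [/negP nf /fE|nf]; last by apply/negP => /fE.
Qed.

(** Quantifiers over points and lines become two, respectively three,
    quantifiers over the field, which are eliminated.  Equality of lines is
    expressed by their having the same points. *)
Lemma psat_defined orth m n (p : pform m n) V (x y : var m -> V) (a b c : var n -> V) :
  exists f, defines orth p x y a b c f.
Proof.
elim: {m n} p V x y a b c => [m n|m n i j|m n k l|m n i k|m n k l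
    |m n p IHp q IHq|m n p IHp q IHq|m n p IHp q IHq|m n p IHp|m n p IHp|m n p IHp|m n p IHp]
    V x y a b c.
- by exists (QNot (QZero ZZero)) => K e M pt A d _ _ _ _ /=; rewrite eqxx.
- exists (QAnd (QZero (ZAdd (ZVar (x i)) (ZOpp (ZVar (x j)))))
    (QZero (ZAdd (ZVar (y i)) (ZOpp (ZVar (y j)))))) => K e M pt A d cM _ AE _ /=.
  rewrite !subr_eq0 !AE; split=> [/andP[/eqP-> /eqP->] //|].
  by move/(pt_inj cM) => [-> ->]; rewrite !eqxx.
- pose s : V -> option (option V) := Some \o Some.
  pose E j := QZero (zequation (s (a j)) (s (b j)) (s (c j)) (Some None) None).
  have [f fP] := quantifier_elimination2
    (QOr (QAnd (E k) (QNot (E l))) (QAnd (E l) (QNot (E k)))).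
  exists (QNot f) => K e M pt A d cM _ _ dE.
  have EE j u v : qsat (oext (oext e u) v) (E j) <-> pl_inc (pt u v) (d j).
    by rewrite (proj2 (dE j)) /=; split=> /eqP.
  rewrite [psat _ _ _]/= [qsat _ _]/=; split=> [/negP nf|dkl]; last first.
    apply/negP => /fP[u [v]]; rewrite qsat_or /=.
    case/orP => /andP[/EE E1 /negP]; apply; apply/EE.
      by rewrite -dkl.
    by rewrite dkl.
  apply: (line_ext cM) => P; have [u [v ->]] := pt_surj cM P.
  rewrite -!EE; split=> E1; apply: contra_notT nf => E2; apply/fP; exists u, v.
    by rewrite qsat_or; apply/orP; left; apply/andP.
  by rewrite qsat_or; apply/orP; right; apply/andP.
- exists (QZero (zequation (a k) (b k) (c k) (x i) (y i))) => K e M pt A d cM _ AE dE.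
  by rewrite /= AE (proj2 (dE k)) /=; split=> /eqP.
- exists (QZero (zrel orth (a k) (b k) (a l) (b l))) => K e M pt A d cM rM AE dE.
  rewrite /= (rM _ _ _ _ _ _ _ _ (dE k) (dE l)) /zrel /rel_form.
  by case: (orth); split=> /eqP.
- have [f fP] := IHp _ x y a b c; have [g gP] := IHq _ x y a b c.
  exists (QAnd f g) => K e M pt A d cM rM AE dE.
  have := fP K e M pt A d cM rM AE dE; have := gP K e M pt A d cM rM AE dE.
  by rewrite /= => <- <-; split=> /andP.
- have [f fP] := IHp _ x y a b c; have [g gP] := IHq _ x y a b c.
  exists (QOr f g) => K e M pt A d cM rM AE dE.
  have := fP K e M pt A d cM rM AE dE; have := gP K e M pt A d cM rM AE dE.
  by rewrite qsat_or /= => <- <-; split=> /orP.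
- have [f fP] := IHp _ x y a b c; have [g gP] := IHq _ x y a b c.
  exists (QNot (QAnd f (QNot g))) => K e M pt A d cM rM AE dE.
  have := fP K e M pt A d cM rM AE dE; have := gP K e M pt A d cM rM AE dE.
  rewrite /= => <- <-; rewrite negb_and negbK -implybE.
  by split=> /implyP.
- have [f fP] := IHp _
    (ext (n := m) (Some \o Some \o x) (Some None)) (ext (n := m) (Some \o Some \o y) None)
    (Some \o Some \o a) (Some \o Some \o b) (Some \o Some \o c).
  have [g /defines_not gP] := defines_ex_point (defines_not fP).
  exists (QNot g) => K e M pt A d cM rM AE dE; rewrite (gP K e M pt A d) //=.
  split=> [nex B|all_p [B]]; last by apply; apply: all_p.
  by apply: contrapT => nB; apply: nex; exists B.
- have [f fP] := IHp _
    (ext (n := m) (Some \o Some \o x) (Some None)) (ext (n := m) (Some \o Some \o y) None)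
    (Some \o Some \o a) (Some \o Some \o b) (Some \o Some \o c).
  have [g gP] := defines_ex_point fP.
  by exists g.
- pose s (v : V) := Some (Some (Some v)).
  have [f fP] := IHp _ (s \o x) (s \o y)
    (ext (n := n) (s \o a) (Some (Some None)))
    (ext (n := n) (s \o b) (Some None)) (ext (n := n) (s \o c) None).
  have [g /defines_not gP] := defines_ex_line (defines_not fP).
  exists (QNot g) => K e M pt A d cM rM AE dE; rewrite (gP K e M pt A d) //=.
  split=> [nex l|all_p [l]]; last by apply; apply: all_p.
  by apply: contrapT => nl; apply: nex; exists l.
- pose s (v : V) := Some (Some (Some v)).
  have [f fP] := IHp _ (s \o x) (s \o y)
    (ext (n := n) (s \o a) (Some (Some None)))
    (ext (n := n) (s \o b) (Some None)) (ext (n := n) (s \o c) None).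
  have [g gP] := defines_ex_line fP.
  by exists g.
Qed.

Theorem coordinate_planes_equivalent orth (K L : closedFieldType) (M N : plane)
    (pt : K -> K -> pl_point M) (qt : L -> L -> pl_point N) :
  [pchar K] =i pred0 -> [pchar L] =i pred0 ->
  affine_coordinates pt -> rel_equation pt orth ->
  affine_coordinates qt -> rel_equation qt orth ->
  forall s, models M s <-> models N s.
Proof.
move=> charK charL cM rM cN rN s.
pose v0 : var 0 -> void := id.
have [f fP] := psat_defined orth s v0 v0 v0 v0 v0.
have fM := fP K (of_void K) M pt env0 env0 cM rM.
have fN := fP L (of_void L) N qt env0 env0 cN rN.
rewrite /models -fM; [|by case|by case]; rewrite -fN; [|by case|by case].
by rewrite (qsat_closed f (of_void K) (of_void L) charK charL).
Qed.

End Uniformity.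

(** * Starred axioms and the field of a frame *)

(** The operations of a frame are available before they are known to satisfy
    any law, so the axioms have to be read in structures that are not yet
    rings. *)
Record arith (T : Type) : Type := Arith {
  azero : T;
  aone : T;
  aadd : T -> T -> T;
  amul : T -> T -> T }.

Definition ring_arith (K : nzRingType) : arith K := Arith 0 1 +%R *%R.

Fixpoint aeval (T : Type) (ar : arith T) n (e : var n -> T) (t : rterm n) : T :=
  match t with
  | RVar v => e v
  | RZero => azero ar
  | ROne => aone ar
  | RAdd t u => aadd ar (aeval ar e t) (aeval ar e u)
  | RMul t u => amul ar (aeval ar e t) (aeval ar e u)
  end.

Fixpoint asat (T : Type) (ar : arith T) n (e : var n -> T) (p : rform n) : Prop :=
  match p with
  | RBot => False
  | REq t u => aeval ar e t = aeval ar e u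
  | RAnd p q => asat ar e p /\ asat ar e q
  | ROr p q => asat ar e p \/ asat ar e q
  | RImp p q => asat ar e p -> asat ar e q
  | RAll p => forall a, asat ar (ext e a) p
  | REx p => exists a, asat ar (ext e a) p
  end.

Section ArithmeticSatisfaction.
Variables (T : Type) (ar : arith T).

Lemma asat_close n (p : rform n) :
  asat ar env0 (rclose p) <-> forall e : var n -> T, asat ar e p.
Proof.
elim: n p => [|n IHn] p.
  split=> [p0 e|]; last exact.
  by rewrite (_ : e = env0) //; apply/funext; case.
rewrite [rclose _]/= IHn /=; split=> [allp e|allp e a]; last exact: allp.
by rewrite (_ : e = ext (n := n) (e \o Some) (e None)) //; apply/funext; case.
Qed.

Lemma aeval_rename m n (f : var m -> var n) (e : var n -> T) t :
  aeval ar e (rrename f t) = aeval ar (e \o f) t.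
Proof. by elim: t => //= [t -> u ->|t -> u ->]. Qed.

End ArithmeticSatisfaction.

Section AlgebraicallyClosed.

(** The polynomial whose value is the term [rmonic n], by the same recursion. *)
Fixpoint monic_poly (K : nzRingType) (n : nat) : (var n -> K) -> {poly K} :=
  if n is n'.+1 then fun a => monic_poly (a \o Some : var n' -> K) * 'X + (a None)%:P
  else fun=> 1.

Lemma size_monic_poly (K : nzRingType) n (a : var n -> K) : size (monic_poly a) = n.+1.
Proof.
elim: n a => [|n IHn] a /=; first exact: size_poly1.
by rewrite size_MXaddC -size_poly_eq0 IHn.
Qed.

Lemma aeval_monic (K : fieldType) n (e : var n.+1 -> K) :
  aeval (ring_arith K) e (rmonic n) = (monic_poly (e \o Some : var n -> K)).[e None].
Proof.
elim: n e => [|n IHn] e /=; first by rewrite hornerC.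
by rewrite aeval_rename IHn /= hornerMXaddC.
Qed.

Lemma aeval_nat (K : fieldType) p n (e : var n -> K) :
  aeval (ring_arith K) e (rnat n p) = p%:R.
Proof. by elim: p => //= p ->; rewrite mulrSr. Qed.

Lemma ACF0_closed_field (K : closedFieldType) p :
  [pchar K] =i pred0 -> ACF0 p -> asat (ring_arith K) env0 p.
Proof.
move=> charK; case=> {p}; rewrite ?asat_close.
- by move=> e; apply: addrA.
- by move=> e; apply: addrC.
- by move=> e; apply: addr0.
- by move=> e; exists (- e None); apply: subrr.
- by move=> e; apply: mulrA.
- by move=> e; apply: mulrC.
- by move=> e; apply: mulr1.
- by move=> e; apply: mulrDr.
- by move/esym/eqP; rewrite oner_eq0.
- by move=> e /eqP nz; exists (e None)^-1; apply: mulfV.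
- move=> p p_pr; rewrite /= aeval_nat => /eqP.
  by move/pcharf0P: charK => ->; case: p p_pr.
- move=> n n_gt0; rewrite asat_close => e.
  have /closed_rootP[x] : size (monic_poly e) != 1 by rewrite size_monic_poly; case: n n_gt0 e.
  move=> /rootP px0; exists x.
  by rewrite /= aeval_monic.
Qed.

Fixpoint var_index n : var n -> nat :=
  if n is n'.+1 then fun v => if v is Some v' then (var_index v').+1 else 0
  else fun=> 0.

Lemma horner_monic_poly (K : fieldType) n (P : nat -> K) x :
  (monic_poly (fun v : var n => - P (var_index v))).[x]
  = x ^+ n - \sum_(i < n) P i * x ^+ i.
Proof.
elim: n P => [|n IHn] P /=; first by rewrite big_ord0 subr0 hornerC.
rewrite hornerMXaddC (IHn (P \o S)) big_ord_recl /= expr0 mulr1 exprSr opprD.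
rewrite mulrBl big_distrl /= -!addrA; congr (_ + _); rewrite addrC; congr (_ - _).
by apply: eq_bigr => i _; rewrite exprSr mulrA.
Qed.

(** The general monic polynomial specializes to any given one by an assignment
    of its coefficients. *)
Lemma ACF0_field_closed (K : fieldType) :
  (forall p, ACF0 p -> asat (ring_arith K) env0 p) ->
  GRing.closed_field_axiom K /\ [pchar K] =i pred0.
Proof.
move=> sat; split=> [n P n_gt0|p].
  have /asat_close := sat _ (acf_root n_gt0).
  case/(_ (fun v => - P (var_index v))) => x xP; exists x.
  have := aeval_monic (ext (fun v : var n => - P (var_index v)) x).
  rewrite [LHS]xP /= horner_monic_poly => /esym/eqP.
  by rewrite subr_eq0 => /eqP.
apply/negbTE/negP => /andP[p_pr /eqP p0].
by apply: (sat _ (acf_char p_pr)); rewrite /= aeval_nat.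
Qed.

Lemma closed_field_ACF0 (T : Type) (ar : arith T) :
  (forall p, ACF0 p -> asat ar env0 p) ->
  exists (K : closedFieldType) (h : K -> T),
    [/\ bijective h, h 0 = azero ar /\ h 1 = aone ar,
        forall a b, h (a + b) = aadd ar (h a) (h b),
        forall a b, h (a * b) = amul ar (h a) (h b) & [pchar K] =i pred0].
Proof.
case: ar => zero one add mul sat.
have axiom n (p : rform n) : ACF0 (rclose p) ->
    forall e : var n -> T, asat (Arith zero one add mul) e p.
  by move=> /sat/asat_close.
pose e1 a : var 1 -> T := ext (n := 0) env0 a.
pose e2 a b : var 2 -> T := ext (n := 1) (e1 a) b.
pose e3 a b c : var 3 -> T := ext (n := 2) (e2 a b) c.
have addA : associative add by move=> a b c; exact: (axiom 3 _ acf_addA (e3 c b a)).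
have addC : commutative add by move=> a b; exact: (axiom 2 _ acf_addC (e2 b a)).
have add0 : left_id zero add.
  by move=> a; rewrite addC; exact: (axiom 1 _ acf_add0 (e1 a)).
have addN a : exists b, add a b = zero by exact: (axiom 1 _ acf_addN (e1 a)).
have mulA : associative mul by move=> a b c; exact: (axiom 3 _ acf_mulA (e3 c b a)).
have mulC : commutative mul by move=> a b; exact: (axiom 2 _ acf_mulC (e2 b a)).
have mul1 : left_id one mul.
  by move=> a; rewrite mulC; exact: (axiom 1 _ acf_mul1 (e1 a)).
have mulD : left_distributive mul add.
  move=> a b c; rewrite mulC [mul a c]mulC [mul b c]mulC.
  exact: (axiom 3 _ acf_mulD (e3 b a c)).
have neq01 : zero <> one by exact: (sat _ acf_neq01).
have mulV a : a <> zero -> exists b, mul a b = one by exact: (axiom 1 _ acf_mulV (e1 a)).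
pose opp a := projT1 (cid (addN a)).
have oppP : left_inverse zero opp add.
  by move=> a; rewrite addC /opp; case: cid.
pose T0 : choiceType := HB.pack T (gen_eqMixin T) (gen_choiceMixin T).
pose T1 : zmodType := HB.pack T0 (GRing.isZmodule.Build T0 addA addC add0 oppP).
have neq10 : one != zero :> T1 by apply/eqP => /esym.
pose T2 : comNzRingType := HB.pack T1
  (GRing.Zmodule_isComNzRing.Build T1 mulA mulC mul1 mulD neq10).
have invE a : exists b, (a <> zero -> mul b a = one) /\ (a = zero -> b = zero).
  have [->|nz] := pselect (a = zero); first by exists zero.
  by have [b ab] := mulV a nz; exists b; split=> // _; rewrite mulC.
pose inv a := projT1 (cid (invE a)).
have inv_l (a : T2) : a != 0 -> (inv a : T2) * a = 1.
  by move/eqP=> nz; rewrite /inv; case: cid => b [/= bP _]; exact: bP.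
have inv_0 : inv zero = 0 :> T2.
  by rewrite /inv; case: cid => b [/= _ bP]; exact: bP.
pose T3 : fieldType := HB.pack T2 (GRing.ComNzRing_isField.Build T2 inv_l inv_0).
have [closedT charT] := ACF0_field_closed (K := T3) sat.
pose T4 : closedFieldType := HB.pack T3 (Field_isAlgClosed.Build T3 closedT).
exists T4, id; split=> //; by exists id.
Qed.

End AlgebraicallyClosed.

(** The arithmetic analogue of [coordinatizes], for structures that are not yet
    rings. *)
Record frame_arith (M : plane) (O E E' : pl_point M) (T : Type) (ar : arith T)
    (g : T -> pl_point M) : Prop := {
  frame_inj : injective g;
  frame_onto : forall P, collinear P O E <-> exists a, P = g a;
  frame_0 : g (azero ar) = O;
  frame_1 : g (aone ar) = E;
  frame_add : forall a b P, coord_sum O E E' (g a) (g b) P <-> P = g (aadd ar a b);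
  frame_mul : forall a b P, coord_prod O E E' (g a) (g b) P <-> P = g (amul ar a b) }.

Section StarSentences.

Let psat_all_imp (M : plane) m n (e : var m -> pl_point M) (d : var n -> pl_line M) p q :
  psat e d (PAllPoint (PImp p q)) = forall A, psat (ext e A) d p -> psat (ext e A) d q.
Proof. by []. Qed.

Variables (M : plane) (O E E' : pl_point M) (T : Type) (ar : arith T).
Variable g : T -> pl_point M.
Hypothesis gP : frame_arith O E E' ar g.

Lemma psat_Pterm k (t : rterm k) m (f : var k -> var m) (o u u' c : var m)
    (e : var m -> pl_point M) (r : var k -> T) :
  e o = O -> e u = E -> e u' = E' -> (forall v, e (f v) = g (r v)) ->
  psat e env0 (Pterm f o u u' t c) <-> e c = g (aeval ar r t).
Proof.
move=> eo eu eu' ef.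
elim: t m f o u u' c e eo eu eu' ef => [v|||t IHt w IHw|t IHt w IHw] m f o u u' c e eo eu eu' ef;
  pose s (x : var m) : var m.+2 := Some (Some x).
- by rewrite /= ef.
- by rewrite /= eo (frame_0 gP).
- by rewrite /= eu (frame_1 gP).
- have tE A B := IHt m.+2 (fun v => s (f v)) (s o) (s u) (s u') (Some None)
    (ext (n := m.+1) (ext e A) B) eo eu eu' ef.
  have wE A B := IHw m.+2 (fun v => s (f v)) (s o) (s u) (s u') None
    (ext (n := m.+1) (ext e A) B) eo eu eu' ef.
  have opE A B := psat_sum (ext (n := m.+1) (ext e A) B) env0
    (s o) (s u) (s u') (Some None) None (s c).
  split=> [[A [B [/(tE A B) /= At [/(wE A B) /= Bw /(opE A B)]]]]|ec].
    by rewrite /= At Bw eo eu eu' => /(frame_add gP).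
  exists (g (aeval ar r t)), (g (aeval ar r w)).
  split; [exact/tE|split; [exact/wE|]].
  by apply/opE; rewrite /= eo eu eu'; apply/(frame_add gP).
- have tE A B := IHt m.+2 (fun v => s (f v)) (s o) (s u) (s u') (Some None)
    (ext (n := m.+1) (ext e A) B) eo eu eu' ef.
  have wE A B := IHw m.+2 (fun v => s (f v)) (s o) (s u) (s u') None
    (ext (n := m.+1) (ext e A) B) eo eu eu' ef.
  have opE A B := psat_prod (ext (n := m.+1) (ext e A) B) env0
    (s o) (s u) (s u') (Some None) None (s c).
  split=> [[A [B [/(tE A B) /= At [/(wE A B) /= Bw /(opE A B)]]]]|ec].
    by rewrite /= At Bw eo eu eu' => /(frame_mul gP).
  exists (g (aeval ar r t)), (g (aeval ar r w)).
  split; [exact/tE|split; [exact/wE|]].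
  by apply/opE; rewrite /= eo eu eu'; apply/(frame_mul gP).
Qed.

(** As in [psat_field], only the graphs of the operations matter. *)
Lemma psat_Pfield k (p : rform k) m (f : var k -> var m) (o u u' : var m)
    (e : var m -> pl_point M) (r : var k -> T) :
  e o = O -> e u = E -> e u' = E' -> (forall v, e (f v) = g (r v)) ->
  psat e env0 (Pfield f o u u' p) <-> asat ar r p.
Proof.
elim: p m f o u u' e r => {k} [k|k t w|k p IHp q IHq|k p IHp q IHq|k p IHp q IHq
  |k p IHp|k p IHp] m f o u u' e r eo eu eu' ef.
- by [].
- have tE t' A : psat (ext e A) env0
      (Pterm (m := m.+1) (fun v => Some (f v)) (Some o) (Some u) (Some u') t' None)
      <-> A = g (aeval ar r t') by exact: psat_Pterm.
  split=> [[A [/tE tA /tE wA]]|/= tw].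
    by apply: (frame_inj gP); rewrite -tA.
  by exists (g (aeval ar r t)); split; apply/tE; rewrite // tw.
- have pE := IHp m f o u u' e r eo eu eu' ef.
  have qE := IHq m f o u u' e r eo eu eu' ef.
  by rewrite /= pE qE.
- have pE := IHp m f o u u' e r eo eu eu' ef.
  have qE := IHq m f o u u' e r eo eu eu' ef.
  by rewrite /= pE qE.
- have pE := IHp m f o u u' e r eo eu eu' ef.
  have qE := IHq m f o u u' e r eo eu eu' ef.
  by rewrite /= pE qE.
all: have IH a : psat (ext e (g a)) env0
      (Pfield (m := m.+1) (ext (fun v => Some (f v) : var m.+1) None)
        (Some o) (Some u) (Some u') p)
      <-> asat ar (ext r a) p by apply: IHp => //; case.
all: have cE A : psat (ext e A) env0 (Pcollinear 0 (None : var m.+1) (Some o) (Some u))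
      <-> exists a, A = g a by rewrite psat_collinear /= eo eu (frame_onto gP).
- rewrite [Pfield _ _ _ _ _]/= psat_all_imp; split=> [all_p a|all_p A].
    by apply/IH; apply: (all_p (g a)); apply/cE; exists a.
  by move/(cE A) => [b ->]; apply/(IH b)/all_p.
- split=> [[A [/(cE A)[a ->] /(IH a) pa]]|[a /IH pa]]; first by exists a.
  by exists (g a); split=> //; apply/cE; exists a.
Qed.

Lemma psat_frame p :
  psat (ext (n := 2) (ext (n := 1) (ext (n := 0) env0 O) E) E') env0
    (Pfield env0 (Some (Some None) : var 3) (Some None) None p) <-> asat ar env0 p.
Proof. by apply: psat_Pfield => //; case. Qed.

End StarSentences.

Lemma models_starE (M : plane) p :
  models M (star p) <-> forall O E E' : pl_point M, ~ collinear O E E' ->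
    psat (ext (n := 2) (ext (n := 1) (ext (n := 0) env0 O) E) E') env0
      (Pfield env0 (Some (Some None) : var 3) (Some None) None p).
Proof.
have -> : models M (star p) = forall O E E' : pl_point M,
    (psat (ext (n := 2) (ext (n := 1) (ext (n := 0) env0 O) E) E') env0
       (Pcollinear 0 (Some (Some None) : var 3) (Some None) None) -> False) ->
    psat (ext (n := 2) (ext (n := 1) (ext (n := 0) env0 O) E) E') env0
      (Pfield env0 (Some (Some None) : var 3) (Some None) None p) by [].
have colE O E E' := psat_collinear (ext (n := 2) (ext (n := 1) (ext (n := 0) env0 O) E) E')
  (env0 : var 0 -> pl_line M) (Some (Some None) : var 3) (Some None) None.
by split=> starM O E E' ncol; apply: starM => col; apply: ncol; apply/(colE O E E').
Qed.

Lemma models_star_frame (M : plane) p (O E E' : pl_point M) (T : Type) (ar : arith T) g :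
  models M (star p) -> ~ collinear O E E' -> frame_arith O E E' ar g -> asat ar env0 p.
Proof. by move=> /models_starE starM nOEE' gP; apply/(psat_frame gP)/starM. Qed.

Lemma frames_model_star (M : plane) p :
  (forall O E E' : pl_point M, ~ collinear O E E' ->
    exists (T : Type) (ar : arith T) (g : T -> pl_point M),
      frame_arith O E E' ar g /\ asat ar env0 p) ->
  models M (star p).
Proof.
move=> frames; apply/models_starE => O E E' /frames[T [ar [g [gP sat_p]]]].
exact/(psat_frame gP).
Qed.

Section AffineIncidence.
Variable M : plane.
Local Notation point := (pl_point M).
Local Notation line := (pl_line M).
Local Notation I := (@pl_inc M).
Implicit Types (A B C P Q X Y O E : point) (l m n : line).

Definition euclidean_parallels : Prop := forall l A, exists! m, I A m /\ parallel m l.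

Hypotheses (incM : incidence_plane M) (parM : euclidean_parallels).
Hypothesis lineM : inhabited line.

Lemma join_unique A B l m : A <> B -> joins A B l -> joins A B m -> l = m.
Proof.
move=> neqAB ABl ABm; have [n [_ nU]] := inc_join incM neqAB.
by rewrite -(nU l ABl) (nU m ABm).
Qed.

Lemma parallel_refl l : parallel l l. Proof. by left. Qed.

Lemma parallel_sym l m : parallel l m -> parallel m l.
Proof.
by case=> [->|npt]; [left|right=> -[P [Pm Pl]]; apply: npt; exists P].
Qed.

Lemma parallel_meet l m P : parallel l m -> I P l -> I P m -> l = m.
Proof. by case=> // npt Pl Pm; case: npt; exists P. Qed.

Lemma parallel_unique l m m' P :
  I P m -> I P m' -> parallel m l -> parallel m' l -> m = m'.
Proof.
move=> Pm Pm' ml m'l; have [n [_ nU]] := parM l P.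
by rewrite -(nU m (conj Pm ml)) (nU m' (conj Pm' m'l)).
Qed.

Lemma parallel_trans m l n : parallel l m -> parallel m n -> parallel l n.
Proof.
move=> lm mn; have [[P [Pl Pn]]|] := pselect (exists P, I P l /\ I P n); last by right.
by left; apply: (parallel_unique Pl Pn lm); exact: parallel_sym.
Qed.

Lemma parallel_through l P : exists2 m, I P m & parallel m l.
Proof. by have [m [[Pm ml] _]] := parM l P; exists m. Qed.

Lemma line_through P Q : P <> Q -> exists l, joins P Q l.
Proof. by move=> neqPQ; have [l [PQl _]] := inc_join incM neqPQ; exists l. Qed.

Lemma meet_point l m : ~ parallel l m -> exists P, I P l /\ I P m.
Proof. by move=> nlm; apply: contrapT => npt; apply: nlm; right. Qed.

Lemma meet_unique l m P Q :
  ~ parallel l m -> I P l -> I P m -> I Q l -> I Q m -> P = Q.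
Proof.
move=> nlm Pl Pm Ql Qm; apply: contrapT => neqPQ; apply: nlm; left.
by apply: (join_unique neqPQ).
Qed.

Lemma collinear_on A B X l : A <> B -> joins A B l -> collinear X A B <-> I X l.
Proof.
move=> neqAB ABl; split=> [[m [Xm Am Bm]]|Xl]; last by exists l; case: ABl.
by rewrite (join_unique neqAB ABl (conj Am Bm)).
Qed.

Lemma on_parallelP A B X Y n m : A <> B -> joins A B n -> I Y m -> parallel m n ->
  on_parallel X Y A B <-> I X m.
Proof.
move=> neqAB ABn Ym mn; split=> [[m' [n' [[Xm' Ym'] ABn' mn']]]|Xm]; last by exists m, n.
rewrite (join_unique neqAB ABn' ABn) in mn'.
by rewrite (parallel_unique Ym Ym' mn mn').
Qed.

(** A line has two points, and these determine it. *)
Lemma line_extensional l m : (forall P, I P l <-> I P m) -> l = m.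
Proof.
move=> lm; have [A [B [neqAB Al Bl]]] := inc_two incM l.
by apply: (join_unique neqAB) => //; split; apply/lm.
Qed.

Section Frame.
Variables O E E' : point.
Hypothesis ncol : ~ collinear O E E'.

Lemma frame_neq : [/\ O <> E, O <> E' & E <> E'].
Proof.
have any X : exists l, I X l.
  by case: lineM => l0; have [l Xl _] := parallel_through l0 X; exists l.
have two X Y : exists l, I X l /\ I Y l.
  have [<-|neq] := pselect (X = Y); last by have [l []] := line_through neq; exists l.
  by have [l Xl] := any X; exists l.
have [l1 [O1 E1]] := two O E; have [l2 [O2 E'2]] := two O E'.
by split=> eq; apply: ncol; [exists l2|exists l1|exists l1]; split=> //;
  rewrite -?eq // eq.
Qed.

Lemma frame_lines : exists lx ly lu,
  [/\ joins O E lx, joins O E' ly & joins E E' lu].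
Proof.
have [/line_through[lx ?] /line_through[ly ?] /line_through[lu ?]] := frame_neq.
by exists lx, ly, lu.
Qed.

Section FrameLines.
Variables lx ly lu : line.
Hypotheses (OEx : joins O E lx) (OEy : joins O E' ly) (EEu : joins E E' lu).

Lemma unit_off_axis : ~ I E' lx.
Proof. by move=> E'x; apply: ncol; exists lx; case: OEx. Qed.

Lemma axes_not_parallel : ~ parallel lx ly.
Proof.
case: OEx => Ox Ex; case: OEy => Oy E'y.
by move=> /parallel_meet -/(_ _ Ox Oy) eqxy; apply: unit_off_axis; rewrite eqxy.
Qed.

Lemma unit_line_not_parallel_x : ~ parallel lu lx.
Proof.
case: OEx => Ox Ex; case: EEu => Eu E'u.
by move=> /parallel_meet -/(_ _ Eu Ex) eqxy; apply: unit_off_axis; rewrite -eqxy.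
Qed.

Lemma unit_line_not_parallel_y : ~ parallel lu ly.
Proof.
case: OEy => Oy E'y; case: EEu => Eu E'u.
move=> /parallel_meet -/(_ _ E'u E'y) eqxy; apply: ncol; exists ly.
by rewrite -{2}eqxy.
Qed.

(** Every construction step intersects two lines that are not parallel, because
    [E'] does not lie on [OE]. *)
Lemma coord_sum_total A B : I A lx -> I B lx ->
  exists2 C, I C lx & forall P, coord_sum O E E' A B P <-> P = C.
Proof.
have [nOE nOE' nEE'] := frame_neq; move=> Ax Bx.
have nE'B : E' <> B by move=> eqE'B; apply: unit_off_axis; rewrite eqE'B.
have [m1 Am1 m1y] := parallel_through ly A.
have [m2 E'm2 m2x] := parallel_through lx E'.
have [|P [Pm1 Pm2]] := @meet_point m1 m2.
  move=> m12; apply: axes_not_parallel; apply: parallel_trans (parallel_sym m2x) _.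
  by apply: parallel_trans (parallel_sym m12) _.
have [n [E'n Bn]] := line_through nE'B.
have [m3 Pm3 m3n] := parallel_through n P.
have nm3x : ~ parallel m3 lx.
  move=> m3x; apply: unit_off_axis.
  by rewrite -(parallel_meet (parallel_trans (parallel_sym m3n) m3x) Bn Bx).
have [C [Cm3 Cx]] := meet_point nm3x; exists C => // X.
split=> [[P' [P'A P'E' XP' XO]]|->].
  have P'm1 : I P' m1 by apply/(on_parallelP _ nOE' OEy Am1 m1y).
  have P'm2 : I P' m2 by apply/(on_parallelP _ nOE OEx E'm2 m2x).
  have eqP : P' = P.
    apply: (@meet_unique m1 m2) => // m12; apply: axes_not_parallel.
    by apply: parallel_trans (parallel_trans (parallel_sym m12) m1y);
      exact: parallel_sym.
  rewrite eqP in XP'; apply: (meet_unique nm3x) => //.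
    by apply/(on_parallelP _ nE'B (conj E'n Bn) Pm3 m3n).
  by apply/(collinear_on _ nOE OEx).
exists P; split.
- by apply/(on_parallelP _ nOE' OEy Am1 m1y).
- by apply/(on_parallelP _ nOE OEx E'm2 m2x).
- by apply/(on_parallelP _ nE'B (conj E'n Bn) Pm3 m3n).
- by apply/(collinear_on _ nOE OEx).
Qed.

Lemma coord_prod_total A B : I A lx -> I B lx ->
  exists2 C, I C lx & forall P, coord_prod O E E' A B P <-> P = C.
Proof.
have [nOE nOE' nEE'] := frame_neq; move=> Ax Bx.
have nE'A : E' <> A by move=> eqE'A; apply: unit_off_axis; rewrite eqE'A.
have [m1 Bm1 m1u] := parallel_through lu B.
have nm1y : ~ parallel m1 ly.
  by move=> m1y; apply: unit_line_not_parallel_y; apply: parallel_trans m1y;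
    exact: parallel_sym.
have [B' [B'm1 B'y]] := meet_point nm1y.
have [n [E'n An]] := line_through nE'A.
have [m3 B'm3 m3n] := parallel_through n B'.
have nm3x : ~ parallel m3 lx.
  move=> m3x; apply: unit_off_axis.
  by rewrite -(parallel_meet (parallel_trans (parallel_sym m3n) m3x) An Ax).
have [C [Cm3 Cx]] := meet_point nm3x; exists C => // X.
split=> [[B2 [B2y B2B XB2 XO]]|->].
  have eqB : B2 = B'.
    apply: (meet_unique nm1y) => //.
      by apply/(on_parallelP _ nEE' EEu Bm1 m1u).
    by apply/(collinear_on _ nOE' OEy).
  rewrite eqB in XB2; apply: (meet_unique nm3x) => //.
    by apply/(on_parallelP _ nE'A (conj E'n An) B'm3 m3n).
  by apply/(collinear_on _ nOE OEx).
exists B'; split.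
- by apply/(collinear_on _ nOE' OEy).
- by apply/(on_parallelP _ nEE' EEu Bm1 m1u).
- by apply/(on_parallelP _ nE'A (conj E'n An) B'm3 m3n).
- by apply/(collinear_on _ nOE OEx).
Qed.

End FrameLines.

Lemma frame_arith_exists :
  exists (T : Type) (ar : arith T) (g : T -> point), frame_arith O E E' ar g.
Proof.
have [nOE nOE' nEE'] := frame_neq; have [lx [ly [lu [OEx OEy EEu]]]] := frame_lines.
pose T := {P | I P lx}.
have sumP (a b : T) : exists c : T,
    forall P, coord_sum O E E' (sval a) (sval b) P <-> P = sval c.
  have [C Cx CP] := coord_sum_total OEx OEy (svalP a) (svalP b).
  by exists (exist _ C Cx).
have prodP (a b : T) : exists c : T,
    forall P, coord_prod O E E' (sval a) (sval b) P <-> P = sval c.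
  have [C Cx CP] := coord_prod_total OEx OEy EEu (svalP a) (svalP b).
  by exists (exist _ C Cx).
exists T, (Arith (exist _ O (proj1 OEx) : T) (exist _ E (proj2 OEx) : T)
  (fun a b => projT1 (cid (sumP a b))) (fun a b => projT1 (cid (prodP a b)))), sval.
split=> //=.
- by move=> [P Px] [Q Qx] /= eqPQ; apply: eq_exist.
- move=> P; rewrite (collinear_on _ nOE OEx); split=> [Px|[[Q Qx] ->] //].
  by exists (exist _ P Px).
- by move=> a b P; case: cid.
- by move=> a b P; case: cid.
Qed.

Lemma frame_field : (forall p, ACF0 p -> models M (star p)) ->
  exists (K : closedFieldType) (g : K -> point),
    frame_arith O E E' (ring_arith K) g /\ [pchar K] =i pred0.
Proof.
move=> starM; have [T [ar [g gP]]] := frame_arith_exists.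
have [p acf_p|K [h [bij_h [h0 h1] hD hM charK]]] := @closed_field_ACF0 T ar.
  exact: models_star_frame (starM p acf_p) ncol gP.
exists K, (g \o h); split=> //; split=> //=.
- exact: inj_comp (frame_inj gP) (bij_inj bij_h).
- move=> P; rewrite (frame_onto gP); case: bij_h => h' hK h'K.
  by split=> -[a ->]; [exists (h' a); rewrite h'K|exists (h a)].
- by rewrite h0 (frame_0 gP).
- by rewrite h1 (frame_1 gP).
- by move=> a b P; rewrite (frame_add gP) hD.
- by move=> a b P; rewrite (frame_mul gP) hM.
Qed.

End Frame.
End AffineIncidence.

(** The sentence says that no point is both the zero and the unit of a frame.
    It excludes the plane with a single point and no lines, in which three equal
    points are not collinear. *)
Lemma star_neq01 (M : plane) (O E E' : pl_point M) :
  models M (star (RNot (REq RZero ROne))) -> ~ collinear O E E' -> O <> E.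
Proof. by move/models_starE => starM /starM + eqOE; apply; exists O. Qed.

(** * Linear equations for lines *)

(** The distributive law of a frame as a statement about points only, so that
    the laws of different frames can be combined. *)
Lemma frame_distributive (M : plane) (O E E' : pl_point M) (K : nzRingType)
    (g : K -> pl_point M) (A B C S T U V : pl_point M) :
  frame_arith O E E' (ring_arith K) g ->
  [/\ collinear A O E, collinear B O E & collinear C O E] ->
  coord_sum O E E' B C S ->
  [/\ coord_prod O E E' A S T, coord_prod O E E' A B U & coord_prod O E E' A C V] ->
  coord_sum O E E' U V T.
Proof.
move=> gP [/(frame_onto gP)[a ->] /(frame_onto gP)[b ->] /(frame_onto gP)[c ->]].
move=> /(frame_add gP) -> [/(frame_mul gP) -> /(frame_mul gP) -> /(frame_mul gP) ->].
by apply/(frame_add gP); rewrite /= mulrDr.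
Qed.

Section FrameCoordinates.
Variable M : plane.
Local Notation point := (pl_point M).
Local Notation line := (pl_line M).
Local Notation I := (@pl_inc M).

Hypotheses (incM : incidence_plane M) (parM : euclidean_parallels M).
Hypothesis lineM : inhabited line.
Hypothesis frameM : forall O E E' : point, ~ collinear O E E' ->
  exists (K : closedFieldType) (g : K -> point), frame_arith O E E' (ring_arith K) g.

Variables (O E E' : point) (lx ly lu : line).
Hypothesis ncol : ~ collinear O E E'.
Hypotheses (OEx : joins O E lx) (OEy : joins O E' ly) (EEu : joins E E' lu).
Variables (K : closedFieldType) (g : K -> point).
Hypothesis gP : frame_arith O E E' (ring_arith K) g.

Let nOE : O <> E. Proof. by have [] := frame_neq incM parM lineM ncol. Qed.
Let nOE' : O <> E'. Proof. by have [] := frame_neq incM parM lineM ncol. Qed.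
Let nEE' : E <> E'. Proof. by have [] := frame_neq incM parM lineM ncol. Qed.
Let nxy : ~ parallel lx ly := axes_not_parallel ncol OEx OEy.
Let nux : ~ parallel lu lx := unit_line_not_parallel_x ncol OEx EEu.
Let nuy : ~ parallel lu ly := unit_line_not_parallel_y ncol OEy EEu.
Let psym := @parallel_sym M.
Let ptrans := parallel_trans parM.

Lemma frame_x P : I P lx <-> exists a, P = g a.
Proof. by rewrite -(frame_onto gP) (collinear_on incM _ nOE OEx). Qed.

Let gx a : I (g a) lx. Proof. by apply/frame_x; exists a. Qed.

(** The axis [OE'] is coordinatized by projecting [OE] onto it along the
    direction of [EE'], as in the definition of the product. *)
Lemma transfer_point y : exists P, I P ly /\ exists m, [/\ I P m, I (g y) m & parallel m lu].
Proof.
have [m gm mu] := parallel_through parM lu (g y).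
have [|P [Pm Py]] := @meet_point M m ly.
  by move=> my; apply: nuy; apply: ptrans (psym mu) my.
by exists P; split=> //; exists m.
Qed.

Definition ypoint (y : K) : point := projT1 (cid (transfer_point y)).
Local Notation k := ypoint.

Lemma ypoint_y y : I (k y) ly. Proof. by rewrite /k; case: cid => P []. Qed.

Lemma ypointP y P m : I P ly -> I P m -> I (g y) m -> parallel m lu -> P = k y.
Proof.
rewrite /k; case: cid => Q /= [Qy [m' [Qm' gm' m'u]]] Py Pm gm mu.
rewrite -(parallel_unique parM gm gm' mu m'u) in Qm'.
by apply: (@meet_unique M incM m ly) => // my; apply: nuy; apply: ptrans (psym mu) my.
Qed.

Lemma ypoint_line y : exists m, [/\ I (k y) m, I (g y) m & parallel m lu].
Proof. by rewrite /k; case: cid => P []. Qed.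

Lemma ypoint_onto P : I P ly -> exists y, P = k y.
Proof.
move=> Py; have [m Pm mu] := parallel_through parM lu P.
have [|Q [Qm Qx]] := @meet_point M m lx.
  by move=> mx; apply: nux; apply: ptrans (psym mu) mx.
move/frame_x: Qx => [y eqQ]; exists y; rewrite eqQ in Qm.
exact: (ypointP Py Pm).
Qed.

Lemma ypoint_inj : injective k.
Proof.
move=> y z eqk; have [m [ym gm mu]] := ypoint_line y.
have [m' [zm' gm' m'u]] := ypoint_line z; rewrite -eqk in zm'.
rewrite -(parallel_unique parM ym zm' mu m'u) in gm'.
apply: (frame_inj gP); apply: (@meet_unique M incM m lx) => //.
by move=> mx; apply: nux; apply: ptrans (psym mu) mx.
Qed.

Lemma ypoint0 : k 0 = O.
Proof.
have [m Om mu] := parallel_through parM lu O.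
by apply/esym/(ypointP _ Om) => //; [case: OEy|rewrite (frame_0 gP)].
Qed.

Lemma ypoint1 : k 1 = E'.
Proof.
apply/esym/(@ypointP 1 E' lu); [by case: OEy|by case: EEu| |exact: parallel_refl].
by rewrite (frame_1 gP); case: EEu.
Qed.

Lemma ypoint_off_x y : y != 0 -> ~ I (k y) lx.
Proof.
move=> nz kx; case/eqP: nz; apply: ypoint_inj; rewrite ypoint0.
apply: (meet_unique incM nxy) => //; first exact: ypoint_y.
  by case: OEx.
by case: OEy.
Qed.

Lemma grid_point x y : exists P, exists v h,
  [/\ I P v, I P h, I (g x) v /\ parallel v ly & I (k y) h /\ parallel h lx].
Proof.
have [v gv vy] := parallel_through parM ly (g x).
have [h kh hx] := parallel_through parM lx (k y).
have [|P [Pv Ph]] := @meet_point M v h; last by exists P, v, h.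
by move=> vh; apply: nxy; apply: ptrans (psym hx) (ptrans (psym vh) vy).
Qed.

Definition grid (x y : K) : point := projT1 (cid (grid_point x y)).

Lemma grid_vertical x y v : I (g x) v -> parallel v ly -> I (grid x y) v.
Proof.
rewrite /grid; case: cid => P /= [v' [h [Pv' _ [gv' v'y] _]]] gv vy.
by rewrite (parallel_unique parM gv gv' vy v'y).
Qed.

Lemma grid_horizontal x y h : I (k y) h -> parallel h lx -> I (grid x y) h.
Proof.
rewrite /grid; case: cid => P /= [v [h' [_ Ph' _ [kh' h'x]]]] kh hx.
by rewrite (parallel_unique parM kh kh' hx h'x).
Qed.

Lemma gridP x y v h P : I (g x) v -> parallel v ly -> I (k y) h -> parallel h lx ->
  I P v -> I P h -> P = grid x y.
Proof.
move=> gv vy kh hx Pv Ph; apply: (@meet_unique M incM v h) => //.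
- by move=> vh; apply: nxy; apply: ptrans (psym hx) (ptrans (psym vh) vy).
- exact: grid_vertical.
- exact: grid_horizontal.
Qed.

Lemma grid_x0 x : grid x 0 = g x.
Proof.
have [v gv vy] := parallel_through parM ly (g x).
apply/esym/(gridP gv vy (h := lx)) => //; last exact: parallel_refl.
by rewrite ypoint0; case: OEx.
Qed.

Lemma grid_0y y : grid 0 y = k y.
Proof.
have [h kh hx] := parallel_through parM lx (k y).
apply/esym/(gridP (v := ly) _ _ kh hx) => //; last exact: ypoint_y.
  by rewrite (frame_0 gP); case: OEy.
exact: parallel_refl.
Qed.

Lemma grid_onto P : exists x y, P = grid x y.
Proof.
have [v Pv vy] := parallel_through parM ly P.
have [h Ph hx] := parallel_through parM lx P.
have [|Q [Qv /frame_x[x eqQ]]] := @meet_point M v lx.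
  by move=> vx; apply: nxy; apply: ptrans (psym vx) vy.
have [|R [Rh /ypoint_onto[y eqR]]] := @meet_point M h ly.
  by move=> hy; apply: nxy; apply: ptrans (psym hx) hy.
exists x, y; rewrite eqQ in Qv; rewrite eqR in Rh.
exact: (gridP Qv vy Rh hx).
Qed.

Lemma vertical_grid x x' y v :
  I (g x) v -> parallel v ly -> I (grid x' y) v <-> x' = x.
Proof.
move=> gv vy; split=> [Pv|->]; last exact: grid_vertical.
have [v' gv' v'y] := parallel_through parM ly (g x').
have eqv := parallel_unique parM Pv (grid_vertical y gv' v'y) vy v'y.
rewrite -eqv in gv'.
apply: (frame_inj gP); apply: (@meet_unique M incM v lx) => // vx.
by apply: nxy; apply: ptrans (psym vx) vy.
Qed.

Lemma horizontal_grid x y y' h :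
  I (k y) h -> parallel h lx -> I (grid x y') h <-> y' = y.
Proof.
move=> kh hx; split=> [Ph|->]; last exact: grid_horizontal.
have [h' kh' h'x] := parallel_through parM lx (k y').
have eqh := parallel_unique parM Ph (grid_horizontal x kh' h'x) hx h'x.
rewrite -eqh in kh'.
apply: ypoint_inj; apply: (@meet_unique M incM h ly) => //; try exact: ypoint_y.
by move=> hy; apply: nxy; apply: ptrans (psym hx) hy.
Qed.

Lemma grid_inj x y x' y' : grid x y = grid x' y' -> x = x' /\ y = y'.
Proof.
move=> eqP; have [v gv vy] := parallel_through parM ly (g x').
have [h kh hx] := parallel_through parM lx (k y').
split; first by apply/(vertical_grid x y gv vy); rewrite eqP; exact: grid_vertical.
by apply/(horizontal_grid x y kh hx); rewrite eqP; exact: grid_horizontal.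
Qed.

(** Slopes are measured against [E']: the line joining [E'] to the point [a] of
    the first axis has the equation [x + a * y = a]. *)
Definition slope (a : K) (m : line) : Prop :=
  exists n, [/\ I E' n, I (g a) n & parallel m n].

Let nE'g a : E' <> g a.
Proof.
by move=> eqE'; apply: (unit_off_axis ncol OEx); rewrite eqE'; exact: gx.
Qed.

Lemma slope_through a P : exists2 m, I P m & slope a m.
Proof.
have [n [E'n gn]] := line_through incM (@nE'g a).
by have [m Pm mn] := parallel_through parM n P; exists m => //; exists n.
Qed.

Lemma slope_parallel a m m' : slope a m -> parallel m m' <-> slope a m'.
Proof.
move=> [n [E'n gn mn]]; split=> [mm'|[n' [E'n' gn' m'n']]].
  by exists n; split=> //; apply: ptrans (psym mm') mn.
rewrite -(join_unique incM (@nE'g a) (conj E'n gn) (conj E'n' gn')) in m'n'.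
exact: ptrans mn (psym m'n').
Qed.

Lemma slope_unique a m m' P : slope a m -> slope a m' -> I P m -> I P m' -> m = m'.
Proof. by move=> am /(slope_parallel _ am); exact: parallel_meet. Qed.

Lemma slope_crosses_x a m : slope a m -> ~ parallel m lx.
Proof.
move=> [n [E'n gn mn]] mx; apply: (unit_off_axis ncol OEx).
by rewrite -(parallel_meet (ptrans (psym mn) mx) gn (gx a)).
Qed.

Lemma slope_x a m : slope a m -> exists c, I (g c) m.
Proof.
move=> /slope_crosses_x/meet_point[P [Pm /frame_x[c eqP]]].
by exists c; rewrite -eqP.
Qed.

Lemma slope_x_unique a m c d : slope a m -> I (g c) m -> I (g d) m -> c = d.
Proof.
move=> am cm dm; apply: (frame_inj gP).
exact: (meet_unique incM (slope_crosses_x am)).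
Qed.

Lemma crossing_slope m : ~ parallel m lx -> exists a, slope a m.
Proof.
move=> nmx; have [n E'n nm] := parallel_through parM m E'.
have [|P [Pn /frame_x[a eqP]]] := @meet_point M n lx.
  by move=> nx; apply: nmx; apply: ptrans (psym nm) nx.
by exists a, n; split; rewrite -?eqP //; exact: psym.
Qed.

Lemma slope0 : slope 0 ly.
Proof.
exists ly; split; [by case: OEy|by rewrite (frame_0 gP); case: OEy|exact: parallel_refl].
Qed.

Lemma slope1 : slope 1 lu.
Proof.
by exists lu; split; [case: EEu|rewrite (frame_1 gP); case: EEu|exact: parallel_refl].
Qed.

Lemma on_parallel_slope a m n A B X Y : A <> B -> slope a n -> slope a m ->
  I A n -> I B n -> I Y m -> on_parallel X Y A B <-> I X m.
Proof.
move=> neqAB an am An Bn Ym; apply: (on_parallelP incM parM _ neqAB (conj An Bn) Ym).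
exact/(slope_parallel _ am).
Qed.

(** This is the definition of the product. *)
Lemma slope_yaxis a b c m : slope a m -> I (k b) m -> I (g c) m <-> c = a * b.
Proof.
move=> am kbm.
have kP P : coord_prod O E E' (g a) (g b) P <-> I P m /\ I P lx.
  have [n [E'n gn mn]] := am; have [u [ku gu uu]] := ypoint_line b.
  split=> [[B' [B'O B'b PB' PO]]|[Pm Px]].
    have eqB : B' = k b.
      apply: (@ypointP b B' u) => //; first exact/(collinear_on incM _ nOE' OEy).
      by apply/(on_parallelP incM parM _ nEE' EEu gu uu).
    rewrite eqB in PB'; split; last exact/(collinear_on incM _ nOE OEx).
    exact/(on_parallelP incM parM _ (@nE'g a) (conj E'n gn) kbm mn).
  exists (k b); split.
  - by apply/(collinear_on incM _ nOE' OEy); exact: ypoint_y.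
  - by apply/(on_parallelP incM parM _ nEE' EEu gu uu).
  - by apply/(on_parallelP incM parM _ (@nE'g a) (conj E'n gn) kbm mn).
  - by apply/(collinear_on incM _ nOE OEx).
split=> [gm|->].
  by apply: (frame_inj gP); apply/(frame_mul gP)/kP.
by have /kP[] : coord_prod O E E' (g a) (g b) (g (a * b)) by apply/(frame_mul gP).
Qed.

(** In the frame with [k y] in place of [E'], the line through [k y] and
    [a * y] has slope [a] by [slope_yaxis], and the parallel to the first axis
    through [k y] consists of the points of height [y]. *)
Lemma coord_sum_slope y a x c m : y != 0 -> slope a m -> I (grid x y) m ->
  coord_sum O E (k y) (g x) (g (a * y)) (g c) <-> I (g c) m.
Proof.
move=> nz am Pm.
have nOk : O <> k y by rewrite -ypoint0 => /ypoint_inj/esym/eqP; exact/negP.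
have nkg : k y <> g (a * y).
  by move=> eqk; apply: (ypoint_off_x nz); rewrite eqk; exact: gx.
have [n kn an] := slope_through a (k y).
have gn : I (g (a * y)) n by apply/(slope_yaxis _ an kn).
have [v gv vy] := parallel_through parM ly (g x).
have [h kh hx] := parallel_through parM lx (k y).
have Oky : joins O (k y) ly by split; [case: OEy|exact: ypoint_y].
split=> [[P [PO PE cP _]]|cm].
  have eqP : P = grid x y.
    apply: (gridP gv vy kh hx).
      exact/(on_parallelP incM parM _ nOk Oky gv vy).
    exact/(on_parallelP incM parM _ nOE OEx kh hx).
  rewrite eqP in cP.
  exact/(on_parallel_slope _ nkg an am kn gn Pm).
exists (grid x y); split.
- by apply/(on_parallelP incM parM _ nOk Oky gv vy); exact: grid_vertical.
- by apply/(on_parallelP incM parM _ nOE OEx kh hx); exact: grid_horizontal.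
- by apply/(on_parallel_slope _ nkg an am kn gn Pm).
- by apply/(collinear_on incM _ nOE OEx); exact: gx.
Qed.

(** This is the definition of the sum. *)
Lemma slope_horizontal1 a x c m :
  slope a m -> I (grid x 1) m -> I (g c) m <-> c = x + a.
Proof.
move=> am Pm; have := coord_sum_slope c (oner_neq0 K) am Pm.
rewrite ypoint1 mulr1 => <-; rewrite (frame_add gP) /=.
by split=> [/(frame_inj gP)|->].
Qed.

(** Moving [E'] along the second axis divides all slopes by [y] and multiplies
    the transferred second factor by [y]; the two effects cancel by
    associativity. *)
Lemma coord_prod_scaled y a b : y != 0 -> coord_prod O E (k y) (g a) (g b) (g (a * b)).
Proof.
move=> nz.
have nOk : O <> k y by rewrite -ypoint0 => /ypoint_inj/esym/eqP; exact/negP.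
have off z : k y <> g z.
  by move=> eqk; apply: (ypoint_off_x nz); rewrite eqk; exact: gx.
have nEk : E <> k y by rewrite -(frame_1 gP) => /esym; exact: off.
have Oky : joins O (k y) ly by split; [case: OEy|exact: ypoint_y].
exists (k (b * y)); split.
- by apply/(collinear_on incM _ nOk Oky); exact: ypoint_y.
- have [n kn an] := slope_through y^-1 (k y).
  have [m km am] := slope_through y^-1 (k (b * y)).
  apply/(on_parallel_slope _ nEk an am _ kn) => //.
    by rewrite -(frame_1 gP); apply/(slope_yaxis _ an kn); rewrite mulVf.
  by apply/(slope_yaxis _ am km); rewrite mulrCA mulVf ?mulr1.
- have [n kn an] := slope_through (a / y) (k y).
  have [m km am] := slope_through (a / y) (k (b * y)).
  apply/(on_parallel_slope _ (off a) an am kn _ km).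
    by apply/(slope_yaxis _ an kn); rewrite divfK.
  by apply/(slope_yaxis _ am km); rewrite mulrCA divfK // mulrC.
- by apply/(collinear_on incM _ nOE OEx); exact: gx.
Qed.

(** With [k y] in place of [E'], [s] is the sum of [x] and [y], and the
    distributive law makes [a * s] the sum of [a * x] and [a * y]; both sums are
    read off lines through points of height [y], of slope 1 and [a]. *)
Lemma slope_scaling a x y s m m1 : y != 0 ->
  slope 1 m1 -> I (grid x y) m1 -> I (g s) m1 ->
  slope a m -> I (grid (a * x) y) m -> I (g (a * s)) m.
Proof.
move=> nz am1 Pm1 sm1 am Pm.
have ncol_y : ~ collinear O E (k y).
  by move=> [l [Ol El kl]]; apply: (ypoint_off_x nz);
    rewrite (join_unique incM nOE OEx (conj Ol El)).
have [L [h hP]] := frameM ncol_y.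
have colg b : collinear (g b) O E by apply/(collinear_on incM _ nOE OEx); exact: gx.
apply/(coord_sum_slope _ nz am Pm).
apply: (frame_distributive hP (A := g a) (B := g x) (C := g y) (S := g s)) => //.
  by have := (coord_sum_slope _ nz am1 Pm1).2 sm1; rewrite mul1r.
by split; exact: coord_prod_scaled.
Qed.

Let ncol' : ~ collinear O E' E.
Proof. by move=> [l [Ol E'l El]]; apply: ncol; exists l. Qed.

(** Exchanging the axes replaces the slope [a] by its inverse, so the
    construction of the product computes the same value. *)
Lemma coord_prod_swapped a b : a != 0 -> coord_prod O E' E (k a) (k b) (k (a * b)).
Proof.
move=> nz.
have nEk : E <> k a.
  by move=> eqE; apply: (ypoint_off_x nz); rewrite -eqE; case: OEx.
exists (g b); split.
- by apply/(collinear_on incM _ nOE OEx); exact: gx.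
- have [m km am] := slope_through 1 (k b).
  apply/(on_parallel_slope _ (not_eq_sym nEE') slope1 am _ _ km).
  - by case: EEu.
  - by case: EEu.
  - by apply/(slope_yaxis _ am km); rewrite mul1r.
- have [n kn an] := slope_through a^-1 (k a).
  have [m km am] := slope_through a^-1 (k (a * b)).
  apply/(on_parallel_slope _ nEk an am _ kn) => //.
    by rewrite -(frame_1 gP); apply/(slope_yaxis _ an kn); rewrite mulVf.
  by apply/(slope_yaxis _ am km); rewrite mulKf.
- by apply/(collinear_on incM _ nOE' OEy); exact: ypoint_y.
Qed.

(** The line constructing the sum of [y] and [t] in the exchanged frame has
    slope [t^-1] and passes through [(1, y)]; [slope_scaling] compares it with
    the line of slope 1 through [(t, y)]. *)
Lemma coord_sum_swapped y t s m : y != 0 -> t != 0 ->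
  slope 1 m -> I (grid t y) m -> I (g s) m -> coord_sum O E' E (k y) (k t) (k s).
Proof.
move=> nzy nzt am Pm sm.
have nEk : E <> k t.
  by move=> eqE; apply: (ypoint_off_x nzt); rewrite -eqE; case: OEx.
have [v Ev vy] := parallel_through parM ly E.
have [h kh hx] := parallel_through parM lx (k y).
exists (grid 1 y); split.
- by apply/(on_parallelP incM parM _ nOE OEx kh hx); exact: grid_horizontal.
- apply/(on_parallelP incM parM _ nOE' OEy Ev vy); apply: grid_vertical => //.
  by rewrite (frame_1 gP).
- have [n kn an] := slope_through t^-1 (k t).
  have [m' Pm' am'] := slope_through t^-1 (grid 1 y).
  apply/(on_parallel_slope _ nEk an am' _ kn) => //.
    by rewrite -(frame_1 gP); apply/(slope_yaxis _ an kn); rewrite mulVf.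
  have [m2 km2 am2] := slope_through t^-1 (k s).
  suff <- : m2 = m' by [].
  apply: (@slope_unique t^-1 _ _ (g (t^-1 * s))) => //.
    exact/(slope_yaxis _ am2 km2).
  by apply: (slope_scaling nzy am Pm sm am'); rewrite mulVf.
- by apply/(collinear_on incM _ nOE' OEy); exact: ypoint_y.
Qed.

(** For [y = 1] this is [slope_horizontal1].  In the exchanged frame the sum of
    [y] and [t] is [y] times the sum of 1 and [t / y], which is that case. *)
Lemma slope1_grid t y m : t != 0 -> y != 0 ->
  slope 1 m -> I (grid t y) m -> I (g (t + y)) m.
Proof.
move=> nzt nzy am Pm; have [s sm] := slope_x am.
suff <- : s = t + y by [].
have [L [h hP]] := frameM ncol'.
have sumE := coord_sum_swapped nzy nzt am Pm sm.
apply: ypoint_inj; have [m1 Pm1 am1] := slope_through 1 (grid (t / y) 1).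
have nzty : t / y != 0 by rewrite mulf_neq0 ?invr_neq0.
have sum1 : coord_sum O E' E (k 1) (k (t / y)) (k (t / y + 1)).
  apply: (coord_sum_swapped _ _ am1) => //; first exact: oner_neq0.
  exact/(slope_horizontal1 _ am1 Pm1).
have colk b : collinear (k b) O E'.
  by apply/(collinear_on incM _ nOE' OEy); exact: ypoint_y.
have sumE' : coord_sum O E' E (k y) (k t) (k (t + y)).
  have Dt : y * (t / y) = t by rewrite mulrCA divff ?mulr1.
  have Dty : y * (t / y + 1) = t + y by rewrite mulrDr Dt mulr1.
  apply: (frame_distributive hP (A := k y) (B := k 1) (C := k (t / y)) _ sum1) => //.
  have P1 := coord_prod_swapped (t / y + 1) nzy; rewrite Dty in P1.
  have P2 := coord_prod_swapped 1 nzy; rewrite mulr1 in P2.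
  have P3 := coord_prod_swapped (t / y) nzy; rewrite Dt in P3.
  by split.
have /(frame_onto hP)[b yb] := colk y; have /(frame_onto hP)[c tc] := colk t.
move: sumE sumE'; rewrite yb tc.
by move=> /(frame_add hP) -> /(frame_add hP) ->.
Qed.

(** [slope_scaling] carries the case of slope 1 to slope [a]; points on the
    axes and vertical lines are treated separately. *)
Lemma slope_grid a x y c m :
  slope a m -> I (g c) m -> I (grid x y) m <-> x + a * y = c.
Proof.
have fwd x' y' m' : slope a m' -> I (grid x' y') m' -> I (g (x' + a * y')) m'.
  move=> am' Pm'; have [y0|nzy] := eqVneq y' 0.
    by move: Pm'; rewrite y0 grid_x0 mulr0 addr0.
  have [x0|nzx] := eqVneq x' 0.
    by move: Pm'; rewrite x0 grid_0y add0r => km; apply/(slope_yaxis _ am' km).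
  have [a0|nza] := eqVneq a 0.
    rewrite a0 mul0r addr0; rewrite a0 in am'.
    have [v gv vy] := parallel_through parM ly (g x').
    suff -> : m' = v by [].
    apply: (slope_unique am' _ Pm' (grid_vertical y' gv vy)).
    exact/(slope_parallel _ slope0)/psym.
  have nzxa : x' / a != 0 by rewrite mulf_neq0 ?invr_neq0.
  have [m1 Pm1 am1] := slope_through 1 (grid (x' / a) y').
  have := slope_scaling nzy am1 Pm1 (slope1_grid nzxa nzy am1 Pm1) am'.
  by rewrite mulrDr mulrCA divff // mulr1; exact.
move=> am cm; split=> [Pm|Dc]; first exact: slope_x_unique am (fwd _ _ _ am Pm) cm.
have [m' Pm' am'] := slope_through a (grid x y).
suff <- : m' = m by [].
by apply: (slope_unique am' am _ cm); rewrite -Dc; exact: fwd.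
Qed.

Lemma grid_coordinates : affine_coordinates grid.
Proof.
split.
- exact: grid_inj.
- exact: grid_onto.
- move=> m; have [mx|/crossing_slope[a am]] := pselect (parallel m lx).
    have [|P [Pm /ypoint_onto[y Dk]]] := @meet_point M m ly.
      by move=> my; apply: nxy; apply: ptrans (psym mx) my.
    rewrite Dk in Pm; exists 0, 1, (- y); split; first by case=> /eqP; rewrite oner_eq0.
    move=> x' y'; rewrite (horizontal_grid _ _ Pm mx) mul0r add0r mul1r.
    by split=> [->|/subr0_eq //]; rewrite subrr.
  have [c cm] := slope_x am; exists 1, a, (- c).
  split; first by case=> /eqP; rewrite oner_eq0.
  move=> x y; rewrite (slope_grid _ _ am cm) mul1r.
  by split=> [->|/subr0_eq //]; rewrite subrr.
- move=> a b c nz; have [a0|nza] := eqVneq a 0.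
    have nzb : b != 0 by apply/eqP => b0; apply: nz; rewrite a0 b0.
    have [h kh hx] := parallel_through parM lx (k (- c / b)).
    exists h; split=> // x y; rewrite (horizontal_grid _ _ kh hx) a0 mul0r add0r.
    split=> [->|/eqP]; first by rewrite mulrC divfK // addNr.
    by rewrite addr_eq0 => /eqP <-; rewrite mulrC mulKf.
  have [m cm am] := slope_through (b / a) (g (- c / a)).
  exists m; split=> // x y; rewrite (slope_grid _ _ am cm).
  split=> [/(congr1 ( *%R a))|].
    rewrite mulrDr [a * (- c / a)]mulrC divfK // mulrA [a * (b / a)]mulrC divfK //.
    by move->; rewrite addNr.
  move/eqP; rewrite addr_eq0 => /eqP <-.
  by rewrite mulrDl [a * x]mulrC mulfK // mulrAC.
- by move=> l l'; exact: line_extensional.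
Qed.

Lemma grid_axes : has_equation grid lx 0 1 0 /\ has_equation grid ly 1 0 0.
Proof.
split; split; try by case=> /eqP; rewrite oner_eq0.
- have k0x : I (k 0) lx by rewrite ypoint0; case: OEx.
  move=> x y; rewrite (horizontal_grid _ _ k0x (parallel_refl lx)).
  by rewrite mul0r add0r mul1r addr0.
- have g0y : I (g 0) ly by rewrite (frame_0 gP); case: OEy.
  move=> x y; rewrite (vertical_grid _ _ g0y (parallel_refl ly)).
  by rewrite mul0r mul1r !addr0.
Qed.

End FrameCoordinates.

Theorem plane_coordinates (M : plane) (O E E' : pl_point M) (lx ly : pl_line M) :
  incidence_plane M -> euclidean_parallels M -> (forall p, ACF0 p -> models M (star p)) ->
  ~ collinear O E E' -> joins O E lx -> joins O E' ly ->
  exists (K : closedFieldType) (pt : K -> K -> pl_point M),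
    [/\ affine_coordinates pt, [pchar K] =i pred0,
        has_equation pt lx 0 1 0 & has_equation pt ly 1 0 0].
Proof.
move=> incM parM starM ncol OEx OEy.
have lineM : inhabited (pl_line M) by exact: inhabits lx.
have frameM O1 E1 E1' : ~ collinear O1 E1 E1' -> exists (K : closedFieldType)
    (g : K -> pl_point M), frame_arith O1 E1 E1' (ring_arith K) g.
  by move=> /(frame_field incM parM lineM) -/(_ starM) [K [g [gP _]]]; exists K, g.
have [K [g [gP charK]]] := frame_field incM parM lineM ncol starM.
have [_ _ /(line_through incM)[lu EEu]] := frame_neq incM parM lineM ncol.
exists K, (grid parM ncol OEx OEy EEu g).
have [lxE lyE] := grid_axes incM parM lineM ncol OEx OEy EEu gP.
split=> //; exact: (grid_coordinates incM parM lineM frameM ncol OEx OEy EEu gP).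
Qed.

(** * Geometry of coordinate planes *)

Section CoordinateGeometry.
Variables (M : plane) (K : fieldType) (pt : K -> K -> pl_point M).
Hypothesis cM : affine_coordinates pt.
Local Notation point := (pl_point M).
Local Notation line := (pl_line M).
Local Notation I := (@pl_inc M).
Local Notation eqn := (has_equation pt).
Implicit Types (l m : line) (a b c x y : K).

Lemma pair_neq0 (a b : K) : (a, b) <> (0, 0) <-> (a != 0) || (b != 0).
Proof.
rewrite -negb_and; split=> [nz|/negP nz [a0 b0]]; last by apply: nz; rewrite a0 b0 !eqxx.
by apply/negP => /andP[/eqP a0 /eqP b0]; apply: nz; rewrite a0 b0.
Qed.

Lemma proportional a b u v : (u, v) <> (0, 0) -> a * v - b * u = 0 ->
  exists t, a = t * u /\ b = t * v.
Proof.
move=> /pair_neq0/orP[nz|nz] D.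
  by exists (a / u); rewrite divfK //; split=> //; apply: (mulIf nz);
     rewrite mulrAC divfK //; apply/esym/subr0_eq.
by exists (b / v); rewrite divfK //; split=> //; apply: (mulIf nz);
   rewrite mulrAC divfK //; apply/subr0_eq.
Qed.

Lemma proportional_neq0 a b u v : (a, b) <> (0, 0) -> (u, v) <> (0, 0) ->
  a * v - b * u = 0 -> exists t, [/\ t != 0, a = t * u & b = t * v].
Proof.
move=> nzab nzuv /(proportional nzuv)[t [Da Db]]; exists t; split=> //.
by apply/eqP => t0; apply: nzab; rewrite Da Db t0 !mul0r.
Qed.

Lemma cramer a b c a' b' c' : a * b' - b * a' != 0 ->
  exists x y, a * x + b * y + c = 0 /\ a' * x + b' * y + c' = 0.
Proof.
move=> nz; exists ((b * c' - c * b') / (a * b' - b * a')), ((c * a' - a * c') / (a * b' - b * a')).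
by split; field.
Qed.

Lemma equation_ext l m a b c : eqn l a b c -> eqn m a b c -> l = m.
Proof.
move=> [_ lE] [_ mE]; apply: (line_ext cM) => P.
by have [x [y ->]] := pt_surj cM P; rewrite lE mE.
Qed.

Lemma equation_scale l a b c t : t != 0 -> eqn l a b c -> eqn l (t * a) (t * b) (t * c).
Proof.
move=> nz [/pair_neq0 nzab lE]; split; first by apply/pair_neq0; rewrite !mulf_eq0 (negPf nz).
move=> x y; rewrite lE -!mulrA -!mulrDr; split=> [->|/eqP]; first by rewrite mulr0.
by rewrite mulf_eq0 (negPf nz) => /eqP.
Qed.

Lemma equation_points l a b c : eqn l a b c ->
  exists x y, I (pt x y) l /\ I (pt (x + b) (y - a)) l.
Proof.
move=> [/pair_neq0 nzab lE].
have [x [y Exy]] : exists x y, a * x + b * y + c = 0.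
  have [a0|nza] := eqVneq a 0.
    exists 0, (- c / b); rewrite mulr0 add0r mulrC divfK ?addNr //.
    by move: nzab; rewrite a0 eqxx.
  by exists (- c / a), 0; rewrite mulr0 addr0 mulrC divfK ?addNr.
by exists x, y; rewrite !lE; split=> //; rewrite -[RHS]Exy; ring.
Qed.

Lemma neq_points x y x' y' : pt x y <> pt x' y' <-> (x' - x, y' - y) <> (0, 0).
Proof.
split=> [neq [dx dy]|neq /(pt_inj cM)[ex ey]]; last by apply: neq; rewrite ex ey !subrr.
by apply: neq; rewrite (subr0_eq dx) (subr0_eq dy).
Qed.

Lemma joins_equation x y x' y' l : pt x y <> pt x' y' -> joins (pt x y) (pt x' y') l ->
  eqn l (y - y') (x' - x) (x * y' - x' * y).
Proof.
move=> /neq_points nz [Pl Ql]; have [a [b [c [nzab lE]]]] := line_equation cM l.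
move: Pl Ql; rewrite !lE => Pl Ql.
have nz' : (y - y', x' - x) <> (0, 0).
  by move=> [/subr0_eq dy dx]; apply: nz; rewrite dx dy subrr.
have [|t [nzt Da Db]] := proportional_neq0 nzab nz'.
  by rewrite -[RHS](subrr 0) -{1}Ql -Pl; ring.
split=> // u v; rewrite lE.
have -> : a * u + b * v + c = t * ((y - y') * u + (x' - x) * v + (x * y' - x' * y)).
  have Dc : c = - (a * x + b * y) by apply/eqP; rewrite -addr_eq0 addrC Pl.
  by rewrite Dc Da Db; ring.
split=> [/eqP|->]; last by rewrite mulr0.
by rewrite mulf_eq0 (negPf nzt) => /eqP.
Qed.

Lemma joins_inc x y x' y' l u v : pt x y <> pt x' y' -> joins (pt x y) (pt x' y') l ->
  I (pt u v) l <-> (u - x) * (y' - y) - (v - y) * (x' - x) = 0.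
Proof.
move=> neq /(joins_equation neq)[_ ->].
have -> : (y - y') * u + (x' - x) * v + (x * y' - x' * y)
    = - ((u - x) * (y' - y) - (v - y) * (x' - x)) by ring.
by split=> [/eqP|->]; rewrite ?oppr0 // oppr_eq0 => /eqP.
Qed.

Lemma equation_unique l a b c a' b' c' : eqn l a b c -> eqn l a' b' c' -> a * b' - b * a' = 0.
Proof.
move=> lE [nz' lE']; have [x [y [Pl Ql]]] := equation_points lE.
move: Pl Ql; rewrite !lE' => Pl Ql; rewrite -[RHS](subrr 0) -{1}Pl -Ql; ring.
Qed.

Lemma parallel_equation l m a b c a' b' c' : eqn l a b c -> eqn m a' b' c' ->
  parallel l m <-> a * b' - b * a' = 0.
Proof.
move=> lE mE; split=> [[eqlm|npt]|D].
- by rewrite eqlm in lE; exact: equation_unique lE mE.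
- apply/eqP; apply: contra_notT npt => /(cramer c c')[x [y [Exy Exy']]].
  by exists (pt x y); rewrite (proj2 lE) (proj2 mE).
have [[P [Pl Pm]]|] := pselect (exists P, I P l /\ I P m); last by right.
have [t [nzt Da Db]] := proportional_neq0 (proj1 lE) (proj1 mE) D.
left; apply: (equation_ext lE); rewrite Da Db.
have [x [y DP]] := pt_surj cM P; move: Pl Pm.
rewrite DP (proj2 lE) (proj2 mE) => Pl Pm.
have -> : c = t * c'; last exact: equation_scale.
have solve a1 b1 c1 : a1 * x + b1 * y + c1 = 0 -> c1 = - (a1 * x + b1 * y).
  by move=> E; apply/eqP; rewrite -addr_eq0 addrC E.
by rewrite (solve _ _ _ Pl) (solve _ _ _ Pm) Da Db; ring.
Qed.

Lemma line_at a b x y : (a, b) <> (0, 0) ->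
  exists l, [/\ eqn l a b (- (a * x + b * y)), I (pt x y) l &
    forall m a' b' c', eqn m a' b' c' -> a * b' - b * a' = 0 -> I (pt x y) m -> m = l].
Proof.
move=> nz; have [l lE] := equation_line cM (- (a * x + b * y)) nz; exists l; split=> //.
  by rewrite (proj2 lE) subrr.
move=> m a' b' c' mE D Pm; have /(parallel_equation lE mE)[//|npt] := D.
by case: npt; exists (pt x y); rewrite (proj2 lE) subrr.
Qed.

Lemma coordinates_incidence : incidence_plane M.
Proof.
split.
- move=> A B; have [x [y ->]] := pt_surj cM A; have [x' [y' ->]] := pt_surj cM B.
  move=> neq; have nz : (y - y', x' - x) <> (0, 0).
    by case=> /subr0_eq dy /subr0_eq dx; apply: neq; rewrite dx dy.
  have [l lE] := equation_line cM (x * y' - x' * y) nz; exists l; split.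
    by split; rewrite (proj2 lE); ring.
  by move=> m /(joins_equation neq) mE; exact: equation_ext lE mE.
- move=> l; have [a [b [c lE]]] := line_equation cM l.
  have [x [y [Pl Ql]]] := equation_points lE.
  exists (pt x y), (pt (x + b) (y - a)); split=> //; apply/neq_points.
  rewrite addrAC subrr add0r addrAC subrr add0r => -[eb ea].
  by apply: (proj1 lE); rewrite eb -[a]opprK ea oppr0.
- exists (pt 0 0), (pt 1 0), (pt 0 1) => -[l [Ol El E'l]].
  have [a [b [c [nz lE]]]] := line_equation cM l.
  move: Ol El E'l; rewrite !lE !mulr0 !mulr1 !add0r => ->; rewrite !addr0 => ea eb.
  by apply: nz; rewrite ea eb.
Qed.

Lemma coordinates_parallels : euclidean_parallels M.
Proof.
move=> l A; have [x [y ->]] := pt_surj cM A.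
have [a [b [c lE]]] := line_equation cM l.
have [m [mE Pm mU]] := line_at x y (proj1 lE); exists m; split.
  by split=> //; apply/(parallel_equation mE lE); ring.
move=> n [Pn /parallel_sym nl]; have [a' [b' [c' nE]]] := line_equation cM n.
by apply/esym/(mU n a' b' c' nE) => //; apply/(parallel_equation lE nE).
Qed.

Lemma coordinates_line : inhabited line.
Proof.
have nz : (1 : K, 0 : K) <> (0, 0) by case=> /eqP; rewrite oner_eq0.
by have [l _] := equation_line cM 0 nz.
Qed.

End CoordinateGeometry.

(** * Orthogonality in coordinates *)

Lemma parallel_rel_equation (M : plane) (K : fieldType) (pt : K -> K -> pl_point M) :
  affine_coordinates pt -> (forall l m : pl_line M, pl_rel l m <-> parallel l m) ->
  rel_equation pt false.
Proof.
by move=> cM relM l m a b c a' b' c' lE mE; rewrite relM (parallel_equation cM lE mE).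
Qed.

Section Orthogonality.
Variable M : plane.
Local Notation point := (pl_point M).
Local Notation line := (pl_line M).
Local Notation I := (@pl_inc M).
Local Notation rel := (@pl_rel M).
Hypothesis relC : forall l m : line, rel l m <-> rel m l.
Hypothesis perpendicular : forall (P : point) (l : line), exists! m, rel l m /\ I P m.
Hypothesis rel_parallel : forall l m n : line, rel l m /\ rel l n -> parallel m n.
Hypothesis heights : heights_concur M.

(** The lines orthogonal to a given line form exactly one parallel class. *)
Lemma rel_iff_parallel (l m : line) (n : line) :
  incidence_plane M -> euclidean_parallels M -> rel l m -> rel l n <-> parallel m n.
Proof.
move=> incM parM lm; split=> [ln|mn]; first exact: rel_parallel (conj lm ln).
have [P [_ [_ Pn _]]] := inc_two incM n.
have [n' [[ln' Pn'] _]] := perpendicular P l.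
suff <- : n' = n by [].
apply: (parallel_meet _ Pn' Pn).
exact: parallel_trans parM _ _ _ (parallel_sym (rel_parallel (conj lm ln'))) mn.
Qed.

Variables (K : closedFieldType) (pt : K -> K -> point) (lx ly : line).
Hypothesis cM : affine_coordinates pt.
Local Notation eqn := (has_equation pt).
Hypotheses (lxE : eqn lx 0 1 0) (lyE : eqn ly 1 0 0) (rel_xy : rel lx ly).

Let incM := coordinates_incidence cM.
Let parM := coordinates_parallels cM.
Local Notation perpP := (rel_iff_parallel _ incM parM).

(** As the axes are orthogonal, a line parallel to neither axis is orthogonal
    only to such lines. *)
Lemma perpendicular_slope p : p != 0 -> exists q, q != 0 /\
  forall l m c a' b' c', eqn l 1 p c -> eqn m a' b' c' -> rel l m <-> a' * q - b' = 0.
Proof.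
move=> nzp; have nz1 : (1 : K, p) <> (0, 0) by apply/pair_neq0; rewrite oner_eq0.
have [l0 l0E] := equation_line cM 0 nz1.
have [m0 [[l0m0 _] _]] := perpendicular (pt 0 0) l0.
have [a [b [c mE]]] := line_equation cM m0.
have nza : a != 0.
  apply/eqP => a0; have /(perpP rel_xy) : rel lx l0.
    have /perpP H : rel m0 l0 by apply/relC.
    apply/relC; apply/(perpP l0m0); apply/(parallel_equation cM mE lxE).
    by rewrite a0; ring.
  move/(parallel_equation cM lyE l0E); rewrite mul1r mul0r subr0 => p0.
  by rewrite p0 eqxx in nzp.
have nzb : b != 0.
  apply/eqP => b0; have rel_yx : rel ly lx by apply/relC.
  have /(perpP rel_yx) : rel ly l0.
    apply/relC; apply/(perpP l0m0); apply/(parallel_equation cM mE lyE).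
    by rewrite b0; ring.
  move/(parallel_equation cM lxE l0E); rewrite mul0r mul1r sub0r => /eqP.
  by rewrite oppr_eq0 oner_eq0.
exists (b / a); split; first by rewrite mulf_neq0 ?invr_neq0.
move=> l m c1 a' b' c' lE m'E.
have lm0 : rel l m0.
  by apply/relC/(perpP (proj1 (relC _ _) l0m0)); apply/(parallel_equation cM l0E lE); ring.
rewrite (perpP lm0) (parallel_equation cM mE m'E).
have -> : a' * (b / a) - b' = - (a * b' - b * a') / a by field.
split=> [->|/eqP]; first by rewrite oppr0 mul0r.
by rewrite mulf_eq0 invr_eq0 (negPf nza) orbF oppr_eq0 => /eqP.
Qed.

(** Let [tau p] be the slope orthogonal to [p].  In the triangle
    [(p, 0), (1, 0), (0, 1)] the height through [(0, 1)] is the second axis, and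
    the two other heights meet it at heights [p / tau 1] and [1 / tau p].  They
    concur, so [p * tau p = tau 1]. *)
Lemma perpendicular_slopes_const : exists k, k != 0 /\
  forall p l m c a' b' c', p != 0 ->
    eqn l 1 p c -> eqn m a' b' c' -> rel l m <-> a' * k - b' * p = 0.
Proof.
have tau_ex p : exists q, p != 0 -> q != 0 /\
    forall l m c a' b' c', eqn l 1 p c -> eqn m a' b' c' -> rel l m <-> a' * q - b' = 0.
  have [nzp|] := pselect (p != 0); last by exists 0.
  by have [q qP] := perpendicular_slope nzp; exists q.
have [tau tauP'] := choice tau_ex.
have tau_neq0 p : p != 0 -> tau p != 0 by move=> /tauP'[].
have tauP p l m c a' b' c' : p != 0 -> eqn l 1 p c -> eqn m a' b' c' ->
    rel l m <-> a' * tau p - b' = 0.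
  by move=> /tauP'[_]; apply.
have nz10 : (1 : K) != 0 by exact: oner_neq0.
have nz1p (p : K) : (1 : K, p) <> (0, 0) by apply/pair_neq0; rewrite oner_eq0.
have const p : p != 0 -> p * tau p = tau 1.
  move=> nzp; have [->|neq1] := eqVneq p 1; first by rewrite mul1r.
  have ptn x y x' y' : (x' - x != 0) || (y' - y != 0) -> pt x y <> pt x' y'.
    by move=> /pair_neq0 nz; apply/neq_points.
  have [a aE] := equation_line cM (- 1) (nz1p 1).
  have [b bE] := equation_line cM (- p) (nz1p p).
  have [ha haE] := equation_line cM (- p) (nz1p (tau 1)).
  have [hb hbE] := equation_line cM (- 1) (nz1p (tau p)).
  have [|||||||H [[Ha Hb Hc] _]] := heights (A := pt p 0) (B := pt 1 0) (C := pt 0 1)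
      (a := a) (b := b) (c := lx) (ha := ha) (hb := hb) (hc := ly).
  - move=> [l [Al Bl Cl]]; have [u [v [w [nz lE]]]] := line_equation cM l.
    move: Al Bl Cl; rewrite !lE => Al Bl Cl; apply: nz.
    have u0 : u = 0.
      have : u * (p - 1) = (u * p + v * 0 + w) - (u * 1 + v * 0 + w) by ring.
      by rewrite Al Bl subrr => /eqP; rewrite mulf_eq0 subr_eq0 (negPf neq1) orbF => /eqP.
    rewrite u0; congr (_, _).
    have -> : v = (u * 0 + v * 1 + w) - (u * 1 + v * 0 + w) by rewrite u0; ring.
    by rewrite Cl Bl subrr.
  - by split; rewrite (proj2 aE); ring.
  - by split; rewrite (proj2 bE); ring.
  - by split; rewrite (proj2 lxE); ring.
  - split; first by rewrite (proj2 haE); ring.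
    by apply/relC/(tauP _ _ _ _ _ _ _ nz10 aE haE); ring.
  - split; first by rewrite (proj2 hbE); ring.
    by apply/relC/(tauP _ _ _ _ _ _ _ nzp bE hbE); ring.
  - by split; [rewrite (proj2 lyE); ring|apply/relC].
  have [x [y DH]] := pt_surj cM H; move: Ha Hb Hc.
  rewrite DH (proj2 haE) (proj2 hbE) (proj2 lyE) => Ha Hb Hc.
  have x0 : x = 0 by rewrite -Hc; ring.
  rewrite x0 in Ha Hb.
  have nzy : y != 0.
    apply/eqP => y0; move: Hb; rewrite y0 => /eqP.
    by rewrite !mulr0 !add0r oppr_eq0 oner_eq0.
  apply: (mulIf nzy); apply/subr0_eq.
  have -> : p * tau p * y - tau 1 * y = p * (1 * 0 + tau p * y - 1)
    - (1 * 0 + tau 1 * y - p) by ring.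
  by rewrite Ha Hb mulr0 subrr.
exists (tau 1); split; first exact: tau_neq0.
move=> p l m c a' b' c' nzp lE mE; rewrite (tauP _ _ _ _ _ _ _ nzp lE mE) -(const p nzp).
have -> : a' * (p * tau p) - b' * p = p * (a' * tau p - b') by ring.
split=> [->|/eqP]; first by rewrite mulr0.
by rewrite mulf_eq0 (negPf nzp) => /eqP.
Qed.

(** Lines of slope [p] and [k / p] are orthogonal.  In terms of arbitrary
    coefficients this is a diagonal bilinear form, which also covers the
    directions of the axes. *)
Lemma orthogonal_form : exists k, k != 0 /\
  forall l m a b c a' b' c', eqn l a b c -> eqn m a' b' c' ->
    rel l m <-> b * b' - k * (a * a') = 0.
Proof.
have [k [nzk kP]] := perpendicular_slopes_const; exists k; split=> //.
move=> l m a b c a' b' c' lE mE; have [nzab _] := lE.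
have [a0|nza] := eqVneq a 0.
  have nzb : b != 0 by move/pair_neq0: nzab; rewrite a0 eqxx.
  have yl : rel ly l.
    apply/(perpP (proj1 (relC _ _) rel_xy)); apply/(parallel_equation cM lxE lE).
    by rewrite a0; ring.
  rewrite (perpP (proj1 (relC _ _) yl)) (parallel_equation cM lyE mE) a0.
  have -> : b * b' - k * (0 * a') = b * b' by ring.
  have -> : 1 * b' - 0 * a' = b' by ring.
  split=> [->|/eqP]; first by rewrite mulr0.
  by rewrite mulf_eq0 (negPf nzb) => /eqP.
have [b0|nzb] := eqVneq b 0.
  have xl : rel lx l.
    by apply/(perpP rel_xy); apply/(parallel_equation cM lyE lE); rewrite b0; ring.
  rewrite (perpP (proj1 (relC _ _) xl)) (parallel_equation cM lxE mE) b0.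
  have -> : 0 * b' - k * (a * a') = - (k * a) * a' by ring.
  have -> : 0 * b' - 1 * a' = - a' by ring.
  split=> [/eqP|/eqP]; first by rewrite oppr_eq0 => /eqP->; rewrite mulr0.
  by rewrite mulf_eq0 oppr_eq0 mulf_eq0 (negPf nzk) (negPf nza) => /eqP ->; rewrite oppr0.
have nzba : b / a != 0 by rewrite mulf_neq0 ?invr_neq0.
have lE' : eqn l 1 (b / a) (c / a).
  have := equation_scale (invr_neq0 nza) lE.
  by rewrite mulVf // ![a^-1 * _]mulrC.
rewrite (kP _ _ _ _ _ _ _ nzba lE' mE).
have -> : a' * k - b' * (b / a) = - (b * b' - k * (a * a')) / a by field.
split=> [/eqP|->]; last by rewrite oppr0 mul0r.
by rewrite mulf_eq0 invr_eq0 (negPf nza) orbF oppr_eq0 => /eqP.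
Qed.

Lemma rescaled_equation t l a b c : t != 0 ->
  has_equation (fun x y => pt (t * x) y) l a b c <-> eqn l (a / t) b c.
Proof.
move=> nzt; split=> -[/pair_neq0 nz lE]; split.
- by apply/pair_neq0; rewrite mulf_eq0 invr_eq0 (negPf nzt) orbF.
- by move=> x y; have := lE (x / t) y; rewrite mulrC divfK // mulrAC mulrA.
- by apply/pair_neq0; move: nz; rewrite mulf_eq0 invr_eq0 (negPf nzt) orbF.
- by move=> x y; rewrite lE mulrA divfK.
Qed.

Lemma rescaled_coordinates t : t != 0 -> affine_coordinates (fun x y => pt (t * x) y).
Proof.
move=> nzt; split.
- by move=> x y x' y' /(pt_inj cM)[/(mulfI nzt)].
- move=> P; have [x [y ->]] := pt_surj cM P; exists (x / t), y.
  by rewrite mulrC divfK.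
- move=> l; have [a [b [c lE]]] := line_equation cM l; exists (a * t), b, c.
  by apply/rescaled_equation => //; rewrite mulfK.
- move=> a b c /pair_neq0 nz.
  have nz' : (a / t, b) <> (0, 0).
    by apply/pair_neq0; rewrite mulf_eq0 invr_eq0 (negPf nzt) orbF.
  by have [l lE] := equation_line cM c nz'; exists l; apply/rescaled_equation.
- exact: line_ext cM.
Qed.

(** Stretching the first coordinate by a square root of [- k] turns the form
    into the standard one. *)
Theorem orthogonal_coordinates :
  exists qt : K -> K -> point, affine_coordinates qt /\ rel_equation qt true.
Proof.
have [k [nzk kP]] := orthogonal_form.
have /closed_rootP[t] : size ('X^2 + k%:P) != 1 by rewrite -[k]opprK polyCN size_XnsubC.
rewrite rootE !hornerE addr_eq0 => /eqP Dt.
have nzt : t != 0 by apply/eqP => t0; move: nzk; rewrite -[k]opprK -Dt t0 expr0n oppr0 eqxx.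
exists (fun x y => pt (t * x) y); split; first exact: rescaled_coordinates.
move=> l m a b c a' b' c' /(rescaled_equation _ _ _ _ nzt) lE /(rescaled_equation _ _ _ _ nzt) mE.
rewrite (kP _ _ _ _ _ _ _ _ lE mE) /rel_form.
suff -> : b * b' - k * (a / t * (a' / t)) = a * a' + b * b' by [].
have -> : k = - (t ^+ 2) by rewrite Dt opprK.
by field.
Qed.

End Orthogonality.

(** * The axioms in coordinate planes *)

Section CoordinateTheorems.
Variables (M : plane) (K : fieldType) (pt : K -> K -> pl_point M).
Hypothesis cM : affine_coordinates pt.
Local Notation point := (pl_point M).
Local Notation line := (pl_line M).
Local Notation I := (@pl_inc M).
Local Notation rel := (@pl_rel M).
Local Notation eqn := (has_equation pt).
Implicit Types (l m : line) (a b c x y : K).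

Let incM := coordinates_incidence cM.
Let parM := coordinates_parallels cM.
Let lineM := coordinates_line cM.

Definition cross (u v u' v' : K) := u * v' - v * u'.

Lemma joins_parallel_cross x y x' y' u v u' v' l m :
  pt x y <> pt x' y' -> joins (pt x y) (pt x' y') l ->
  pt u v <> pt u' v' -> joins (pt u v) (pt u' v') m ->
  parallel l m <-> cross (x' - x) (y' - y) (u' - u) (v' - v) = 0.
Proof.
move=> neql Pl neqm Pm.
rewrite (parallel_equation cM (joins_equation cM neql Pl) (joins_equation cM neqm Pm)).
by rewrite (_ : (y - y') * (u' - u) - _ = cross (x' - x) (y' - y) (u' - u) (v' - v)) // /cross; ring.
Qed.

Lemma line_parameter l a b c x y x' y' : eqn l a b c ->
  I (pt x y) l -> I (pt x' y') l -> exists t, x' = x + t * b /\ y' = y - t * a.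
Proof.
move=> [nz lE]; rewrite !lE => Pl Ql.
have [||t [Dx Dy]] := @proportional K (x' - x) (y' - y) b (- a).
- by move=> [b0 /eqP]; rewrite oppr_eq0 => /eqP a0; apply: nz; rewrite a0 b0.
- have -> : (x' - x) * - a - (y' - y) * b = (a * x + b * y + c) - (a * x' + b * y' + c) by ring.
  by rewrite Pl Ql subrr.
by exists t; rewrite -Dx -mulrN -Dy; split; ring.
Qed.

Lemma parallel_same_coefficients l m a b c : eqn l a b c -> parallel m l ->
  exists c', eqn m a b c'.
Proof.
move=> lE ml; have [a' [b' [c' mE]]] := line_equation cM m.
have /(parallel_equation cM lE mE) D := parallel_sym ml.
have [t [nzt -> ->]] := proportional_neq0 (proj1 lE) (proj1 mE) D.
by exists (t * c'); exact: equation_scale.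
Qed.

(** Parametrize both lines, from their common point if there is one.  Up to a
    nonzero factor, the determinant of the directions of [A_i B_j] and [A_j B_i]
    is [h_i - h_j], where [h_i] is the product of the parameters of [A_i] and
    [B_i] (with a sign) for intersecting lines and their sum for parallel ones.
    So the parallelism in question is equality of [h_i] and [h_j], which is
    transitive. *)
Lemma coordinates_pappian : (forall l m, rel l m <-> parallel l m) -> pappian M.
Proof.
move=> relP l1 l2 A1 A2 A3 B1 B2 B3 neq12 nodup [A1l A2l A3l] [B1l B2l B3l].
move=> m12 m21 m23 m32 m13 m31 J12 J21 J23 J32 J13 J31; rewrite !relP.
move: nodup => /List.NoDup_cons_iff[nA1 /List.NoDup_cons_iff[nA2 /List.NoDup_cons_iff[nA3 _]]].
have n12 : A1 <> B2 by move=> eqAB; apply: nA1; rewrite eqAB; do 3 right; left.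
have n13 : A1 <> B3 by move=> eqAB; apply: nA1; rewrite eqAB; do 4 right; left.
have n21 : A2 <> B1 by move=> eqAB; apply: nA2; rewrite eqAB; right; left.
have n23 : A2 <> B3 by move=> eqAB; apply: nA2; rewrite eqAB; do 3 right; left.
have n31 : A3 <> B1 by move=> eqAB; apply: nA3; rewrite eqAB; left.
have n32 : A3 <> B2 by move=> eqAB; apply: nA3; rewrite eqAB; right; left.
move: {nA1 nA2 nA3} A1l A2l A3l B1l B2l B3l n12 n13 n21 n23 n31 n32 J12 J21 J23 J32 J13 J31.
have [x1 [y1 ->]] := pt_surj cM A1; have [x2 [y2 ->]] := pt_surj cM A2.
have [x3 [y3 ->]] := pt_surj cM A3; have [u1 [v1 ->]] := pt_surj cM B1.
have [u2 [v2 ->]] := pt_surj cM B2; have [u3 [v3 ->]] := pt_surj cM B3.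
move=> A1l A2l A3l B1l B2l B3l n12 n13 n21 n23 n31 n32 J12 J21 J23 J32 J13 J31.
rewrite (joins_parallel_cross n12 J12 n21 J21) (joins_parallel_cross n23 J23 n32 J32).
rewrite (joins_parallel_cross n13 J13 n31 J31).
suff [h1 [h2 [h3 [D [nzD -> -> ->]]]]] : exists h1 h2 h3 D, [/\ D != 0,
    cross (u2 - x1) (v2 - y1) (u1 - x2) (v1 - y2) = (h1 - h2) * D,
    cross (u3 - x2) (v3 - y2) (u2 - x3) (v2 - y3) = (h2 - h3) * D &
    cross (u3 - x1) (v3 - y1) (u1 - x3) (v1 - y3) = (h1 - h3) * D].
  have cancel h h' : (h - h') * D = 0 -> h = h'.
    by move/eqP; rewrite mulf_eq0 (negPf nzD) orbF subr_eq0 => /eqP.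
  by move=> [/cancel -> /cancel ->]; rewrite subrr mul0r.
have [a [b [c l1E]]] := line_equation cM l1.
have [/parallel_sym par12|npar] := pselect (parallel l1 l2).
  have [d l2E] := parallel_same_coefficients l1E par12.
  have [s2 [-> ->]] := line_parameter l1E A1l A2l.
  have [s3 [-> ->]] := line_parameter l1E A1l A3l.
  have [t2 [-> ->]] := line_parameter l2E B1l B2l.
  have [t3 [-> ->]] := line_parameter l2E B1l B3l.
  exists 0, (s2 + t2), (s3 + t3), (cross (u1 - x1) (v1 - y1) b (- a)).
  split; try by rewrite /cross; ring.
  apply/eqP => D0; apply: neq12; apply/esym/(parallel_meet par12 B1l).
  move: A1l; rewrite !(proj2 l1E) => E1.
  have -> : a * u1 + b * v1 + c = a * x1 + b * y1 + c - cross (u1 - x1) (v1 - y1) b (- a).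
    by rewrite /cross; ring.
  by rewrite E1 D0 subrr.
have [a' [b' [c' l2E]]] := line_equation cM l2.
have nzD : a * b' - b * a' != 0 by apply/eqP => /(parallel_equation cM l1E l2E).
have [x0 [y0 [/(proj2 l1E) P1 /(proj2 l2E) P2]]] := cramer c c' nzD.
have [s1 [-> ->]] := line_parameter l1E P1 A1l.
have [s2 [-> ->]] := line_parameter l1E P1 A2l.
have [s3 [-> ->]] := line_parameter l1E P1 A3l.
have [t1 [-> ->]] := line_parameter l2E P2 B1l.
have [t2 [-> ->]] := line_parameter l2E P2 B2l.
have [t3 [-> ->]] := line_parameter l2E P2 B3l.
exists (- (s1 * t1)), (- (s2 * t2)), (- (s3 * t3)), (a * b' - b * a').
by split=> //; rewrite /cross; ring.
Qed.

(** Otherwise [AB] is the line [b], so its parallel through [B'] is [b] as well;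
    it contains [A'], whence [a] and [b] share two points. *)
Lemma no_vertex_center (A B A' B' O : point) (a b ab ab' : line) :
  A <> B -> A' <> B' -> A <> A' -> joins A A' a -> joins B B' b -> a <> b ->
  I O a -> I O b -> joins A B ab -> joins A' B' ab' -> parallel ab ab' -> A <> O.
Proof.
move=> nAB nA'B' nAA' [Aa A'a] [Bb B'b] nab Oa Ob [Aab Bab] [A'ab' B'ab'] par AO.
have Ab : I A b by rewrite AO.
have eqb : ab = b by apply: (join_unique incM nAB).
have eqb' : ab' = b.
  by rewrite -eqb; apply: (parallel_meet (parallel_sym par) B'ab'); rewrite eqb.
rewrite eqb' in A'ab'; apply: nab.
exact (join_unique incM nAA' (conj Aa A'a) (conj Ab A'ab')).
Qed.

(** In the parallel form, the second triangle is a translate of the first, in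
    the central form a dilate: the parallel sides force the translation vectors,
    or the dilation factors, of the three vertices to agree. *)
Lemma coordinates_desargues : desargues M.
Proof.
move=> A B C A' B' C' a b c ncol ncol' [nAA' nBB' nCC'] [Ja Jb Jc] [nab nac nbc].
have [nAB nAC nBC] := frame_neq incM parM lineM ncol.
have [nAB' nAC' nBC'] := frame_neq incM parM lineM ncol'.
move=> persp ab ab' ac ac' bc bc' Jab Jab' Jac Jac' Jbc Jbc' par_ab par_ac.
have off m P : parallel a m -> a <> m -> I P m -> ~ I P a.
  by move=> par neq Pm Pa; apply: neq; exact: parallel_meet par Pa Pm.
have center : forall O, I O a -> I O b -> I O c -> [/\ A <> O, B <> O & C <> O].
  move=> O Oa Ob Oc; split.
  - exact: no_vertex_center nAB nAB' nAA' Ja Jb nab Oa Ob Jab Jab' par_ab.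
  - have nba : b <> a by move=> eqab; apply: nab.
    have Jba : joins B A ab by case: Jab.
    have Jba' : joins B' A' ab' by case: Jab'.
    exact: no_vertex_center (not_eq_sym nAB) (not_eq_sym nAB') nBB' Jb Ja nba Ob Oa
      Jba Jba' par_ab.
  - have nca : c <> a by move=> eqac; apply: nac.
    have Jca : joins C A ac by case: Jac.
    have Jca' : joins C' A' ac' by case: Jac'.
    exact: no_vertex_center (not_eq_sym nAC) (not_eq_sym nAC') nCC' Jc Ja nca Oc Oa
      Jca Jca' par_ac.
have offO O m P : I O a -> I O m -> a <> m -> I P m -> P <> O -> ~ I P a.
  move=> Oa Om neq Pm PO Pa; apply: neq.
  exact (join_unique incM PO (conj Pa Oa) (conj Pm Om)).
move: nAA' nBB' nCC' nAB nAC nBC nAB' nAC' nBC' Ja Jb Jc Jab Jab' Jac Jac' Jbc Jbc' center.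
have [xA [yA ->]] := pt_surj cM A; have [xA' [yA' ->]] := pt_surj cM A'.
have [xB [yB ->]] := pt_surj cM B; have [xB' [yB' ->]] := pt_surj cM B'.
have [xC [yC ->]] := pt_surj cM C; have [xC' [yC' ->]] := pt_surj cM C'.
move=> nAA' nBB' nCC' nAB nAC nBC nAB' nAC' nBC' Ja Jb Jc Jab Jab' Jac Jac' Jbc Jbc' center.
apply/(joins_parallel_cross nBC Jbc nBC' Jbc').
move/(joins_parallel_cross nAB Jab nAB' Jab'): par_ab => par_ab.
move/(joins_parallel_cross nAC Jac nAC' Jac'): par_ac => par_ac.
case: persp => [[pab pac _]|[O [Oa Ob Oc]]].
  have nzu := (neq_points cM _ _ _ _).1 nAA'.
  have translate x x' y y' m : pt x y <> pt x' y' -> joins (pt x y) (pt x' y') m ->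
      parallel a m -> exists t, x' = x + t * (xA' - xA) /\ y' = y + t * (yA' - yA).
    move=> neq J /parallel_sym/(joins_parallel_cross neq J nAA' Ja)/(proportional nzu)[t [Dx Dy]].
    by exists t; rewrite -Dx -Dy; split; ring.
  have [t [Dx Dy]] := translate _ _ _ _ _ nBB' Jb pab.
  have [r [Dx' Dy']] := translate _ _ _ _ _ nCC' Jc pac.
  have offB := off _ _ pab nab (proj1 Jb); have offC := off _ _ pac nac (proj1 Jc).
  rewrite (joins_inc cM _ _ nAA' Ja) in offB; rewrite (joins_inc cM _ _ nAA' Ja) in offC.
  have t1 : t - 1 = 0.
    apply: (mulIf (introN eqP offB)); rewrite mul0r -[RHS]par_ab Dx Dy /cross; ring.
  have r1 : r - 1 = 0.
    apply: (mulIf (introN eqP offC)); rewrite mul0r -[RHS]par_ac Dx' Dy' /cross; ring.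
  by rewrite Dx Dy Dx' Dy' (subr0_eq t1) (subr0_eq r1) /cross; ring.
have [nAO nBO nCO] := center O Oa Ob Oc; move: Oa Ob Oc nAO nBO nCO.
have [xO [yO ->]] := pt_surj cM O => Oa Ob Oc nAO nBO nCO.
have dilate x x' y y' m : pt x y <> pt xO yO -> joins (pt x y) (pt x' y') m ->
    I (pt xO yO) m -> exists t, x' = xO + t * (x - xO) /\ y' = yO + t * (y - yO).
  move=> neq [Pm Qm] Om.
  have nz : (x - xO, y - yO) <> (0, 0) by exact: (neq_points cM xO yO x y).1 (not_eq_sym neq).
  have /(joins_inc cM _ _ (not_eq_sym neq)) := conj Om Pm.
  move=> /(_ x' y')[/(_ Qm) /(proportional nz)[t [Dx Dy]] _].
  by exists t; rewrite -Dx -Dy; split; ring.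
have [s [Ax Ay]] := dilate _ _ _ _ _ nAO Ja Oa.
have [t [Bx By]] := dilate _ _ _ _ _ nBO Jb Ob.
have [r [Cx Cy]] := dilate _ _ _ _ _ nCO Jc Oc.
have JOA : joins (pt xO yO) (pt xA yA) a by split=> //; case: Ja.
have offB := offO _ _ _ Oa Ob nab (proj1 Jb) nBO.
have offC := offO _ _ _ Oa Oc nac (proj1 Jc) nCO.
rewrite (joins_inc cM _ _ (not_eq_sym nAO) JOA) in offB.
rewrite (joins_inc cM _ _ (not_eq_sym nAO) JOA) in offC.
have st : s - t = 0.
  apply: (mulIf (introN eqP offB)); rewrite mul0r -[RHS]oppr0 -[in RHS]par_ab Ax Ay Bx By /cross.
  ring.
have sr : s - r = 0.
  apply: (mulIf (introN eqP offC)); rewrite mul0r -[RHS]oppr0 -[in RHS]par_ac Ax Ay Cx Cy /cross.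
  ring.
by rewrite Bx By Cx Cy -(subr0_eq st) -(subr0_eq sr) /cross; ring.
Qed.

End CoordinateTheorems.

Section OrthogonalPlane.
Variables (M : plane) (K : fieldType) (pt : K -> K -> pl_point M).
Hypotheses (cM : affine_coordinates pt) (relM : rel_equation pt true).
Local Notation point := (pl_point M).
Local Notation line := (pl_line M).
Local Notation I := (@pl_inc M).
Local Notation rel := (@pl_rel M).
Local Notation eqn := (has_equation pt).

Lemma orthogonal_coefficients (a b a' b' : K) : (a, b) <> (0, 0) ->
  a * a' + b * b' = 0 -> exists t, a' = t * - b /\ b' = t * a.
Proof.
move=> nz D; apply: proportional.
  by move=> [/eqP]; rewrite oppr_eq0 => /eqP b0 a0; apply: nz; rewrite a0 b0.
by rewrite -[RHS]D; ring.
Qed.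

(** Lines are infinite because the field has characteristic 0.  As for the
    heights, one of their equations is the difference of the two others, and
    these have a unique common solution. *)
Lemma coordinates_wu : [pchar K] =i pred0 -> desargues M -> wu_orthogonal_plane M.
Proof.
move=> charK desM; have incM := coordinates_incidence cM.
have parM := coordinates_parallels cM; split=> //.
- move=> l fin; have [a [b [c lE]]] := line_equation cM l.
  have [x [y [Pl _]]] := equation_points lE; have [nz _] := lE.
  pose f (n : nat) := pt (x + n%:R * b) (y - n%:R * a).
  suff inj_f : injective f.
    apply: infinite_nat; apply: sub_finite_set (finite_preimage (f := f) _ fin).
      move=> n _ /=; rewrite (proj2 lE); move: Pl; rewrite (proj2 lE) => Pl.
      by rewrite -[RHS]Pl; ring.
    by move=> n m _ _; exact: inj_f.
  move=> n m /(pt_inj cM)[/addrI eb /addrI/oppr_inj ea].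
  have /eqP : (n%:R : K) = m%:R.
    by move/pair_neq0: nz => /orP[/mulIf|/mulIf]; apply.
  wlog le_nm : n m {ea eb} / (n <= m)%N.
    by move=> W; have [/W//|/ltnW/W W'] := leqP n m; rewrite eq_sym => /W'.
  rewrite eq_sym -subr_eq0 -natrB //; move/pcharf0P: charK => ->.
  by rewrite subn_eq0 => le_mn; apply/eqP; rewrite eqn_leq le_nm.
- move=> l m; have [a [b [c lE]]] := line_equation cM l.
  have [a' [b' [c' mE]]] := line_equation cM m.
  rewrite (relM lE mE) (relM mE lE) /rel_form.
  by rewrite [a' * a]mulrC [b' * b]mulrC.
- move=> P l; have [x [y ->]] := pt_surj cM P.
  have [a [b [c lE]]] := line_equation cM l; have [nz _] := lE.
  have nz' : (- b, a) <> (0, 0).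
    by move=> [/eqP]; rewrite oppr_eq0 => /eqP b0 a0; apply: nz; rewrite a0 b0.
  have [m [mE Pm mU]] := line_at cM x y nz'; exists m; split.
    by split=> //; apply/(relM lE mE); rewrite /rel_form; ring.
  move=> n [ln Pn]; have [a' [b' [c' nE]]] := line_equation cM n.
  have [t [Da Db]] := orthogonal_coefficients nz ((relM lE nE).1 ln).
  by apply/esym/(mU n _ _ _ nE) => //; rewrite Da Db; ring.
- move=> l m n [lm ln]; have [a [b [c lE]]] := line_equation cM l; have [nz _] := lE.
  have [a1 [b1 [c1 mE]]] := line_equation cM m.
  have [a2 [b2 [c2 nE]]] := line_equation cM n.
  have [t [Da Db]] := orthogonal_coefficients nz ((relM lE mE).1 lm).
  have [t' [Da' Db']] := orthogonal_coefficients nz ((relM lE nE).1 ln).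
  by apply/(parallel_equation cM mE nE); rewrite Da Db Da' Db'; ring.
- move=> P; have [x [y ->]] := pt_surj cM P.
  have nz : (1 : K, 0 : K) <> (0, 0) by apply/pair_neq0; rewrite oner_eq0.
  have [l [lE Pl _]] := line_at cM x y nz; exists l; split=> //.
  by move/(relM lE lE); rewrite /rel_form mulr1 mulr0 addr0 => /eqP; rewrite oner_eq0.
move=> A B C a b c ha hb hc ncol Ja Jb Jc.
have [nAB nAC nBC] := frame_neq incM parM (coordinates_line cM) ncol.
have offA : ~ I A a.
  by move=> Aa; apply: ncol; exists a; case: Ja.
move: nAB nAC nBC Ja Jb Jc offA {ncol}.
have [xA [yA ->]] := pt_surj cM A; have [xB [yB ->]] := pt_surj cM B.
have [xC [yC ->]] := pt_surj cM C.
move=> nAB nAC nBC Ja Jb Jc offA.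
have height x y x' y' x'' y'' l h : pt x y <> pt x' y' ->
    joins (pt x y) (pt x' y') l -> I (pt x'' y'') h /\ rel h l ->
    forall u v, I (pt u v) h <-> (x' - x) * (u - x'') + (y' - y) * (v - y'') = 0.
  move=> neq J [Ph hl] u v; have [a1 [b1 [c1 hE]]] := line_equation cM h.
  have lE := joins_equation cM neq J; have [nz _] := lE.
  have [nzh _] := hE; have := (relM hE lE).1 hl; rewrite /rel_form => D.
  have [||t [nzt Da Db]] := @proportional_neq0 K a1 b1 (x' - x) (y' - y) nzh.
  - by move=> [ex ey]; apply: nz; rewrite ex -opprB ey oppr0.
  - have -> : a1 * (y' - y) - b1 * (x' - x) = - (a1 * (y - y') + b1 * (x' - x)) by ring.
    by rewrite D oppr0.
  move: Ph; rewrite !(proj2 hE) => Ph.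
  have -> : a1 * u + b1 * v + c1 = t * ((x' - x) * (u - x'') + (y' - y) * (v - y''))
      + (a1 * x'' + b1 * y'' + c1) by rewrite Da Db; ring.
  rewrite Ph addr0; split=> [/eqP|->]; last by rewrite mulr0.
  by rewrite mulf_eq0 (negPf nzt) => /eqP.
move=> /(height _ _ _ _ _ _ _ _ nBC Ja) haE /(height _ _ _ _ _ _ _ _ nAC Jb) hbE.
move=> /(height _ _ _ _ _ _ _ _ nAB Jc) hcE.
have nzD : (xC - xB) * (yC - yA) - (yC - yB) * (xC - xA) != 0.
  apply/eqP => D0; apply: offA; apply/(joins_inc cM _ _ nBC Ja).
  by rewrite -[RHS]D0; ring.
have [u [v [E1 E2]]] := cramer (- ((xC - xB) * xA + (yC - yB) * yA))
  (- ((xC - xA) * xB + (yC - yA) * yB)) nzD.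
have F1 : (xC - xB) * (u - xA) + (yC - yB) * (v - yA) = 0 by rewrite -[RHS]E1; ring.
have F2 : (xC - xA) * (u - xB) + (yC - yA) * (v - yB) = 0 by rewrite -[RHS]E2; ring.
exists (pt u v); split.
  split; [exact/haE|exact/hbE|apply/hcE].
  have -> : (xB - xA) * (u - xC) + (yB - yA) * (v - yC) =
    ((xC - xA) * (u - xB) + (yC - yA) * (v - yB))
    - ((xC - xB) * (u - xA) + (yC - yB) * (v - yA)) by ring.
  by rewrite F1 F2 subrr.
move=> H; have [u' [v' ->]] := pt_surj cM H => -[/haE G1 /hbE G2 _].
have [Eu Ev] : (u - u') * ((xC - xB) * (yC - yA) - (yC - yB) * (xC - xA)) = 0 /\
    (v - v') * ((xC - xB) * (yC - yA) - (yC - yB) * (xC - xA)) = 0.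
  split.
    have -> : (u - u') * ((xC - xB) * (yC - yA) - (yC - yB) * (xC - xA)) =
      (yC - yA) * (((xC - xB) * (u - xA) + (yC - yB) * (v - yA))
                   - ((xC - xB) * (u' - xA) + (yC - yB) * (v' - yA)))
      - (yC - yB) * (((xC - xA) * (u - xB) + (yC - yA) * (v - yB))
                   - ((xC - xA) * (u' - xB) + (yC - yA) * (v' - yB))) by ring.
    by rewrite F1 F2 G1 G2 !subrr !mulr0 subrr.
  have -> : (v - v') * ((xC - xB) * (yC - yA) - (yC - yB) * (xC - xA)) =
    (xC - xB) * (((xC - xA) * (u - xB) + (yC - yA) * (v - yB))
                 - ((xC - xA) * (u' - xB) + (yC - yA) * (v' - yB)))
    - (xC - xA) * (((xC - xB) * (u - xA) + (yC - yB) * (v - yA))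
                 - ((xC - xB) * (u' - xA) + (yC - yB) * (v' - yA))) by ring.
  by rewrite F1 F2 G1 G2 !subrr !mulr0 subrr.
have cancel w w' : (w - w') * ((xC - xB) * (yC - yA) - (yC - yB) * (xC - xA)) = 0 -> w = w'.
  by move/eqP; rewrite mulf_eq0 (negPf nzD) orbF subr_eq0 => /eqP.
by rewrite (cancel _ _ Eu) (cancel _ _ Ev).
Qed.

End OrthogonalPlane.

Section FramesInCoordinates.
Variables (M : plane) (K : fieldType).
Local Notation point := (pl_point M).
Local Notation line := (pl_line M).
Local Notation I := (@pl_inc M).

(** Cramer's rule inverts the affine change of coordinates; its determinant is
    nonzero because the frame is not collinear. *)
Lemma frame_coordinates (pt : K -> K -> point) (O E E' : point) :
  affine_coordinates pt -> ~ collinear O E E' ->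
  exists qt : K -> K -> point,
    [/\ affine_coordinates qt, qt 0 0 = O, qt 1 0 = E & qt 0 1 = E'].
Proof.
move=> cM ncol; have incM := coordinates_incidence cM.
have [nOE _ _] := frame_neq incM (coordinates_parallels cM) (coordinates_line cM) ncol.
have [l OEl] := line_through incM nOE.
have offE' : ~ I E' l by move=> E'l; apply: ncol; exists l; case: OEl.
move: nOE OEl offE' {ncol}.
have [x0 [y0 ->]] := pt_surj cM O; have [x1 [y1 ->]] := pt_surj cM E.
have [x2 [y2 ->]] := pt_surj cM E' => nOE OEl; rewrite (joins_inc cM _ _ nOE OEl).
set D := (_ - _); move/eqP => nzD.
pose qt x y := pt (x0 + x * (x1 - x0) + y * (x2 - x0)) (y0 + x * (y1 - y0) + y * (y2 - y0)).
exists qt; split; try by rewrite /qt; congr pt; ring.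
have eqnP l' a b c a' b' c' : a' = a * (x1 - x0) + b * (y1 - y0) ->
    b' = a * (x2 - x0) + b * (y2 - y0) -> c' = a * x0 + b * y0 + c ->
    (a, b) <> (0, 0) -> (a', b') <> (0, 0) ->
    has_equation pt l' a b c -> has_equation qt l' a' b' c'.
  move=> Da Db Dc nz nz' [_ lE]; split=> // x y; rewrite /qt lE.
  suff -> : a' * x + b' * y + c' =
    a * (x0 + x * (x1 - x0) + y * (x2 - x0)) + b * (y0 + x * (y1 - y0) + y * (y2 - y0)) + c.
    by [].
  by rewrite Da Db Dc; ring.
have solve u v : exists x y, u = x0 + x * (x1 - x0) + y * (x2 - x0) /\
    v = y0 + x * (y1 - y0) + y * (y2 - y0).
  exists (((v - y0) * (x2 - x0) - (u - x0) * (y2 - y0)) / D),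
    (((u - x0) * (y1 - y0) - (v - y0) * (x1 - x0)) / D).
  by split; rewrite /D; field; exact: nzD.
have nz_image a b : (a, b) <> (0, 0) ->
    (a * (x1 - x0) + b * (y1 - y0), a * (x2 - x0) + b * (y2 - y0)) <> (0, 0).
  move=> nz [E1 E2]; apply: nz; congr (_, _); apply: (mulIf nzD); rewrite mul0r.
    have -> : a * D = (a * (x2 - x0) + b * (y2 - y0)) * (y1 - y0)
      - (a * (x1 - x0) + b * (y1 - y0)) * (y2 - y0) by rewrite /D; ring.
    by rewrite E1 E2 !mul0r subrr.
  have -> : b * D = (a * (x1 - x0) + b * (y1 - y0)) * (x2 - x0)
      - (a * (x2 - x0) + b * (y2 - y0)) * (x1 - x0) by rewrite /D; ring.
  by rewrite E1 E2 !mul0r subrr.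
split.
- move=> x y x' y' /(pt_inj cM)[Ex Ey].
  have cancel w w' : (w - w') * D = 0 -> w = w'.
    by move/eqP; rewrite mulf_eq0 (negPf nzD) orbF subr_eq0 => /eqP.
  split; apply: cancel.
    have -> : (x - x') * D =
      (x2 - x0) * ((y0 + x * (y1 - y0) + y * (y2 - y0))
                   - (y0 + x' * (y1 - y0) + y' * (y2 - y0)))
      - (y2 - y0) * ((x0 + x * (x1 - x0) + y * (x2 - x0))
                   - (x0 + x' * (x1 - x0) + y' * (x2 - x0))) by rewrite /D; ring.
    by rewrite Ex Ey !subrr !mulr0 subrr.
  have -> : (y - y') * D =
      (y1 - y0) * ((x0 + x * (x1 - x0) + y * (x2 - x0))
                   - (x0 + x' * (x1 - x0) + y' * (x2 - x0)))
      - (x1 - x0) * ((y0 + x * (y1 - y0) + y * (y2 - y0))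
                   - (y0 + x' * (y1 - y0) + y' * (y2 - y0))) by rewrite /D; ring.
  by rewrite Ex Ey !subrr !mulr0 subrr.
- move=> P; have [u [v ->]] := pt_surj cM P; have [x [y [-> ->]]] := solve u v.
  by exists x, y.
- move=> l'; have [a [b [c lE]]] := line_equation cM l'; have [nz _] := lE.
  do 3 eexists; apply: (eqnP _ a b c _ _ _ erefl erefl erefl) => //.
  exact: nz_image.
- move=> a' b' c' nz'.
  pose a := (b' * (y1 - y0) - a' * (y2 - y0)) / D.
  pose b := (a' * (x2 - x0) - b' * (x1 - x0)) / D.
  have Da : a' = a * (x1 - x0) + b * (y1 - y0) by rewrite /a /b /D; field; exact: nzD.
  have Db : b' = a * (x2 - x0) + b * (y2 - y0) by rewrite /a /b /D; field; exact: nzD.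
  have nz : (a, b) <> (0, 0).
    by move=> [a0 b0]; apply: nz'; rewrite Da Db a0 b0 !mul0r addr0.
  have [l' lE] := equation_line cM (c' - a * x0 - b * y0) nz; exists l'.
  by apply: (eqnP _ _ _ _ _ _ _ Da Db _ nz nz' lE); ring.
- exact: line_ext cM.
Qed.

Variable pt : K -> K -> point.
Hypothesis cM : affine_coordinates pt.
Let incM := coordinates_incidence cM.
Let parM := coordinates_parallels cM.

Lemma on_parallel_cross x y x' y' a b a' b' : pt a b <> pt a' b' ->
  on_parallel (pt x y) (pt x' y') (pt a b) (pt a' b') <->
  cross (x - x') (y - y') (a' - a) (b' - b) = 0.
Proof.
move=> neq; have [n Jn] := line_through incM neq.
have nE := joins_equation cM neq Jn; have [nz _] := nE.
have [m [mE Pm _]] := line_at cM x' y' nz.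
have mn : parallel m n by apply/(parallel_equation cM mE nE); ring.
rewrite (on_parallelP incM parM _ neq Jn Pm mn) (proj2 mE) /cross.
have -> : (b - b') * x + (a' - a) * y - ((b - b') * x' + (a' - a) * y') =
  - ((x - x') * (b' - b) - (y - y') * (a' - a)) by ring.
by split=> [/eqP|->]; rewrite ?oppr0 // oppr_eq0 => /eqP.
Qed.

Lemma collinear_cross x y a b a' b' : pt a b <> pt a' b' ->
  collinear (pt x y) (pt a b) (pt a' b') <-> cross (x - a) (y - b) (a' - a) (b' - b) = 0.
Proof.
move=> neq; have [n Jn] := line_through incM neq.
by rewrite (collinear_on incM _ neq Jn) (joins_inc cM _ _ neq Jn).
Qed.

Lemma standard_frame :
  frame_arith (pt 0 0) (pt 1 0) (pt 0 1) (ring_arith K) (fun a => pt a 0).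
Proof.
have neq x y x' y' : (x' - x != 0) || (y' - y != 0) -> pt x y <> pt x' y'.
  by move=> /pair_neq0 nz; apply/neq_points.
have nOE : pt 0 0 <> pt 1 0 by apply: neq; rewrite subr0 oner_eq0.
have nOE' : pt 0 0 <> pt 0 1 by apply: neq; rewrite !subr0 oner_eq0 orbT.
have nEE' : pt 1 0 <> pt 0 1 by apply: neq; rewrite !subr0 oner_eq0 orbT.
have nE' b : pt 0 1 <> pt b 0 by apply: neq; rewrite sub0r oppr_eq0 oner_eq0 orbT.
have onx x y : collinear (pt x y) (pt 0 0) (pt 1 0) <-> y = 0.
  rewrite (collinear_cross _ _ nOE) /cross !subr0 mulr0 mulr1 sub0r.
  by split=> [/eqP|->]; rewrite ?oppr0 // oppr_eq0 => /eqP.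
have ony x y : collinear (pt x y) (pt 0 0) (pt 0 1) <-> x = 0.
  by rewrite (collinear_cross _ _ nOE') /cross !subr0 mulr0 mulr1 subr0.
split=> //=.
- by move=> a b /(pt_inj cM)[].
- move=> P; have [x [y ->]] := pt_surj cM P; rewrite onx.
  by split=> [->|[a /(pt_inj cM)[]]] //; exists x.
- move=> a b P; have [x [y ->]] := pt_surj cM P; split=> [[Q []]|/(pt_inj cM)[-> ->]].
    have [p [q ->]] := pt_surj cM Q.
    move=> /(on_parallel_cross _ _ _ _ nOE') + /(on_parallel_cross _ _ _ _ nOE).
    rewrite /cross !subr0 !(mulr0, mulr1, subr0, sub0r) => /subr0_eq ->.
    move=> /eqP; rewrite oppr_eq0 => /eqP/subr0_eq ->.
    move=> /(on_parallel_cross _ _ _ _ (nE' b)); rewrite /cross => + /onx y0.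
    rewrite y0 => E0; congr pt; apply/eqP; rewrite -subr_eq0 -oppr_eq0; apply/eqP.
    by rewrite -[RHS]E0; ring.
  exists (pt a 1); split.
  - by apply/(on_parallel_cross _ _ _ _ nOE'); rewrite /cross; ring.
  - by apply/(on_parallel_cross _ _ _ _ nOE); rewrite /cross; ring.
  - by apply/(on_parallel_cross _ _ _ _ (nE' b)); rewrite /cross; ring.
  - exact/onx.
- move=> a b P; have [x [y ->]] := pt_surj cM P; split=> [[Q []]|/(pt_inj cM)[-> ->]].
    have [p [q ->]] := pt_surj cM Q.
    move=> /ony -> /(on_parallel_cross _ _ _ _ nEE') E1.
    move=> /(on_parallel_cross _ _ _ _ (nE' a)) E2 /onx y0.
    have Dq : q = b.
      by apply/eqP; rewrite -subr_eq0; apply/eqP; rewrite -[RHS]E1 /cross; ring.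
    rewrite y0; congr pt; apply/eqP; rewrite -subr_eq0 -oppr_eq0; apply/eqP.
    by rewrite -[RHS]E2 /cross y0 Dq; ring.
  exists (pt 0 b); split.
  - exact/ony.
  - by apply/(on_parallel_cross _ _ _ _ nEE'); rewrite /cross; ring.
  - by apply/(on_parallel_cross _ _ _ _ (nE' a)); rewrite /cross; ring.
  - exact/onx.
Qed.

End FramesInCoordinates.

Lemma coordinates_star (M : plane) (K : closedFieldType) (pt : K -> K -> pl_point M) p :
  affine_coordinates pt -> [pchar K] =i pred0 -> ACF0 p -> models M (star p).
Proof.
move=> cM charK acf_p; apply: frames_model_star => O E E' ncol.
have [qt [cqt <- <- <-]] := frame_coordinates cM ncol.
exists K, (ring_arith K), (fun a => qt a 0); split; first exact: standard_frame.
exact: ACF0_closed_field.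
Qed.

(** * Axioms as first-order sentences *)

Section Expressible.

(** The de Bruijn indices used below, with the number of variables inferred. *)
Definition idx0 {n} : var n.+1 := None.
Definition idx1 {n} : var n.+2 := Some None.
Definition idx2 {n} : var n.+3 := Some (Some None).

(** A property that is expressed by a sentence and holds throughout a class
    passes to every model of the theory of the class. *)
Definition expressible (P : plane -> Prop) : Prop :=
  exists s : psentence, forall M, models M s <-> P M.

Lemma theory_inherit (C P : plane -> Prop) (N : plane) : expressible P ->
  (forall M, C M -> P M) -> (forall s, theory_of C s -> models N s) -> P N.
Proof. by move=> [s sP] CP NC; apply/sP/NC => M /CP /sP. Qed.

Lemma expressible_iff (P Q : plane -> Prop) : (forall M, P M <-> Q M) ->
  expressible P -> expressible Q.
Proof. by move=> PQ [s sP]; exists s => M; rewrite sP PQ. Qed.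

Lemma expressible_and (P Q : plane -> Prop) :
  expressible P -> expressible Q -> expressible (fun M => P M /\ Q M).
Proof. by move=> [s sP] [t tQ]; exists (PAnd s t) => M; rewrite -sP -tQ. Qed.

Lemma expressible_incidence : expressible incidence_plane.
Proof.
pose join (M : plane) := forall A B : pl_point M, A <> B -> exists! l, joins A B l.
pose two (M : plane) := forall l : pl_line M,
  exists A B, A <> B /\ pl_inc A l /\ pl_inc B l.
pose three (M : plane) := exists A B C : pl_point M,
  ~ exists l, pl_inc A l /\ pl_inc B l /\ pl_inc C l.
apply: (@expressible_iff (fun M => (join M /\ two M) /\ three M)).
  move=> M; split=> [[[joinM twoM] [A [B [C nABC]]]]|[joinM twoM [A [B [C nABC]]]]].
    split=> //; first by move=> l; have [X [Y [? [? ?]]]] := twoM l; exists X, Y.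
    by exists A, B, C => -[l [? ? ?]]; apply: nABC; exists l.
  split; last by exists A, B, C => -[l [? [? ?]]]; apply: nABC; exists l.
  by split=> // l; have [X [Y [? ? ?]]] := twoM l; exists X, Y.
apply: expressible_and; first apply: expressible_and.
- by exists (PAllPoint (PAllPoint (PImp (PNot (PEqPoint idx1 idx0))
    (PExLine (PAnd (PAnd (PInc idx1 idx0) (PInc idx0 idx0))
      (PAllLine (PImp
        (PAnd (PInc idx1 idx0) (PInc idx0 idx0))
        (PEqLine idx1 idx0)))))))).
- by exists (PAllLine (PExPoint (PExPoint (PAnd (PNot (PEqPoint idx1 idx0))
    (PAnd (PInc idx1 idx0) (PInc idx0 idx0)))))).
- by exists (PExPoint (PExPoint (PExPoint (PNot (PExLine
    (PAnd (PInc idx2 idx0)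
    (PAnd (PInc idx1 idx0) (PInc idx0 idx0)))))))).
Qed.

Lemma expressible_parallels : expressible euclidean_parallels.
Proof.
by exists (PAllLine (PAllPoint (PExLine (PAnd
  (PAnd (PInc idx0 idx0) (Pparallel 1 idx0 idx1))
  (PAllLine (PImp
    (PAnd (PInc idx0 idx0) (Pparallel 1 idx0 idx2))
    (PEqLine idx1 idx0))))))).
Qed.

Lemma expressible_rel_parallel :
  expressible (fun M => forall l m : pl_line M, pl_rel l m <-> parallel l m).
Proof.
by exists (PAllLine (PAllLine (PAnd
  (PImp (PRel 0 idx1 idx0) (Pparallel 0 idx1 idx0))
  (PImp (Pparallel 0 idx1 idx0) (PRel 0 idx1 idx0))))).
Qed.

Lemma expressible_rel_symmetric :
  expressible (fun M => forall l m : pl_line M, pl_rel l m <-> pl_rel m l).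
Proof.
by exists (PAllLine (PAllLine (PAnd
  (PImp (PRel 0 idx1 idx0) (PRel 0 idx0 idx1))
  (PImp (PRel 0 idx0 idx1) (PRel 0 idx1 idx0))))).
Qed.

Lemma expressible_perpendicular :
  expressible (fun M => forall (P : pl_point M) l, exists! m, pl_rel l m /\ pl_inc P m).
Proof.
by exists (PAllPoint (PAllLine (PExLine (PAnd
  (PAnd (PRel 1 idx1 idx0) (PInc idx0 idx0))
  (PAllLine (PImp
    (PAnd (PRel 1 idx2 idx0) (PInc idx0 idx0))
    (PEqLine idx1 idx0))))))).
Qed.

Lemma expressible_common_perpendicular : expressible (fun M =>
  forall l m n : pl_line M, pl_rel l m /\ pl_rel l n -> parallel m n).
Proof.
by exists (PAllLine (PAllLine (PAllLine (PImp
  (PAnd (PRel 0 idx2 idx1)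
        (PRel 0 idx2 idx0))
  (Pparallel 0 idx1 idx0))))).
Qed.

Lemma expressible_nonisotropic : expressible (fun M =>
  forall P : pl_point M, exists l, pl_inc P l /\ ~ pl_rel l l).
Proof.
by exists (PAllPoint (PExLine (PAnd (PInc idx0 idx0)
  (PNot (PRel 1 idx0 idx0))))).
Qed.

Lemma expressible_heights : expressible heights_concur.
Proof.
pose l1 : var 1 := None.
pose a : var 6 := Some (Some (Some (Some (Some None)))).
pose b : var 6 := Some (Some (Some (Some None))).
pose c : var 6 := Some (Some (Some None)).
pose ha : var 6 := Some (Some None).
pose hb : var 6 := Some None.
pose hc : var 6 := None.
pose A : var 3 := Some (Some None).
pose B : var 3 := Some None.
pose C : var 3 := None.
pose on3 k (x : var k) := PAnd (PInc x ha) (PAnd (PInc x hb) (PInc x hc)).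
exists (PAllPoint (PAllPoint (PAllPoint (PAllLine (PAllLine (PAllLine
  (PAllLine (PAllLine (PAllLine
    (PImp (PNot (Pcollinear 6 A B C))
    (PImp (PAnd (PInc B a) (PInc C a)) (PImp (PAnd (PInc A b) (PInc C b))
    (PImp (PAnd (PInc A c) (PInc B c))
    (PImp (PAnd (PInc A ha) (PRel 3 ha a)) (PImp (PAnd (PInc B hb) (PRel 3 hb b))
    (PImp (PAnd (PInc C hc) (PRel 3 hc c))
    (PExPoint (PAnd (on3 4 None)
      (PAllPoint (PImp (on3 5 None)
        (PEqPoint (Some None : var 5) None))))))))))))))))))))).
move=> M; split=> H P Q R la lb lc ka kb kc ncol.
  move=> Ja Jb Jc Ha Hb Hc.
  have [|X [[? [? ?]] XU]] := H P Q R la lb lc ka kb kc _ Ja Jb Jc Ha Hb Hc.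
    by move=> [l [? [? ?]]]; apply: ncol; exists l.
  exists X; split=> // Y [? ? ?]; exact: XU.
move=> Ja Jb Jc Ha Hb Hc.
have [|X [[? ? ?] XU]] := H P Q R la lb lc ka kb kc _ Ja Jb Jc Ha Hb Hc.
  by move=> [l [? ? ?]]; apply: ncol; exists l.
exists X; split=> // Y [? [? ?]]; exact: XU.
Qed.

End Expressible.

(** * The complex plane *)

Section ComplexPlane.
Variable R : realType.
Local Notation C := R[i].

Lemma pchar_complex : [pchar C] =i pred0.
Proof. exact: Num.Theory.pchar_num. Qed.

Variable r : complex_line R -> complex_line R -> Prop.
Local Notation plane_r := (Plane (@complex_inc R) r).
Let cpt (x y : C) : pl_point plane_r := (x, y).

Lemma complex_equation (a b c : C) : (a, b) <> (0, 0) ->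
  exists l, has_equation cpt l a b c.
Proof.
move=> nz; have L : is_complex_line [set x : C * C | a * x.1 + b * x.2 + c = 0]%classic.
  by exists a, b, c.
by exists (exist _ _ L).
Qed.

Lemma complex_coordinates : affine_coordinates cpt.
Proof.
split.
- by move=> x y x' y' [].
- by move=> [x y]; exists x, y.
- by move=> [L [a [b [c [nz DL]]]]]; exists a, b, c; split=> // x y; rewrite /= /complex_inc /= DL.
- exact: complex_equation.
- move=> [L HL] [L' HL'] /= LL'; apply: eq_exist.
  by apply/seteqP; split=> P; [exact: (LL' P).1|exact: (LL' P).2].
Qed.

Lemma complex_direction l (a b c : C) u : has_equation cpt l a b c ->
  direction l u <-> exists2 t, t != 0 & u = (t * - b, t * a).
Proof.
move=> lE; have [nz _] := lE; split.
  move=> [[x y] [[x' y'] [neq Pl Ql Du]]].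
  have [t [Dx Dy]] := line_parameter lE Pl Ql.
  have Eu : u = (- t * - b, - t * a) by rewrite Du Dx Dy; congr (_, _); rewrite /=; ring.
  exists (- t) => //; rewrite oppr_eq0; apply/eqP => t0; apply: neq.
  by rewrite Dx Dy t0 !mul0r subr0 addr0.
move=> [t nzt ->]; have [x [y [Pl Ql]]] := equation_points lE.
exists (x, y), (x - t * b, y + t * a); split.
- move=> [E1 E2]; apply: nz; apply/eqP; rewrite xpair_eqE.
  have : t * a = 0 by apply: (addrI y); rewrite -E2 addr0.
  have : - (t * b) = 0 by apply: (addrI x); rewrite -E1 addr0.
  by move=> /eqP; rewrite oppr_eq0 mulf_eq0 (negPf nzt) /= => -> /eqP;
    rewrite mulf_eq0 (negPf nzt) /= => ->.
- exact: Pl.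
- apply/(proj2 lE (x - t * b) (y + t * a)); move/(proj2 lE): Pl => Pl.
  by rewrite -[RHS]Pl; ring.
- by congr (_, _); rewrite /=; ring.
Qed.

End ComplexPlane.

Lemma complex_orthogonal_equation (R : realType) :
  rel_equation (M := complex_orthogonal_plane R) (fun x y : R[i] => (x, y)) true.
Proof.
move=> l m a b c a' b' c' lE mE; rewrite /= /rel_form.
have dotE t t' : t * - b * (t' * - b') + t * a * (t' * a') = t * t' * (a * a' + b * b') by ring.
split=> [[u [v [/(complex_direction _ lE)[t nzt ->] /(complex_direction _ mE)[t' nzt' ->]]]]|D].
  rewrite /= dotE => /eqP; rewrite mulf_eq0 mulf_eq0 (negPf nzt) (negPf nzt') /=.
  by move=> /eqP.
exists (1 * - b, 1 * a), (1 * - b', 1 * a'); split.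
- by apply/(complex_direction _ lE); exists 1 => //; exact: oner_neq0.
- by apply/(complex_direction _ mE); exists 1 => //; exact: oner_neq0.
- by rewrite /= dotE D mulr0.
Qed.

(** The frame of a noncollinear triple has [O <> E], and these two points are
    joined by a line. *)
Lemma line_exists (N : plane) : incidence_plane N ->
  (forall p, ACF0 p -> models N (star p)) -> euclidean_parallels N ->
  inhabited (pl_line N).
Proof.
move=> incN starN parN; have [A [B [D ncol]]] := inc_three incN.
have /(line_through incN)[l _] := star_neq01 (starN _ acf_neq01) ncol.
exact: inhabits l.
Qed.

Local Open Scope classical_set_scope.

Theorem theorem4p0p3 (R : realType) :
  axiomatizes (theory_of pappian_parallelity_plane `|` [set star p | p in ACF0])
              (complex_affine_plane R)
  /\
  axiomatizes (theory_of wu_orthogonal_plane `|` [set star p | p in ACF0])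
              (complex_orthogonal_plane R).
Proof.
have charC := pchar_complex R.
have cA : affine_coordinates (M := complex_affine_plane R) (fun x y : R[i] => (x, y)).
  exact: complex_coordinates.
have cO : affine_coordinates (M := complex_orthogonal_plane R) (fun x y : R[i] => (x, y)).
  exact: complex_coordinates.
have relO := @complex_orthogonal_equation R.
have relA : forall l m : pl_line (complex_affine_plane R), pl_rel l m <-> parallel l m by [].
split; split.
- move=> s [thy_s|[p acf_p <-]]; last exact: coordinates_star cA charC acf_p.
  apply: thy_s; split; last exact: coordinates_pappian cA relA.
  split=> //; first exact: coordinates_incidence cA.
  exact: coordinates_parallels cA.
- move=> s Cs N NS.
  have NT t : theory_of pappian_parallelity_plane t -> models N t by move=> ?; apply: NS; left.
  have starN p : ACF0 p -> models N (star p) by move=> ?; apply: NS; right; exists p.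
  have incN : incidence_plane N.
    by apply: theory_inherit expressible_incidence _ NT => M [[]].
  have relN : forall l m : pl_line N, pl_rel l m <-> parallel l m.
    by apply: (theory_inherit expressible_rel_parallel _ NT) => M [[]].
  have parN : euclidean_parallels N.
    apply: (theory_inherit expressible_parallels _ NT) => M [[_ relM parM] _] l A.
    have [m [[Am ml] mU]] := parM l A; exists m; split.
      by split=> //; apply/relM.
    by move=> m' [Am' /relM m'l]; apply: mU.
  have [O [E [E' ncol]]] := inc_three incN.
  have [lx [ly [_ [OEx OEy _]]]] := frame_lines incN parN (line_exists incN starN parN) ncol.
  have [K [pt [cN charK _ _]]] := plane_coordinates incN parN starN ncol OEx OEy.
  have rE := parallel_rel_equation cN relN.
  have rC := parallel_rel_equation cA relA.
  exact: (coordinate_planes_equivalent charC charK cA rC cN rE s).1 Cs.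
- move=> s [thy_s|[p acf_p <-]]; last exact: coordinates_star cO charC acf_p.
  apply: thy_s; exact: coordinates_wu cO relO charC (coordinates_desargues cO).
- move=> s Cs N NS.
  have NT t : theory_of wu_orthogonal_plane t -> models N t by move=> ?; apply: NS; left.
  have starN p : ACF0 p -> models N (star p) by move=> ?; apply: NS; right; exists p.
  have incN : incidence_plane N.
    by apply: theory_inherit expressible_incidence _ NT => M [].
  have parN : euclidean_parallels N.
    by apply: (theory_inherit expressible_parallels _ NT) => M [].
  have symN : forall l m : pl_line N, pl_rel l m <-> pl_rel m l.
    by apply: (theory_inherit expressible_rel_symmetric _ NT) => M [].
  have perpN : forall (P : pl_point N) l, exists! m, pl_rel l m /\ pl_inc P m.
    by apply: (theory_inherit expressible_perpendicular _ NT) => M [].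
  have commonN : forall l m n : pl_line N, pl_rel l m /\ pl_rel l n -> parallel m n.
    by apply: (theory_inherit expressible_common_perpendicular _ NT) => M [].
  have nonisoN : forall P : pl_point N, exists l, pl_inc P l /\ ~ pl_rel l l.
    by apply: (theory_inherit expressible_nonisotropic _ NT) => M [].
  have heightsN : heights_concur N.
    by apply: (theory_inherit expressible_heights _ NT) => M [].
  have [O _] := inc_three incN; have [lx [Ox nlx]] := nonisoN O.
  have [ly [[lxy Oy] _]] := perpN O lx.
  have other l : pl_inc O l -> exists2 P, O <> P & pl_inc P l.
    move=> Ol; have [A [B [nAB Al Bl]]] := inc_two incN l.
    have [eqO|] := pselect (O = A); last by exists A.
    by exists B => //; rewrite eqO.
  have [E nOE Ex] := other lx Ox; have [E' nOE' E'y] := other ly Oy.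
  have ncol : ~ collinear O E E'.
    move=> [l [Ol El E'l]]; apply: nlx.
    have lE := join_unique incN nOE (conj Ol El) (conj Ox Ex).
    rewrite -{2}lE.
    by rewrite (join_unique incN nOE' (conj Ol E'l) (conj Oy E'y)).
  have [K [pt [cN charK lxE lyE]]] := plane_coordinates incN parN starN ncol
    (conj Ox Ex) (conj Oy E'y).
  have [qt [cN' rN]] := orthogonal_coordinates symN perpN commonN heightsN cN lxE lyE lxy.
  exact: (coordinate_planes_equivalent charC charK cO relO cN' rN s).1 Cs.
Qed.
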